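(* Let $M$ be a real-analytic generic submanifold of finite type through $p_0$ in $\mathbb{C}^N$ (of finite type at $p_0$), and let $H\colon(\mathbb{C}^N,p_0)\to(\mathbb{C}^N,\tilde p_0)$ be a germ of a finite holomorphic mapping. Let $\mathcal{M}$ and $\mathcal{H}$ denote the complexifications of $M$ and $H$, respectively. If $\mathcal{H}^{-1}(\mathcal{H}(\mathcal{M}))=\mathcal{M}$, then $$\operatorname{rk}\frac{\partial H}{\partial Z}(p_0)\ \geq\ \operatorname{codim} M,$$ where $\operatorname{rk}$ denotes the rank of a matrix and $\operatorname{codim}M$ is the real codimension of $M$ in $\mathbb{C}^N$.
   Context: All statements about sets and maps are understood in the sense of germs at the relevant base points. $Z=(Z_1,\dots,Z_N)$ are the coordinates in $\mathbb{C}^N$ and $\partial H/\partial Z$ is the holomorphic Jacobian matrix. Finite mapping: a germ of a holomorphic mapping $H\colon(\mathbb{C}^N,p_0)\to(\mathbb{C}^N,\tilde p_0)$ is finite at $p_0$ if $H^{-1}(\tilde p_0)\cap U=\{p_0\}$ for a sufficiently small open neighborhood $U$ of $p_0$. Complexification: if $M$ is a real-analytic submanifold of (real) codimension $d$ given near $p_0$ by $\rho_1(Z,\bar Z)=\dots=\rho_d(Z,\bar Z)=0$, with $\rho_j$ real-valued, real-analytic and with linearly independent differentials, then $\mathcal{M}\subset\mathbb{C}^N\times\mathbb{C}^N$ is the complex submanifold defined near $(p_0,\bar p_0)$ by $\rho_1(Z,\zeta)=\dots=\rho_d(Z,\zeta)=0$. The complexification of $H$ is $\mathcal{H}(Z,\zeta)=(H(Z),\bar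 H(\zeta))$, a germ $(\mathbb{C}^N\times\mathbb{C}^N,(p_0,\bar p_0))\to(\mathbb{C}^N\times\mathbb{C}^N,(\tilde p_0,\overline{\tilde p_0}))$, where $\bar H(\zeta):=\overline{H(\bar\zeta)}$. Generic: $M$ is generic if $T_pM+J(T_pM)=T_p\mathbb{C}^N$ for every $p\in M$, where $T_pM$ is the real tangent space and $J$ is the complex structure on $\mathbb{C}^N$; equivalently $\partial\rho_1\wedge\dots\wedge\partial\rho_d\neq0$ on $M$ near $p_0$. Finite type: a generic submanifold $M$ is of finite type at $p_0$ (in the sense of Kohn and Bloom–Graham) if the complex Lie algebra $\mathfrak{g}_M$ generated by all smooth $(1,0)$ and $(0,1)$ vector fields tangent to $M$ satisfies $\mathfrak{g}_M(p_0)=\mathbb{C}T_{p_0}M$, the complexified tangent space. *)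

(* Defs.v *)
From HB Require Import structures.
From mathcomp Require Import all_boot all_order all_algebra complex.
From mathcomp Require Import all_classical all_reals all_analysis.

Set Implicit Arguments.
Unset Strict Implicit.
Unset Printing Implicit Defensive.

Import Order.TTheory GRing.Theory Num.Theory.
Import numFieldNormedType.Exports.

Local Open Scope classical_set_scope.
Local Open Scope ring_scope.

(* R[i] is a numFieldType, but unification does not find the topology of a
   numFieldType from the head constant [complex]. *)
HB.instance Definition _ (R : realType) := NormedModule.copy R[i] (R[i]^o).

(** * C^N as a real vector space *)

(* The real coordinates of Z are (Re Z_1, ..., Re Z_N, Im Z_1, ..., Im Z_N). *)
Definition to_real (R : realType) (N : nat) (Z : 'rV[R[i]]_N) :
    'rV[R]_(N + N) :=
  row_mx (map_mx (@complex.Re R) Z) (map_mx (@complex.Im R) Z).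

Definition to_complex (R : realType) (N : nat) (x : 'rV[R]_(N + N)) :
    'rV[R[i]]_N :=
  \row_j Complex (x 0 (lshift N j)) (x 0 (rshift N j)).

Definition conj_row (R : realType) (N : nat) (Z : 'rV[R[i]]_N) : 'rV[R[i]]_N :=
  map_mx (@conjc R) Z.

(** * Real-analytic and smooth functions of n real variables *)

Definition monomial (R : realType) (n : nat) (a : 'I_n -> nat)
    (h : 'rV[R]_n) : R :=
  \prod_(i < n) h 0 i ^+ a i.

(* Near x, f is the sum of an absolutely convergent power series centred at x;
   its m-th partial sum runs over the multi-indices with all entries < m. *)
Definition real_analytic_at (R : realType) (n : nat) (f : 'rV[R]_n -> R)
    (x : 'rV[R]_n) : Prop :=
  exists c : {ffun 'I_n -> nat} -> R,
    \forall h \near (0 : 'rV[R]_n),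
      summable [set: {ffun 'I_n -> nat}] (fun a => (c a * monomial a h)%:E) /\
      (fun m : nat => \sum_(a : {ffun 'I_n -> 'I_m})
         c [ffun i => val (a i)] * monomial (fun i => val (a i)) h) @ \oo
        --> f (x + h).

Definition partial (R : realType) (n : nat) (i : 'I_n) (f : 'rV[R]_n -> R) :
    'rV[R]_n -> R :=
  fun x => 'D_(delta_mx 0 i) f x.

(* C^oo near x: all iterated partial derivatives are differentiable. *)
Definition smooth_near (R : realType) (n : nat) (f : 'rV[R]_n -> R)
    (x : 'rV[R]_n) : Prop :=
  \forall y \near x, forall s : seq 'I_n,
    differentiable (foldr (@partial R n) f s) y.

(** * Complex vector fields on C^N *)

Section VectorFields.
Variables (R : realType) (N : nat).
Implicit Types (f : 'rV[R[i]]_N -> R[i]) (Z : 'rV[R[i]]_N).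

Definition re_part f (x : 'rV[R]_(N + N)) : R := complex.Re (f (to_complex x)).

Definition im_part f (x : 'rV[R]_(N + N)) : R := complex.Im (f (to_complex x)).

Definition csmooth_near f Z : Prop :=
  smooth_near (re_part f) (to_real Z) /\ smooth_near (im_part f) (to_real Z).

Definition real_partial (i : 'I_(N + N)) f Z : R[i] :=
  Complex (partial i (re_part f) (to_real Z))
          (partial i (im_part f) (to_real Z)).

Definition dZ (j : 'I_N) f Z : R[i] :=
  (real_partial (lshift N j) f Z - 'i%C * real_partial (rshift N j) f Z) / 2.

Definition dZbar (j : 'I_N) f Z : R[i] :=
  (real_partial (lshift N j) f Z + 'i%C * real_partial (rshift N j) f Z) / 2.

(* The pair (a, b) is the complexified tangent vector
   sum_j a_j d/dZ_j + b_j d/dZbar_j; the real vector v in C^N is (v, conj v). *)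
Definition ctangent_vector : Type := ('rV[R[i]]_N * 'rV[R[i]]_N)%type.

Definition vector_field : Type := 'rV[R[i]]_N -> ctangent_vector.

Implicit Types X Y : vector_field.

Definition vf_smooth_near X Z : Prop :=
  forall j, csmooth_near (fun W => (X W).1 0 j) Z /\
            csmooth_near (fun W => (X W).2 0 j) Z.

Definition vf_apply X f Z : R[i] :=
  \sum_j ((X Z).1 0 j * dZ j f Z + (X Z).2 0 j * dZbar j f Z).

Definition vf_add X Y : vector_field :=
  fun Z => ((X Z).1 + (Y Z).1, (X Z).2 + (Y Z).2).

Definition vf_scale (c : R[i]) X : vector_field :=
  fun Z => (c *: (X Z).1, c *: (X Z).2).

Definition lie_bracket X Y : vector_field := fun Z =>
  (\row_j (vf_apply X (fun W => (Y W).1 0 j) Z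
           - vf_apply Y (fun W => (X W).1 0 j) Z),
   \row_j (vf_apply X (fun W => (Y W).2 0 j) Z
           - vf_apply Y (fun W => (X W).2 0 j) Z)).

End VectorFields.

(** * Germs of real submanifolds *)

Section Submanifolds.
Variables (R : realType) (N d : nat).
Implicit Types (M : set 'rV[R[i]]_N) (rho : 'rV[R[i]]_N -> 'rV[R]_d).

(* The columns of the library's Jacobian 'J are the differentials of the
   components, hence the transpose. *)
Record real_analytic_submanifold M rho (p0 : 'rV[R[i]]_N) : Prop := {
  submanifold_base : M p0 ;
  submanifold_analytic : forall k : 'I_d,
    real_analytic_at (fun x => rho (to_complex x) 0 k) (to_real p0) ;
  submanifold_indep :
    row_free (('J (fun x => rho (to_complex x)) (to_real p0))^T) ;
  submanifold_eq : \forall Z \near p0, M Z <-> rho Z = 0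
}.

Definition tangent_space rho (p : 'rV[R[i]]_N) : set 'rV[R[i]]_N :=
  [set v | 'd (fun x => rho (to_complex x)) (to_real p) (to_real v) = 0].

Definition generic M rho (p0 : 'rV[R[i]]_N) : Prop :=
  \forall p \near p0, M p ->
    [set u + 'i%C *: v | u in tangent_space rho p & v in tangent_space rho p]
      = [set: 'rV[R[i]]_N].

(* C (x) T_pM: the vectors u + i v with u, v real tangent vectors *)
Definition ctangent_space rho (p : 'rV[R[i]]_N) : set (ctangent_vector R N) :=
  [set (u + 'i%C *: v, conj_row u + 'i%C *: conj_row v)
     | u in tangent_space rho p & v in tangent_space rho p].

Definition vf_tangent M rho (p0 : 'rV[R[i]]_N) (X : vector_field R N) : Prop :=
  \forall p \near p0, M p -> ctangent_space rho p (X p).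

(* Vector fields on M are represented by smooth extensions to a neighbourhood
   of p0; the bracket of two tangent fields depends, along M, only on their
   restrictions to M. *)
Inductive lie_algebra M rho (p0 : 'rV[R[i]]_N) : vector_field R N -> Prop :=
| lie_algebra_10 X : vf_smooth_near X p0 -> vf_tangent M rho p0 X ->
    (\forall p \near p0, (X p).2 = 0) -> lie_algebra M rho p0 X
| lie_algebra_01 X : vf_smooth_near X p0 -> vf_tangent M rho p0 X ->
    (\forall p \near p0, (X p).1 = 0) -> lie_algebra M rho p0 X
| lie_algebra_add X Y : lie_algebra M rho p0 X -> lie_algebra M rho p0 Y ->
    lie_algebra M rho p0 (vf_add X Y)
| lie_algebra_scale c X : lie_algebra M rho p0 X ->
    lie_algebra M rho p0 (vf_scale c X)
| lie_algebra_bracket X Y : lie_algebra M rho p0 X -> lie_algebra M rho p0 Y ->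
    lie_algebra M rho p0 (lie_bracket X Y).

Definition finite_type M rho (p0 : 'rV[R[i]]_N) : Prop :=
  [set X p0 | X in lie_algebra M rho p0] = ctangent_space rho p0.

(* rhoC (Z, zeta) is the holomorphic function "rho (Z, zeta)", i.e. the unique
   germ at (p0, conj p0) that restricts to rho on {zeta = conj Z}. *)
Record complexification rho (p0 : 'rV[R[i]]_N)
    (rhoC : 'rV[R[i]]_N * 'rV[R[i]]_N -> 'rV[R[i]]_d) : Prop := {
  complexification_holomorphic :
    \forall w \near (p0, conj_row p0), differentiable rhoC w ;
  complexification_diagonal :
    \forall Z \near p0, rhoC (Z, conj_row Z) = map_mx (real_complex R) (rho Z)
}.

End Submanifolds.

(** * Germs of holomorphic maps *)

Definition holomorphic_germ (R : realType) (N : nat)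
    (H : 'rV[R[i]]_N -> 'rV[R[i]]_N) (p0 q0 : 'rV[R[i]]_N) : Prop :=
  H p0 = q0 /\ \forall Z \near p0, differentiable H Z.

Definition finite_germ (R : realType) (N : nat)
    (H : 'rV[R[i]]_N -> 'rV[R[i]]_N) (p0 q0 : 'rV[R[i]]_N) : Prop :=
  exists U : set 'rV[R[i]]_N,
    open_nbhs p0 U /\ H @^-1` [set q0] `&` U = [set p0].

Definition complexify_map (R : realType) (N : nat)
    (H : 'rV[R[i]]_N -> 'rV[R[i]]_N) (w : 'rV[R[i]]_N * 'rV[R[i]]_N) :
    'rV[R[i]]_N * 'rV[R[i]]_N :=
  (H w.1, conj_row (H (conj_row w.2))).

(* F^-1(F(A)) = A as germs at p.  The germ of F(A) at F(p) is that of
   F(A `&` U) for all sufficiently small neighbourhoods U of p; for finite F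
   it does not depend on U. *)
Definition germ_saturated (S T : topologicalType) (F : S -> T) (A : set S)
    (p : S) : Prop :=
  exists U0 : set S, nbhs p U0 /\
    forall U : set S, nbhs p U -> U `<=` U0 ->
      \forall w \near p, (F @^-1` (F @` (A `&` U))) w <-> A w.

(* Main.v *)
Require Import Defs.
From HB Require Import structures.
From mathcomp Require Import all_boot all_order all_algebra complex.
From mathcomp Require Import all_classical all_reals all_analysis.
From mathcomp Require Import perm ring lra zify.
Import Order.TTheory GRing.Theory Num.Theory.
Import numFieldNormedType.Exports.
Set Implicit Arguments.
Unset Strict Implicit.
Unset Printing Implicit Defensive.
Local Open Scope classical_set_scope.
Local Open Scope ring_scope.

(** Write [D] for the differential of [rhoC] at the base point
    [(p0, conj_row p0)] and [D_Z], [D_zeta] for its restrictions to the two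
    factors.  Genericity makes both of them onto
    ([partial_differentials_onto]), so [D_Z] has rank [d] and it suffices to
    show that the kernel of the Jacobian of [H] is contained in the kernel of
    [D_Z].

    Saturation gives the complexification a product structure along the
    fibres of [H]: if [(Z, zeta)] lies on it and [H Z' = H Z], then [(Z', zeta)]
    lies on it, because both points have the same image.  Parametrise [zeta] by
    [eta] through a right inverse of [D_zeta] and let [g (Z, eta)] be the
    resulting function; its partial differential in [eta] is the identity.
    The map [(H - q0, g)] of [C^(N + d)] has an isolated zero at the origin, hence is
    onto near it ([finite_map_onto]).  Let [v] be in the kernel of the
    Jacobian of [H].  Over [(H (p0 + t v) - q0, 0)] there is a point [(Z, eta)], and
    saturation moves it to [g (t v, eta) = 0].  As [g (t v, _)] is
    injective, [eta] is the same for all points of the fibre: the coordinate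
    functions [eta_j] are constant on the fibre of a finite map over a point of
    size [O(t^2)].  The estimate [fiber_value_estimate] then gives
    [eta = O(t^2)], and the expansion of [g (t v, eta) = 0] reads
    [t D_Z v = O(t^2)], so that [D_Z v = 0] ([kernel_transversal]).

    The estimate says that a holomorphic [u] with [u 0 = 0] which
    takes only the value [c] on the fibre of [F] over [W] satisfies
    [|c| <= const * |W|].  (Without constancy on the fibre only a fractional
    power of [|W|] could be expected.)  Its proof replaces the trace of [u] by
    the quotients of the weighted means
    [m_k = int |det F'|^2 w_k] and
    [I_k = int (conj u) |det F'|^2 w_k], where
    [w_k] is the [k]-th power of the positive part of [1 - |F - W|^2 / eps^2].
    Integration by parts against the radial field pulled back by [F] - the
    cofactors of a Jacobian are divergence free ([piola]), and
    [(conj u) (conj (det F'))] is annihilated by [d/dZ] - shows that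
    [I_(k+1) = r_k I_1] with ratios [r_k] that do not depend on [u], in
    particular are those of [m_k] ([weight_recurrence]).  For large
    [k] the weight [w_k] concentrates at the fibre while [r_k] decays only
    polynomially, so [I_2] is arbitrarily close to [(conj c) m_2]
    ([concentration]).  Since [w_2] depends on [W] in a Lipschitz way, with
    a constant controlled by [w_1], comparing [W] with [0], where the value is
    [u 0 = 0], bounds [c].  A small multiple of the identity is added to [F] to
    make its Jacobian at the origin invertible and hence [m_2] positive; it
    tends to [0] at the end.

    The integral over [C^n] is the limit, along a fixed ultrafilter, of
    averages over finer and finer grids in a cube ([cube_mean]): only linearity,
    positivity and the vanishing of the mean of a derivative are used.
    From the theory of one complex variable, Goursat's theorem for squares and
    Cauchy's estimate are enough. *)

(** * The modulus of a complex number *)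

Section ComplexModulus.
Variable R : realType.
Local Notation C := R[i].
Implicit Types (x y z w : C) (a b c e t : R).

(** The norm [`|z|] of [z : R[i]] is itself an element of [R[i]], whose order is
    partial; the modulus with values in [R] allows case distinctions and linear
    arithmetic. *)
Definition modc z : R := ComplexField.Normc.normc z.

Lemma modcE a b : modc (Complex a b) = Num.sqrt (a ^+ 2 + b ^+ 2).
Proof. by []. Qed.

Lemma modc_sqr z : modc z ^+ 2 = complex.Re z ^+ 2 + complex.Im z ^+ 2.
Proof. by case: z => a b; rewrite modcE sqr_sqrtr// addr_ge0// sqr_ge0. Qed.

Lemma modc0 : modc 0 = 0. Proof. exact: ComplexField.Normc.normc0. Qed.
Lemma modc1 : modc 1 = 1. Proof. exact: ComplexField.Normc.normc1. Qed.
Lemma modc_ge0 z : 0 <= modc z. Proof. by case: z => a b; apply: sqrtr_ge0. Qed.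
Lemma modc_eq0 z : modc z = 0 -> z = 0.
Proof. exact: ComplexField.Normc.eq0_normc. Qed.
Lemma modc_gt0 z : (0 < modc z) = (z != 0).
Proof.
rewrite lt0r modc_ge0 andbT; congr (~~ _); apply/eqP/eqP; first exact: modc_eq0.
by move=> ->; exact: modc0.
Qed.
Lemma modcM x y : modc (x * y) = modc x * modc y.
Proof. exact: ComplexField.Normc.normcM. Qed.
Lemma modcV x : modc x^-1 = (modc x)^-1.
Proof. exact: ComplexField.Normc.normcV. Qed.
Lemma modcX x n : modc (x ^+ n) = modc x ^+ n.
Proof. by elim: n => [|n IH]; rewrite ?expr0 ?modc1// !exprS modcM IH. Qed.
Lemma modcD x y : modc (x + y) <= modc x + modc y.
Proof. exact: le_normcD. Qed.
Lemma modcN x : modc (- x) = modc x.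
Proof. exact: normcN. Qed.
Lemma modcB x y : modc (x - y) <= modc x + modc y.
Proof. by rewrite -(modcN y); exact: modcD. Qed.
Lemma modcBC x y : modc (x - y) = modc (y - x).
Proof. by rewrite -opprB modcN. Qed.
Lemma modc_real a : modc a%:C%C = `|a|.
Proof. by rewrite /real_complex_def modcE expr0n addr0 sqrtr_sqr. Qed.
Lemma modc_conj z : modc (conjc z) = modc z.
Proof. by case: z => a b; rewrite /conjc !modcE sqrrN. Qed.
Lemma modc_i : modc 'i%C = 1.
Proof. by rewrite modcE expr0n add0r expr1n sqrtr1. Qed.
Lemma Re_le_modc z : `|complex.Re z| <= modc z.
Proof.
rewrite -(ler_pXn2r (n := 2))// ?nnegrE ?modc_ge0// modc_sqr real_normK ?num_real//.
by rewrite lerDl sqr_ge0.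
Qed.
Lemma Im_le_modc z : `|complex.Im z| <= modc z.
Proof.
rewrite -(ler_pXn2r (n := 2))// ?nnegrE ?modc_ge0// modc_sqr real_normK ?num_real//.
by rewrite lerDr sqr_ge0.
Qed.
Lemma modc_le_ReIm z : modc z <= `|complex.Re z| + `|complex.Im z|.
Proof.
rewrite -(ler_pXn2r (n := 2))// ?nnegrE ?modc_ge0 ?addr_ge0// modc_sqr sqrrD.
rewrite !real_normK ?num_real// -addrA lerD2l lerDr mulrn_wge0//.
Qed.
Lemma modc_sum (I : Type) (r : seq I) (P : pred I) (F : I -> C) :
  modc (\sum_(i <- r | P i) F i) <= \sum_(i <- r | P i) modc (F i).
Proof.
elim/big_rec2: _ => [|i s S _ H]; first by rewrite modc0.
by apply: le_trans (modcD _ _) _; rewrite lerD2l.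
Qed.
Lemma Re_add x y : complex.Re (x + y) = complex.Re x + complex.Re y.
Proof. by case: x y => [a b] [c d]. Qed.
Lemma Im_add x y : complex.Im (x + y) = complex.Im x + complex.Im y.
Proof. by case: x y => [a b] [c d]. Qed.
Lemma Re_opp x : complex.Re (- x) = - complex.Re x.
Proof. by case: x. Qed.
Lemma Im_opp x : complex.Im (- x) = - complex.Im x.
Proof. by case: x. Qed.
Lemma Re_mul x y : complex.Re (x * y) =
  complex.Re x * complex.Re y - complex.Im x * complex.Im y.
Proof. by case: x y => [a b] [c d]. Qed.
Lemma Im_mul x y : complex.Im (x * y) =
  complex.Re x * complex.Im y + complex.Im x * complex.Re y.
Proof. by case: x y => [a b] [c d]. Qed.
Lemma complex_eqP x y :
  complex.Re x = complex.Re y -> complex.Im x = complex.Im y -> x = y.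
Proof. by case: x y => [a b] [c d] /= -> ->. Qed.

End ComplexModulus.

Arguments modc : simpl never.

(** * Goursat's theorem and Cauchy's estimate *)

Section SegmentIntegral.
Variable R : realType.
Local Notation C := R[i].
Local Notation mu := (@lebesgue_measure R).
Implicit Types (f g : R -> C) (a b : R).

Definition continuous_on_segment a b f := forall t, a <= t <= b ->
  forall e, 0 < e -> exists2 d, 0 < d &
    forall s, a <= s <= b -> `|s - t| < d -> modc (f s - f t) <= e.

(** Integrals are only needed along horizontal and vertical segments, so the
    path is always parametrised by one real coordinate. *)
Definition segment_integral a b f : C :=
  Complex (\int[mu]_(t in `[a, b]) complex.Re (f t))
          (\int[mu]_(t in `[a, b]) complex.Im (f t)).

Lemma continuous_on_segmentZ a b (c : C) f : continuous_on_segment a b f ->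
  continuous_on_segment a b (fun t => c * f t).
Proof.
move=> cf t tab e e0.
have c0 : 0 < modc c + 1 by have := modc_ge0 c; lra.
have [d d0 H] := cf t tab (e / (modc c + 1)) (divr_gt0 e0 c0).
exists d => // s sab st; rewrite -mulrBr modcM.
have := H s sab st; rewrite ler_pdivlMr//; have := modc_ge0 (f s - f t).
by have := modc_ge0 c; nra.
Qed.

Lemma continuous_on_segment_part a b f (p : C -> R) :
    (forall z w, `|p z - p w| <= modc (z - w)) ->
    continuous_on_segment a b f ->
  mu.-integrable `[a, b] (EFin \o (p \o f)).
Proof.
move=> Hp cf; apply: continuous_compact_integrable; first exact: segment_compact.
apply/subspace_continuousP => t /=; rewrite in_itv/= => tab.
apply/cvgrPdist_le => e e0; have [d d0 H] := cf t tab e e0.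
rewrite /prop_near1 /within /=; exists d => //= s ts; rewrite in_itv/= => sab.
apply: le_trans (Hp _ _) _; rewrite modcBC; apply: H => //.
by rewrite distrC.
Qed.

Lemma Re_integrable a b f : continuous_on_segment a b f ->
  mu.-integrable `[a, b] (EFin \o (fun t => complex.Re (f t))).
Proof.
apply: (@continuous_on_segment_part a b f (@complex.Re R)) => z w.
by rewrite -Re_opp -Re_add Re_le_modc.
Qed.

Lemma Im_integrable a b f : continuous_on_segment a b f ->
  mu.-integrable `[a, b] (EFin \o (fun t => complex.Im (f t))).
Proof.
apply: (@continuous_on_segment_part a b f (@complex.Im R)) => z w.
by rewrite -Im_opp -Im_add Im_le_modc.
Qed.

Let mE a b : measurable (`[a, b]%classic : set (measurableTypeR R)).
Proof. exact: measurable_itv. Qed.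

Lemma segment_integralD a b f g : continuous_on_segment a b f ->
    continuous_on_segment a b g ->
  segment_integral a b (fun t => f t + g t) =
  segment_integral a b f + segment_integral a b g.
Proof.
move=> cf cg; apply: complex_eqP => /=.
  under eq_Rintegral do rewrite Re_add.
  by rewrite RintegralD//; apply: Re_integrable.
under eq_Rintegral do rewrite Im_add.
by rewrite RintegralD//; apply: Im_integrable.
Qed.

Lemma segment_integralZ a b (c : C) f : continuous_on_segment a b f ->
  segment_integral a b (fun t => c * f t) = c * segment_integral a b f.
Proof.
move=> cf; have i1 := Re_integrable cf; have i2 := Im_integrable cf.
have iZ (r : R) (h : R -> R) : mu.-integrable `[a, b] (EFin \o h) ->
    mu.-integrable `[a, b] (EFin \o (fun t => r * h t)).
  by move=> ih; have := integrableZl (mE a b) r ih.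
apply: complex_eqP => /=.
  under eq_Rintegral do rewrite Re_mul.
  by rewrite RintegralB ?iZ// !RintegralZl// Re_mul.
under eq_Rintegral do rewrite Im_mul.
by rewrite RintegralD ?iZ// !RintegralZl// Im_mul.
Qed.

Lemma segment_integralB a b f g : continuous_on_segment a b f ->
    continuous_on_segment a b g ->
  segment_integral a b (fun t => f t - g t) =
  segment_integral a b f - segment_integral a b g.
Proof.
move=> cf cg; rewrite -[X in _ = _ + X]mulN1r -segment_integralZ//.
rewrite -segment_integralD//; last exact: continuous_on_segmentZ.
by congr segment_integral; apply/funext => t; rewrite mulN1r.
Qed.

Lemma eq_segment_integral a b f g : (forall t, a <= t <= b -> f t = g t) ->
  segment_integral a b f = segment_integral a b g.
Proof.
move=> fg; congr Complex; apply: eq_Rintegral => t; rewrite inE/= in_itv/= => tab;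
  by rewrite fg.
Qed.

Let mu_seg a b : a <= b -> fine (mu `[a, b]) = b - a.
Proof.
move=> ab; rewrite lebesgue_measure_itv/= lte_fin; case: ltP => //= ba.
by have -> : a = b by [lra]; rewrite subrr.
Qed.

Lemma segment_integral_cst a b (c : C) : a <= b ->
  segment_integral a b (fun=> c) = (b - a)%:C%C * c.
Proof.
move=> ab; apply: complex_eqP; rewrite /segment_integral /=.
  by rewrite Rintegral_cst// mu_seg// Re_mul/= mul0r subr0 mulrC.
by rewrite Rintegral_cst// mu_seg// Im_mul/= mul0r addr0 mulrC.
Qed.

Lemma segment_integral_split a b c f : a <= b -> b <= c ->
    continuous_on_segment a c f ->
  segment_integral a c f = segment_integral a b f + segment_integral b c f.
Proof.
move=> ab bc cf.
have key (h : R -> R) : mu.-integrable `[a, c] (EFin \o h) ->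
    \int[mu]_(t in `[a, c]) h t =
    \int[mu]_(t in `[a, b]) h t + \int[mu]_(t in `[b, c]) h t.
  move=> ih; rewrite -(@Rintegral_itv_obnd_cbnd _ b).
    by rewrite -(Rintegral_itvB ih) ?bnd_simp// addrC subrK.
  by apply: integrableS ih => //; apply: subset_itvr; rewrite bnd_simp.
apply: complex_eqP => /=; apply: key; [exact: Re_integrable|exact: Im_integrable].
Qed.

(** The factor [2] comes from estimating real and imaginary part separately;
    none of the constants below is sharp. *)
Lemma modc_segment_integral a b f (B : R) : a <= b ->
    continuous_on_segment a b f -> (forall t, a <= t <= b -> modc (f t) <= B) ->
  modc (segment_integral a b f) <= 2 * ((b - a) * B).
Proof.
move=> ab cf fB.
have key (h : R -> R) : mu.-integrable `[a, b] (EFin \o h) ->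
    (forall t, a <= t <= b -> `|h t| <= B) ->
    `|\int[mu]_(t in `[a, b]) h t| <= (b - a) * B.
  move=> ih hB; apply: le_trans (le_normr_Rintegral (mE a b) ih) _.
  rewrite [leRHS]mulrC -(mu_seg ab) -(@Rintegral_cst _ _ _ mu)//.
  have iB : mu.-integrable `[a, b] (EFin \o (fun=> B)).
    apply: continuous_compact_integrable; first exact: segment_compact.
    exact/continuous_subspaceT/cst_continuous.
  apply: (le_Rintegral (mE a b) (integrable_norm ih) iB).
  by move=> t /=; rewrite in_itv/=; exact: hB.
apply: le_trans (modc_le_ReIm _) _; rewrite [leRHS]mulr_natl mulr2n; apply: lerD.
  apply: key; first exact: Re_integrable.
  by move=> t /fB; apply: le_trans; exact: Re_le_modc.
apply: key; first exact: Im_integrable.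
by move=> t /fB; apply: le_trans; exact: Im_le_modc.
Qed.

Lemma Im_segment_integral_ge a b f (B : R) : a <= b ->
    continuous_on_segment a b f -> (forall t, a <= t <= b -> B <= complex.Im (f t)) ->
  (b - a) * B <= complex.Im (segment_integral a b f).
Proof.
move=> ab cf fB.
rewrite [leLHS]mulrC -(mu_seg ab) -(@Rintegral_cst _ _ _ mu)//=.
have iB : mu.-integrable `[a, b] (EFin \o (fun=> B)).
  apply: continuous_compact_integrable; first exact: segment_compact.
  exact/continuous_subspaceT/cst_continuous.
apply: (le_Rintegral (mE a b) iB (Im_integrable cf)).
by move=> t /=; rewrite in_itv/=; exact: fB.
Qed.

End SegmentIntegral.

Arguments segment_integral : simpl never.

Section Goursat.
Variable R : realType.
Local Notation C := R[i].
Implicit Types (F G : C -> C) (z a c : C) (x y h t : R).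

(** The error is required to be [<=] a multiple of the increment, so that the
    increment [0] needs no exception. *)
Definition complex_derivative_at F z a := forall e, 0 < e ->
  exists2 d, 0 < d & forall h : C, modc h < d ->
    modc (F (z + h) - F z - a * h) <= e * modc h.

Definition continuous_atC F z := forall e, 0 < e ->
  exists2 d, 0 < d & forall h : C, modc h < d -> modc (F (z + h) - F z) <= e.

Definition in_square x y h z :=
  (x <= complex.Re z <= x + h) /\ (y <= complex.Im z <= y + h).

Lemma complex_derivative_continuous F z a :
  complex_derivative_at F z a -> continuous_atC F z.
Proof.
move=> dF e e0; have [d d0 H] := dF 1 ltr01.
have A0 : 0 < modc a + 1 by have := modc_ge0 a; lra.
exists (Num.min d (e / (modc a + 1))); first by rewrite lt_min d0 divr_gt0.
move=> h; rewrite lt_min => /andP[hd]; rewrite ltr_pdivlMr// => he.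
have := H h hd; have := modcD (F (z + h) - F z - a * h) (a * h).
by rewrite subrK modcM; have := modc_ge0 h; nra.
Qed.

Definition hor_integral F x y h := segment_integral x (x + h) (fun t => F (Complex t y)).
Definition ver_integral F x y h := segment_integral y (y + h) (fun t => F (Complex x t)).

(** The contour integral of [F] along the boundary of the square with lower
    left corner [x + i y] and side [h]. *)
Definition square_contour F x y h : C :=
  hor_integral F x y h - hor_integral F x (y + h) h + 'i%C * (ver_integral F (x + h) y h - ver_integral F x y h).

Lemma continuous_hor F x y x' : (forall t, x <= t <= x' ->
    continuous_atC F (Complex t y)) ->
  continuous_on_segment x x' (fun t => F (Complex t y)).
Proof.
move=> cF t tab e e0; have [d d0 H] := cF t tab e e0.
exists d => // s sab st; have := H (Complex (s - t) 0).
have -> : Complex t y + Complex (s - t) 0 = Complex s y.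
  by apply: complex_eqP => /=; ring.
by apply; rewrite -[Complex _ _]/((s - t)%:C)%C modc_real.
Qed.

Lemma continuous_ver F x y y' : (forall t, y <= t <= y' ->
    continuous_atC F (Complex x t)) ->
  continuous_on_segment y y' (fun t => F (Complex x t)).
Proof.
move=> cF t tab e e0; have [d d0 H] := cF t tab e e0.
exists d => // s sab st; have := H (Complex 0 (s - t)).
have -> : Complex x t + Complex 0 (s - t) = Complex x s.
  by apply: complex_eqP => /=; ring.
by apply; rewrite modcE expr0n add0r sqrtr_sqr.
Qed.

Definition on_boundary x y h z := in_square x y h z /\
  [\/ complex.Re z = x, complex.Re z = x + h, complex.Im z = y |
      complex.Im z = y + h].

Section Boundary.
Variables (x y h : R).
Hypothesis h0 : 0 <= h.

Let bnd1 t : x <= t <= x + h -> on_boundary x y h (Complex t y).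
Proof. by move=> H; split; [split => //=; lra|apply: Or43]. Qed.
Let bnd2 t : x <= t <= x + h -> on_boundary x y h (Complex t (y + h)).
Proof. by move=> H; split; [split => //=; lra|apply: Or44]. Qed.
Let bnd3 t : y <= t <= y + h -> on_boundary x y h (Complex x t).
Proof. by move=> H; split; [split => //=; lra|apply: Or41]. Qed.
Let bnd4 t : y <= t <= y + h -> on_boundary x y h (Complex (x + h) t).
Proof. by move=> H; split; [split => //=; lra|apply: Or42]. Qed.

Let sides F : (forall z, on_boundary x y h z -> continuous_atC F z) ->
  [/\ continuous_on_segment x (x + h) (fun t => F (Complex t y)),
      continuous_on_segment x (x + h) (fun t => F (Complex t (y + h))),
      continuous_on_segment y (y + h) (fun t => F (Complex x t)) &
      continuous_on_segment y (y + h) (fun t => F (Complex (x + h) t))].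
Proof.
by move=> cF; split; (apply: continuous_hor || apply: continuous_ver) => // t ht;
  apply: cF; auto.
Qed.

Lemma square_contourD F G :
    (forall z, on_boundary x y h z -> continuous_atC F z) ->
    (forall z, on_boundary x y h z -> continuous_atC G z) ->
  square_contour (fun z => F z + G z) x y h =
  square_contour F x y h + square_contour G x y h.
Proof.
move=> /sides[F1 F2 F3 F4] /sides[G1 G2 G3 G4].
by rewrite /square_contour /hor_integral /ver_integral !segment_integralD//; ring.
Qed.

Lemma square_contourZ c F :
    (forall z, on_boundary x y h z -> continuous_atC F z) ->
  square_contour (fun z => c * F z) x y h = c * square_contour F x y h.
Proof.
move=> /sides[F1 F2 F3 F4].
by rewrite /square_contour /hor_integral /ver_integral !segment_integralZ//; ring.
Qed.

Lemma modc_square_contour F (B : R) :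
    (forall z, on_boundary x y h z -> continuous_atC F z) ->
    (forall z, on_boundary x y h z -> modc (F z) <= B) ->
  modc (square_contour F x y h) <= 8 * h * B.
Proof.
move=> /sides[F1 F2 F3 F4] FB.
have xh : x <= x + h by rewrite lerDl.
have yh : y <= y + h by rewrite lerDl.
have := modc_segment_integral xh F1 (fun t ht => FB _ (bnd1 ht)).
have := modc_segment_integral xh F2 (fun t ht => FB _ (bnd2 ht)).
have := modc_segment_integral yh F3 (fun t ht => FB _ (bnd3 ht)).
have := modc_segment_integral yh F4 (fun t ht => FB _ (bnd4 ht)).
rewrite -/(hor_integral F x y h) -/(hor_integral F x (y + h) h) -/(ver_integral F x y h).
rewrite -/(ver_integral F (x + h) y h) /square_contour.
set H1 := hor_integral F x y h; set H2 := hor_integral F _ _ _; set V1 := ver_integral F x y h.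
set V2 := ver_integral F _ _ _.
have := modcD (H1 - H2) ('i%C * (V2 - V1)); have := modcB H1 H2.
have := modcB V2 V1; rewrite modcM modc_i mul1r; nra.
Qed.

(** Used for [1 / z], whose contour integral has positive imaginary part on
    each of the four sides. *)
Lemma Im_square_contour_ge F (B : R) :
    (forall z, on_boundary x y h z -> continuous_atC F z) ->
    (forall t, x <= t <= x + h -> B <= complex.Im (F (Complex t y))) ->
    (forall t, x <= t <= x + h -> B <= - complex.Im (F (Complex t (y + h)))) ->
    (forall t, y <= t <= y + h -> B <= complex.Re (F (Complex (x + h) t))) ->
    (forall t, y <= t <= y + h -> B <= - complex.Re (F (Complex x t))) ->
  4 * (h * B) <= complex.Im (square_contour F x y h).
Proof.
move=> /sides[F1 F2 F3 F4] B1 B2 B3 B4.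
have xh : x <= x + h by rewrite lerDl.
have yh : y <= y + h by rewrite lerDl.
have E1 := Im_segment_integral_ge xh F1 B1.
have E2 : (x + h - x) * B <= complex.Im (-1 * hor_integral F x (y + h) h).
  rewrite -segment_integralZ//; apply: Im_segment_integral_ge => //.
    exact: continuous_on_segmentZ.
  by move=> t /B2; rewrite mulN1r Im_opp.
have E3 : (y + h - y) * B <= complex.Im ('i%C * ver_integral F (x + h) y h).
  rewrite -segment_integralZ//; apply: Im_segment_integral_ge => //.
    exact: continuous_on_segmentZ.
  by move=> t /B3; rewrite Im_mul/=; lra.
have E4 : (y + h - y) * B <= complex.Im ((- 'i%C) * ver_integral F x y h).
  rewrite -segment_integralZ//; apply: Im_segment_integral_ge => //.
    exact: continuous_on_segmentZ.
  by move=> t /B4; rewrite Im_mul/=; lra.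
move: E1 E2 E3 E4; rewrite -/(hor_integral F x y h) /square_contour.
move: (hor_integral F x y h) (hor_integral F _ _ _) (ver_integral F x y h) (ver_integral F _ _ _).
by move=> [a b] [c d] [e f] [g k] /=; lra.
Qed.

End Boundary.

Lemma square_contour_affine x y h a c : 0 <= h ->
  square_contour (fun z => a * z + c) x y h = 0.
Proof.
move=> h0; rewrite /square_contour /hor_integral /ver_integral.
have xh : x <= x + h by rewrite lerDl.
have yh : y <= y + h by rewrite lerDl.
have Lin : forall z, continuous_atC (fun z => a * z + c) z.
  move=> z; apply: (@complex_derivative_continuous _ _ a) => e e0; exists 1 => // k _.
  rewrite (_ : _ - _ - _ = 0); first by rewrite modc0 mulr_ge0// ?modc_ge0 ?ltW.
  by ring.
have Lh u v w : continuous_on_segment u v (fun t => a * Complex t w + c).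
  by apply: (continuous_hor (F := fun z => a * z + c)) => *; apply: Lin.
have Lv u v w : continuous_on_segment u v (fun t => a * Complex w t + c).
  by apply: (continuous_ver (F := fun z => a * z + c)) => *; apply: Lin.
rewrite -!segment_integralB//.
rewrite (@eq_segment_integral _ x (x + h) _ (fun=> - a * Complex 0 h)); last first.
  move=> t _; have -> : Complex t (y + h) = Complex t y + Complex 0 h.
    by apply: complex_eqP => /=; ring.
  by ring.
rewrite (@eq_segment_integral _ y (y + h) _ (fun=> a * Complex h 0)); last first.
  move=> t _; have -> : Complex (x + h) t = Complex x t + Complex h 0.
    by apply: complex_eqP => /=; ring.
  by ring.
rewrite !segment_integral_cst// (_ : x + h - x = h); last by ring.
rewrite (_ : y + h - y = h); last by ring.
rewrite (_ : Complex 0 h = 'i%C * Complex h 0); first by rewrite -[_%:C%C]/(Complex h 0); ring.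
by apply: complex_eqP => /=; ring.
Qed.

(** The integrals over interior edges cancel.  Nine subsquares instead of four
    leave the centre in the interior of one of them, as [contour_removable]
    requires. *)
Lemma square_contour_split F x y h : 0 <= h ->
    (forall (i j : 'I_3) z,
      on_boundary (x + h * i%:R) (y + h * j%:R) h z -> continuous_atC F z) ->
  square_contour F x y (h * 3) =
  \sum_(i < 3) \sum_(j < 3) square_contour F (x + h * i%:R) (y + h * j%:R) h.
Proof.
move=> h0 cF.
have split3 (f : R -> C) u : continuous_on_segment u (u + h) f ->
    continuous_on_segment (u + h * 1) (u + h * 1 + h) f ->
    continuous_on_segment (u + h * 2) (u + h * 2 + h) f ->
    segment_integral u (u + h * 3) f = segment_integral u (u + h) f +
      segment_integral (u + h * 1) (u + h * 1 + h) f +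
      segment_integral (u + h * 2) (u + h * 2 + h) f.
  move=> c1 c2 c3.
  have e1 : u + h * 1 = u + h by ring.
  have e2 : u + h * 1 + h = u + h * 2 by ring.
  have e3 : u + h * 2 + h = u + h * 3 by ring.
  rewrite e2 e3 in c2 c3 *; rewrite e1 in c2 *.
  have join p q r (g : R -> C) : continuous_on_segment p q g ->
      continuous_on_segment q r g -> continuous_on_segment p r g.
    move=> g1 g2 t tp e e0.
    have [tq|qt|tq] := ltgtP t q.
    - have [|d d0 H] := g1 t _ e e0; first by rewrite (ltW tq) andbT; case/andP: tp.
      exists (Num.min d (q - t)); first by rewrite lt_min d0 subr_gt0.
      move=> s /andP[s1 s2]; rewrite lt_min => /andP[sd sq]; apply: H => //.
      by rewrite s1; move: sq; rewrite ltr_norml; lra.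
    - have [|d d0 H] := g2 t _ e e0; first by rewrite (ltW qt)/=; case/andP: tp.
      exists (Num.min d (t - q)); first by rewrite lt_min d0 subr_gt0.
      move=> s /andP[s1 s2]; rewrite lt_min => /andP[sd sq]; apply: H => //.
      by rewrite s2 andbT; move: sq; rewrite ltr_norml; lra.
    - have [|d1 d10 H1] := g1 t _ e e0; first by rewrite tq lexx -tq; case/andP: tp => ->.
      have [|d2 d20 H2] := g2 t _ e e0; first by rewrite tq lexx -tq; case/andP: tp => _ ->.
      exists (Num.min d1 d2); first by rewrite lt_min d10.
      move=> s /andP[s1 s2]; rewrite lt_min => /andP[sd1 sd2].
      by have [sq|sq] := leP s q; [apply: H1|apply: H2] => //; rewrite ?s1 ?s2 ?sq// ltW.
  have u1 : u <= u + h by lra.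
  have u2 : u + h <= u + h * 2 by lra.
  have u3 : u + h * 2 <= u + h * 3 by lra.
  have c23 := join _ _ _ _ c2 c3.
  rewrite (segment_integral_split u1 (le_trans u2 u3) (join _ _ _ _ c1 c23)).
  by rewrite (segment_integral_split u2 u3 c23) addrA.
have E0 (u : R) : u + h * 0%:R = u by rewrite mulr0 addr0.
have bx (i j : 'I_3) : continuous_on_segment (x + h * i%:R) (x + h * i%:R + h)
    (fun t => F (Complex t (y + h * j%:R))).
  apply: continuous_hor => // t ht; apply: (cF i j).
  by split; [split => //=; lra|apply: Or43].
have bx' (i : 'I_3) : continuous_on_segment (x + h * i%:R) (x + h * i%:R + h)
    (fun t => F (Complex t (y + h * 3))).
  apply: continuous_hor => // t ht; apply: (cF i (@Ordinal 3 2 isT)).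
  by split; [split => //=; lra|apply: Or44 => /=; ring].
have by_ (i j : 'I_3) : continuous_on_segment (y + h * j%:R) (y + h * j%:R + h)
    (fun t => F (Complex (x + h * i%:R) t)).
  apply: continuous_ver => // t ht; apply: (cF i j).
  by split; [split => //=; lra|apply: Or41].
have by' (j : 'I_3) : continuous_on_segment (y + h * j%:R) (y + h * j%:R + h)
    (fun t => F (Complex (x + h * 3) t)).
  apply: continuous_ver => // t ht; apply: (cF (@Ordinal 3 2 isT) j).
  by split; [split => //=; lra|apply: Or42 => /=; ring].
pose o0 := @Ordinal 3 0 isT; pose o1 := @Ordinal 3 1 isT; pose o2 := @Ordinal 3 2 isT.
have H0 : hor_integral F x y (h * 3) = hor_integral F x y h + hor_integral F (x + h * 1) y h + hor_integral F (x + h * 2) y h.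
  by apply: split3; [have := bx o0 o0|have := bx o1 o0|have := bx o2 o0]; rewrite /= ?E0.
have H3 : hor_integral F x (y + h * 3) (h * 3) = hor_integral F x (y + h * 3) h +
    hor_integral F (x + h * 1) (y + h * 3) h + hor_integral F (x + h * 2) (y + h * 3) h.
  by apply: split3; [have := bx' o0|have := bx' o1|have := bx' o2]; rewrite /= ?E0.
have V0 : ver_integral F x y (h * 3) = ver_integral F x y h + ver_integral F x (y + h * 1) h + ver_integral F x (y + h * 2) h.
  by apply: split3; [have := by_ o0 o0|have := by_ o0 o1|have := by_ o0 o2]; rewrite /= ?E0.
have V3 : ver_integral F (x + h * 3) y (h * 3) = ver_integral F (x + h * 3) y h +
    ver_integral F (x + h * 3) (y + h * 1) h + ver_integral F (x + h * 3) (y + h * 2) h.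
  by apply: split3; [have := by' o0|have := by' o1|have := by' o2]; rewrite /= ?E0.
rewrite !big_ord_recl !big_ord0 /= /bump /= !E0 /square_contour H0 H3 V0 V3.
have A1 u : u + h * 1 + h = u + h * 2 by ring.
have A2 u : u + h * 2 + h = u + h * 3 by ring.
have A0 u : u + h = u + h * 1 by ring.
by rewrite !A1 !A2 !A0; ring.
Qed.

End Goursat.

Arguments square_contour : simpl never.

Section CauchyBound.
Variable R : realType.
Local Notation C := R[i].
Implicit Types (F G : C -> C) (z a c : C) (x y h t : R).

Lemma geometric_small (q B e : R) : 0 <= q -> q < 1 -> 0 < e ->
  exists n : nat, B * q ^+ n <= e.
Proof.
move=> q0 q1 e0; have : `|q| < 1 by rewrite ger0_norm.
move=> /cvg_expr /cvgrPdist_le /(_ (e / (`|B| + 1))) -[|n _ H].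
  by rewrite divr_gt0// ltr_pwDr.
exists n; have := H n (leqnn n); rewrite /= sub0r normrN.
rewrite ger0_norm ?exprn_ge0// ler_pdivlMr ?ltr_pwDr// => H'.
have Q0 : 0 <= q ^+ n by exact: exprn_ge0.
have := ler_norm B; nra.
Qed.

Lemma nested_segments (u v : nat -> R) :
    (forall n, u n <= u n.+1) -> (forall n, v n.+1 <= v n) ->
    (forall n, u n <= v n) ->
  exists l, forall n, u n <= l <= v n.
Proof.
move=> hu hv huv.
have mu_ n m : (n <= m)%N -> u n <= u m.
  by move=> /subnK <-; elim: (m - n)%N => // k; move/le_trans; apply; rewrite addSn.
have mv n m : (n <= m)%N -> v m <= v n.
  move=> /subnK <-; elim: (m - n)%N => // k; apply: le_trans.
  by rewrite addSn.
have ub n : ubound (range u) (v n).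
  move=> _ [m _ <-]; have [nm|mn] := leqP n m.
    exact: le_trans (huv m) (mv _ _ nm).
  exact: le_trans (mu_ _ _ (ltnW mn)) (huv n).
exists (sup (range u)) => n; apply/andP; split.
  by apply: ub_le_sup; [exists (v 0%N); exact: ub|exists n].
by apply: ge_sup; [exists (u 0%N), 0%N|exact: ub].
Qed.

Lemma on_boundary_in x y h z : on_boundary x y h z -> in_square x y h z.
Proof. by case. Qed.

(** Goursat: a contour integral of size at least [c] times the area survives, on
    one of nine subsquares, with the same constant [c]; the nested squares close
    down on a point where the derivative makes [F] affine up to [o(h)], hence
    the integral [o(h ^ 2)]. *)
Lemma goursat F x y h : 0 < h ->
    (forall z, in_square x y h z -> exists a, complex_derivative_at F z a) ->
  square_contour F x y h = 0.
Proof.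
move=> h0 dF; apply: modc_eq0; apply/eqP; rewrite eq_le modc_ge0 andbT leNgt.
apply/negP => E0; set c := modc (square_contour F x y h) / h ^+ 2.
have c0 : 0 < c by rewrite divr_gt0// exprn_gt0.
pose sub (p q : R * R * R) :=
  [/\ p.1.1 <= q.1.1, q.1.1 + q.2 <= p.1.1 + p.2,
      p.1.2 <= q.1.2 & q.1.2 + q.2 <= p.1.2 + p.2].
pose bad (p : R * R * R) :=
  [/\ 0 < p.2, sub (x, y, h) p & c * p.2 ^+ 2 <= modc (square_contour F p.1.1 p.1.2 p.2)].
have step p : exists q, bad p -> [/\ bad q, sub p q & q.2 = p.2 / 3].
  case: p => -[px py] ph.
  have [bp|nbp] := pselect (bad (px, py, ph)); last by exists (px, py, ph).
  case: (bp) => /= ph0 [/= s1 s2 s3 s4] big.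
  set k := ph / 3; have k0 : 0 < k by rewrite divr_gt0.
  have phE : ph = k * 3 by rewrite /k; field.
  have subij (i j : 'I_3) : sub (px, py, ph) (px + k * i%:R, py + k * j%:R, k).
    have bd (l : 'I_3) : 0 <= k * l%:R <= k * 2.
      by rewrite mulr_ge0 ?ler0n ?(ltW k0)//= ler_pM2l// (ler_nat _ l 2) -ltnS ltn_ord.
    by have /andP[i0 i2] := bd i; have /andP[j0 j2] := bd j; split => /=; lra.
  have good : exists i j : 'I_3, c * k ^+ 2 <=
      modc (square_contour F (px + k * i%:R) (py + k * j%:R) k).
    apply: contrapT => no.
    have lt (i j : 'I_3) : modc (square_contour F (px + k * i%:R) (py + k * j%:R) k)
        < c * k ^+ 2.
      by rewrite ltNge; apply/negP => H; apply: no; exists i, j.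
    move: big; apply/negP; rewrite -ltNge phE square_contour_split; last 2 first.
    - exact: ltW.
    - move=> i j z /on_boundary_in[Hx Hy]; case: (subij i j) => /= b1 b2 b3 b4.
      have [|a da] := dF z; first by split; lra.
      exact: complex_derivative_continuous da.
    apply: le_lt_trans (modc_sum _ _ _) _.
    have S3 (u : 'I_3 -> R) b : (forall i, u i < b) -> \sum_i u i < b * 3.
      move=> ub; rewrite !big_ord_recl big_ord0 addr0.
      by have := ub ord0; have := ub (lift ord0 ord0);
         have := ub (lift ord0 (lift ord0 ord0)); lra.
    rewrite (_ : c * (k * 3) ^+ 2 = c * k ^+ 2 * 3 * 3); last by ring.
    apply: (S3 _ _) => i; apply: le_lt_trans (modc_sum _ _ _) _.
    by apply: S3 => j; exact: lt.
  have [i [j ij]] := good; exists (px + k * i%:R, py + k * j%:R, k) => _.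
  have sij := subij i j; split => //; split => //.
  by case: sij => /= *; split => /=; lra.
have {step} [f fP] := choice step.
pose s n := iter n f (x, y, h).
have s0bad : bad (x, y, h).
  split; [exact: h0|by split => /=; lra|rewrite /c /= divfK//].
  by rewrite expf_eq0/= gt_eqF.
have sbad n : bad (s n) by elim: n => //= n /fP[].
have ssub n : sub (s n) (s n.+1) by have [] := fP _ (sbad n).
have sh n : (s n).2 = h * (3^-1) ^+ n.
  elim: n => [|n IH]; first by rewrite expr0 mulr1.
  by have [_ _ /= ->] := fP _ (sbad n); rewrite IH exprSr mulrA.
have [X HX] := @nested_segments (fun n => (s n).1.1) (fun n => (s n).1.1 + (s n).2)
  (fun n => let: And4 a _ _ _ := ssub n in a) (fun n => let: And4 _ a _ _ := ssub n in a)
  ltac:(move=> n; rewrite lerDl ltW//; by case: (sbad n)).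
have [Y HY] := @nested_segments (fun n => (s n).1.2) (fun n => (s n).1.2 + (s n).2)
  (fun n => let: And4 _ _ a _ := ssub n in a) (fun n => let: And4 _ _ _ a := ssub n in a)
  ltac:(move=> n; rewrite lerDl ltW//; by case: (sbad n)).
have [|a da] := dF (Complex X Y); first by split; [exact: (HX 0%N)|exact: (HY 0%N)].
(* the constant makes the affine error at most half of the surviving bound *)
have [|d d0 Hd] := da (c / 32); first by rewrite divr_gt0.
have [|||n Hn] := @geometric_small 3^-1 h (d / 4).
- by [].
- by rewrite invf_lt1// ltr1n.
- by rewrite divr_gt0.
move: (sbad n) (HX n) (HY n); rewrite /bad /sub /= !(sh n).
set k := h * _ in Hn *; set sx := (s n).1.1; set sy := (s n).1.2.
move=> [/= k0 [/= b1 b2 b3 b4] big] {}HX {}HY.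
set z0 := Complex X Y.
have near z : in_square sx sy k z -> modc (z - z0) <= 2 * k.
  move=> [/= zx zy]; apply: le_trans (modc_le_ReIm _) _.
  rewrite Re_add Im_add Re_opp Im_opp /= mulr2n mulrDl mul1r; apply: lerD.
    by rewrite ler_norml; lra.
  by rewrite ler_norml; lra.
have cF z : on_boundary sx sy k z -> continuous_atC F z.
  move=> /on_boundary_in[zx zy]; have [|b db] := dF z; first by split; lra.
  exact: complex_derivative_continuous db.
(* subtracting the affine part does not change the contour integral *)
pose G (z : C) : C := - a * z + (a * z0 - F z0).
have cG z : on_boundary sx sy k z -> continuous_atC G z.
  move=> _; apply: (@complex_derivative_continuous _ _ _ (- a)) => e e0.
  exists 1 => // u _; rewrite /G (_ : _ - _ - _ = 0); last by ring.
  by rewrite modc0; apply: mulr_ge0; [exact: ltW|exact: modc_ge0].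
have EG : square_contour F sx sy k = square_contour (fun z => F z + G z) sx sy k.
  by rewrite square_contourD// square_contour_affine ?addr0// ltW.
have cFG z : on_boundary sx sy k z -> continuous_atC (fun z => F z + G z) z.
  move=> zb e e0; have e2 : 0 < e / 2 by rewrite divr_gt0.
  have [d1 d10 H1] := cF z zb _ e2; have [d2 d20 H2] := cG z zb _ e2.
  exists (Num.min d1 d2); first by rewrite lt_min d10.
  move=> u; rewrite lt_min => /andP[u1 u2]; rewrite opprD addrACA.
  by apply: le_trans (modcD _ _) _; have := H1 u u1; have := H2 u u2; lra.
have bound z : on_boundary sx sy k z -> modc (F z + G z) <= c / 32 * (2 * k).
  move=> /on_boundary_in zs; have nz := near z zs.
  have := Hd (z - z0) ltac:(by move: Hn; rewrite ler_pdivlMr//; lra).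
  rewrite (addrC z0) subrK /G (_ : F z + (- a * z + (a * z0 - F z0)) = F z - F z0 - a * (z - z0)); last by ring.
  by move/le_trans; apply; rewrite ler_wpM2l// divr_ge0// ltW.
have := modc_square_contour (ltW k0) cFG bound; rewrite -EG => H.
have := le_trans big H.
have E (u v : R) : 8 * v * (u / 32 * (2 * v)) = u * v ^+ 2 / 2 by field.
rewrite E.
have : 0 < c * k ^+ 2 by rewrite mulr_gt0// exprn_gt0.
by lra.
Qed.

End CauchyBound.

Section CauchyEstimate.
Variable R : realType.
Local Notation C := R[i].
Implicit Types (F G g : C -> C) (z a c : C) (x y h t : R).

Lemma complex_derivative_affine a c z :
  complex_derivative_at (fun w => a * w + c) z a.
Proof.
move=> e e0; exists 1 => // u _; rewrite (_ : _ - _ - _ = 0); last by ring.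
by rewrite modc0; apply: mulr_ge0; [exact: ltW|exact: modc_ge0].
Qed.

Lemma complex_derivative_ext F G z a : (forall w, F w = G w) ->
  complex_derivative_at G z a -> complex_derivative_at F z a.
Proof. by move=> /funext ->. Qed.

Lemma complex_derivativeD F G z a b : complex_derivative_at F z a ->
  complex_derivative_at G z b -> complex_derivative_at (fun w => F w + G w) z (a + b).
Proof.
move=> dF dG e e0; have e2 : 0 < e / 2 by rewrite divr_gt0.
have [d1 d10 H1] := dF _ e2; have [d2 d20 H2] := dG _ e2.
exists (Num.min d1 d2); first by rewrite lt_min d10.
move=> h; rewrite lt_min => /andP[/H1 h1 /H2 h2].
rewrite (_ : _ - _ - _ = (F (z + h) - F z - a * h) + (G (z + h) - G z - b * h)).
  by apply: le_trans (modcD _ _) _; lra.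
by ring.
Qed.

Lemma complex_derivativeM F G z a b : complex_derivative_at F z a ->
    complex_derivative_at G z b ->
  complex_derivative_at (fun w => F w * G w) z (a * G z + F z * b).
Proof.
move=> dF dG e e0.
have cF := complex_derivative_continuous dF.
pose K := modc (G z) + modc (F z) + modc b + 1.
have [Gz Fz bz] := And3 (modc_ge0 (G z)) (modc_ge0 (F z)) (modc_ge0 b).
have K1 : 1 <= K by rewrite /K; lra.
have K0 : 0 < K by lra.
pose f := Num.min 1 (e / (4 * K)).
have f0 : 0 < f by rewrite lt_min ltr01 divr_gt0// mulr_gt0.
have f1 : f <= 1 by rewrite ge_min lexx.
have fK : f * K <= e / 4.
  have : f <= e / (4 * K) by rewrite ge_min lexx orbT.
  by rewrite ler_pdivlMr ?mulr_gt0// => ?; lra.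
have [d1 d10 H1] := dF _ f0; have [d2 d20 H2] := dG _ f0.
have [d3 d30 H3] := cF _ f0.
exists (Num.min d1 (Num.min d2 d3)); first by rewrite !lt_min d10 d20.
move=> h; rewrite !lt_min => /andP[/H1 h1 /andP[/H2 h2 /H3 h3]].
rewrite (_ : _ - _ - _ = (F (z + h) - F z - a * h) * G z
   + F (z + h) * (G (z + h) - G z - b * h) + (F (z + h) - F z) * b * h); last by ring.
have t1 := modcD ((F (z + h) - F z - a * h) * G z + F (z + h) * (G (z + h) - G z - b * h))
  ((F (z + h) - F z) * b * h).
have t2 := modcD ((F (z + h) - F z - a * h) * G z) (F (z + h) * (G (z + h) - G z - b * h)).
have t3 : modc (F (z + h)) <= modc (F z) + f.
  by have := modcD (F (z + h) - F z) (F z); rewrite subrK; lra.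
rewrite !modcM in t1 t2.
have H0 := modc_ge0 h.
have b1 : modc (F (z + h) - F z - a * h) * modc (G z) <= f * modc h * modc (G z).
  by apply: ler_wpM2r.
have b2 : modc (F (z + h)) * modc (G (z + h) - G z - b * h) <=
    (modc (F z) + 1) * (f * modc h).
  by apply: ler_pM; rewrite ?modc_ge0//; lra.
have b3 : modc (F (z + h) - F z) * modc b * modc h <= f * modc b * modc h.
  by apply: ler_wpM2r => //; apply: ler_wpM2r.
apply: le_trans t1 _; apply: le_trans (lerD t2 (lexx _)) _.
have : f * K * modc h <= e / 4 * modc h by apply: ler_wpM2r.
have : 0 <= e * modc h by rewrite mulr_ge0// ltW.
by rewrite /K; lra.
Qed.

Lemma complex_derivativeV z : z != 0 ->
  complex_derivative_at (fun w => w^-1) z (- z ^- 2).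
Proof.
move=> z0 e e0; have mz : 0 < modc z by rewrite modc_gt0.
exists (Num.min (modc z / 2) (e * modc z ^+ 3 / 2)).
  by rewrite lt_min !divr_gt0// mulr_gt0// exprn_gt0.
move=> h; rewrite lt_min => /andP[h1 h2].
have zh : modc z / 2 <= modc (z + h).
  by have := modcB (z + h) h; rewrite addrK; lra.
have zh0 : 0 < modc (z + h) by apply: lt_le_trans zh; rewrite divr_gt0.
have zhn : z + h != 0 by rewrite -modc_gt0.
have -> : (z + h)^-1 - z^-1 - - z ^- 2 * h = h * h * ((z + h)^-1 * z ^- 2).
  by field; rewrite zhn z0.
rewrite !modcM modcV [modc (z ^- 2)]modcV modcX -mulrA mulrC.
apply: ler_wpM2r; first exact: modc_ge0.
rewrite -invfM ler_pdivrMr; last by rewrite mulr_gt0// exprn_gt0.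
have : modc z ^+ 3 / 2 <= modc (z + h) * modc z ^+ 2.
  have -> : modc z ^+ 3 / 2 = modc z / 2 * modc z ^+ 2 by ring.
  by rewrite ler_pM2r// exprn_gt0.
by nra.
Qed.

Lemma complex_derivative_shift g z w a : complex_derivative_at g (z + w) a ->
  complex_derivative_at (fun u => g (z + u)) w a.
Proof. by move=> dg e /dg[d d0 H]; exists d => // h /H; rewrite addrA. Qed.

Lemma boundary_ge r z : 0 < r -> on_boundary (- r) (- r) (r * 2) z -> r <= modc z.
Proof.
move=> r0 [_ zb]; have := Re_le_modc z; have := Im_le_modc z.
have rr : - r + r * 2 = r by ring.
by rewrite rr in zb; case: zb => -> H1 H2;
  ((apply: le_trans H1; rewrite ?normrN gtr0_norm; done) ||
   (apply: le_trans H2; rewrite ?normrN gtr0_norm; done)).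
Qed.

(** A singularity at the centre that is weaker than a simple pole is
    invisible to the contour integral: by Goursat only the central one of nine
    subsquares contributes, and repeating this shrinks the contour. *)
Lemma contour_removable F r : 0 < r ->
    (forall z, in_square (- r) (- r) (r * 2) z -> z != 0 ->
       exists a, complex_derivative_at F z a) ->
    (forall e, 0 < e -> exists2 d, 0 < d & forall z, z != 0 -> modc z < d ->
       modc (F z) * modc z <= e) ->
  square_contour F (- r) (- r) (r * 2) = 0.
Proof.
move=> r0 dF F0.
have cF s z : s <= r -> 0 < s -> on_boundary (- s) (- s) (s * 2) z -> continuous_atC F z.
  move=> sr s0 bz; have [||a] := dF z; last exact: complex_derivative_continuous.
    by move: bz => /on_boundary_in[H1 H2]; split; lra.
  by rewrite -modc_gt0; apply: lt_le_trans (boundary_ge s0 bz).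
have third s : 0 < s -> s <= r -> square_contour F (- s) (- s) (s * 2) =
    square_contour F (- (s / 3)) (- (s / 3)) (s / 3 * 2).
  move=> s0 sr; have s30 : 0 < s / 3 * 2 by rewrite mulr_gt0// divr_gt0.
  have sE : s * 2 = s / 3 * 2 * 3 by field.
  pose o1 := @Ordinal 3 1 isT.
  have bd (l : 'I_3) : l != o1 -> l%:R = 0 :> R \/ l%:R = 2 :> R.
    by case: l => [[|[|[|l]]] lt]//= _; [left|right].
  have bd3 (l : 'I_3) : 0 <= l%:R * s <= 2 * s.
    by rewrite mulr_ge0 ?ler0n ?(ltW s0)//= ler_pM2r// (ler_nat _ l 2) -ltnS ltn_ord.
  have sub (i j : 'I_3) z :
      in_square (- s + s / 3 * 2 * i%:R) (- s + s / 3 * 2 * j%:R) (s / 3 * 2) z ->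
      in_square (- r) (- r) (r * 2) z.
    by move=> [H1 H2]; have /andP[i1 i2] := bd3 i; have /andP[j1 j2] := bd3 j; split; lra.
  have d0 (i j : 'I_3) z : in_square (- s + s / 3 * 2 * i%:R) (- s + s / 3 * 2 * j%:R)
      (s / 3 * 2) z -> (i != o1) || (j != o1) -> z != 0.
    move=> [H1 H2] ij; apply/eqP => z0; move: H1 H2; rewrite z0 /=.
    by case/orP: ij => /bd[] ->; lra.
  rewrite sE square_contour_split ?(ltW s30)//; last first.
    move=> i j z bz; have [||a] := dF z; last exact: complex_derivative_continuous.
      exact: sub (on_boundary_in bz).
    have [/eqP i1|i1] := eqVneq i o1; last by apply: (d0 _ _ _ (on_boundary_in bz)); rewrite i1.
    have [/eqP j1|j1] := eqVneq j o1; last first.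
      by apply: (d0 _ _ _ (on_boundary_in bz)); rewrite j1 orbT.
    rewrite -modc_gt0; apply: (@lt_le_trans _ _ (s / 3)); first by rewrite divr_gt0.
    apply: boundary_ge; first by rewrite divr_gt0.
    move: bz; rewrite (eqP i1) (eqP j1) /= (_ : - s + s / 3 * 2 * 1 = - (s / 3))//.
    by field.
  rewrite (bigD1 o1)//= (bigD1 o1)//= mulr1 (_ : - s + s / 3 * 2 = - (s / 3)); last by field.
  have Z (i j : 'I_3) : (i != o1) || (j != o1) -> square_contour F (- s + s / 3 * 2 * i%:R)
      (- s + s / 3 * 2 * j%:R) (s / 3 * 2) = 0.
    by move=> ij; apply: goursat => // z zs; apply: dF; [exact: sub zs|exact: d0 zs ij].
  rewrite big1 ?addr0; last first.
    move=> j j1; have := Z o1 j; rewrite j1 orbT => /(_ isT).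
    by rewrite /= mulr1 (_ : - s + s / 3 * 2 = - (s / 3)); last by field.
  by rewrite big1 ?addr0// => i i1; rewrite big1// => j _; apply: Z; rewrite i1.
pose s n := r * 3^-1 ^+ n.
have s0 n : 0 < s n by rewrite mulr_gt0// exprn_gt0.
have sr n : s n <= r.
  by rewrite /s ler_piMr ?(ltW r0)// exprn_ile1// invf_le1// ler1n.
have E n : square_contour F (- r) (- r) (r * 2) =
    square_contour F (- s n) (- s n) (s n * 2).
  elim: n => [|n ->]; first by rewrite /s expr0 mulr1.
  by rewrite third// /s exprSr mulrA.
apply: modc_eq0; apply/eqP; rewrite eq_le modc_ge0 andbT; apply/ler_addgt0Pr => e e0.
have [|d d0 Hd] := F0 (e / 16); first by rewrite divr_gt0.
have [|||n Hn] := @geometric_small _ 3^-1 r (d / 4).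
- by [].
- by rewrite invf_lt1// ltr1n.
- by rewrite divr_gt0.
rewrite add0r (E n); rewrite -/(s n) in Hn.
have s20 : 0 <= s n * 2 by rewrite mulr_ge0// ltW.
apply: le_trans (modc_square_contour (B := e / 16 / s n) s20 _ _) _.
- by move=> z; exact: cF.
- move=> z bz; have zs := boundary_ge (s0 n) bz.
  have z0 : z != 0 by rewrite -modc_gt0 (lt_le_trans (s0 n)).
  have zd : modc z < d.
    move: bz => /on_boundary_in[H1 H2]; apply: le_lt_trans (modc_le_ReIm _) _.
    have : `|complex.Re z| <= s n by rewrite ler_norml; lra.
    have : `|complex.Im z| <= s n by rewrite ler_norml; lra.
    by have := s0 n; lra.
  rewrite ler_pdivlMr//; apply: le_trans (Hd z z0 zd).
  by rewrite ler_wpM2l ?modc_ge0.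
- by rewrite le_eqVlt; apply/orP; left; apply/eqP; field; rewrite gt_eqF.
Qed.

(** Cauchy's estimate for the derivative.  Subtracting the affine part at the
    centre leaves a removable singularity in the integral of [g / z ^ 2], so
    [a] times the contour integral of [1 / z] is the contour integral of
    [(g - g 0) / z ^ 2]; only a lower bound of the former is needed, not
    its exact value. *)
Lemma cauchy_estimate g z0 a r S : 0 < r ->
    (forall z, `|complex.Re z| <= r -> `|complex.Im z| <= r ->
       (exists b, complex_derivative_at g (z0 + z) b) /\ modc (g (z0 + z)) <= S) ->
    complex_derivative_at g z0 a ->
  modc a <= 8 * S / r.
Proof.
move=> r0 Hg dg0; pose f z := g (z0 + z).
have df0 : complex_derivative_at f 0 a by apply: complex_derivative_shift; rewrite addr0.
have sq z : in_square (- r) (- r) (r * 2) z ->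
    `|complex.Re z| <= r /\ `|complex.Im z| <= r.
  by move=> [H1 H2]; rewrite !ler_norml; split; lra.
have df z : in_square (- r) (- r) (r * 2) z -> exists b, complex_derivative_at f z b.
  by move=> /sq[H1 H2]; have [[b db] _] := Hg z H1 H2; exists b; apply: complex_derivative_shift.
have fS z : in_square (- r) (- r) (r * 2) z -> modc (f z) <= S.
  by move=> /sq[H1 H2]; have [_] := Hg z H1 H2.
have dV2 z : z != 0 -> exists b, complex_derivative_at (fun w : C => w^-1 * w^-1) z b.
  by move=> zn; eexists; apply: complex_derivativeM; apply: complex_derivativeV.
pose P z := f z + (- a * z + - f 0).
pose F z := P z * (z^-1 * z^-1).
have dP z : in_square (- r) (- r) (r * 2) z -> exists b, complex_derivative_at P z b.
  move=> /df[b db]; exists (b + - a).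
  exact: complex_derivativeD db (complex_derivative_affine _ _ _).
have F0 : square_contour F (- r) (- r) (r * 2) = 0.
  apply: contour_removable => //.
    move=> z /dP[b db] /dV2[c dc]; eexists; exact: complex_derivativeM db dc.
  move=> e /df0[d d0 H]; exists d => // z zn /H.
  rewrite add0r /F !modcM !modcV /P (_ : f z + (- a * z + - f 0) = f z - f 0 - a * z); last by ring.
  have mz : 0 < modc z by rewrite modc_gt0.
  move=> Hz; rewrite -mulrA -mulrA mulVf ?gt_eqF// mulr1 ler_pdivrMr//.
pose G z := (f z + - f 0) * (z^-1 * z^-1).
pose V z := - a * z^-1.
have bn z : on_boundary (- r) (- r) (r * 2) z -> z != 0.
  by move=> /(boundary_ge r0) H; rewrite -modc_gt0 (lt_le_trans r0).
have cV1 z : on_boundary (- r) (- r) (r * 2) z -> continuous_atC (fun w => w^-1) z.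
  by move=> /bn zn; apply: complex_derivative_continuous (complex_derivativeV zn).
have cV z : on_boundary (- r) (- r) (r * 2) z -> continuous_atC V z.
  move=> /bn zn; have := complex_derivativeM (complex_derivative_affine 0 (- a) z)
    (complex_derivativeV zn).
  move=> /complex_derivative_continuous; congr continuous_atC.
  by apply/funext => w; rewrite mul0r add0r.
have cG z : on_boundary (- r) (- r) (r * 2) z -> continuous_atC G z.
  move=> zb; have [b db] := df _ (on_boundary_in zb); have [c dc] := dV2 _ (bn z zb).
  have := complex_derivativeM (complex_derivativeD db (complex_derivative_affine 0 (- f 0) z)) dc.
  move=> /complex_derivative_continuous; congr continuous_atC.
  by apply/funext => w; rewrite mul0r add0r.
have FE z : on_boundary (- r) (- r) (r * 2) z -> F z = G z + V z.
  by move=> /bn zn; rewrite /F /G /V /P; field.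
have EF : square_contour F (- r) (- r) (r * 2) =
    square_contour (fun z => G z + V z) (- r) (- r) (r * 2).
  rewrite /square_contour /hor_integral /ver_integral; congr (_ - _ + _ * (_ - _));
  apply: eq_segment_integral => t ht; apply: FE.
  - by split; [split => //=; lra|apply: Or43].
  - by split; [split => //=; lra|apply: Or44].
  - by split; [split => //=; lra|apply: Or42].
  - by split; [split => //=; lra|apply: Or41].
move: F0; rewrite EF square_contourD// square_contourZ// mulNr => /eqP.
rewrite subr_eq0 => /eqP /esym E.
have r20 : 0 <= r * 2 by rewrite mulr_ge0// ltW.
have GB z : on_boundary (- r) (- r) (r * 2) z -> modc (G z) <= 2 * S / r ^+ 2.
  move=> zb; have zr := boundary_ge r0 zb.
  have mz : 0 < modc z by apply: lt_le_trans zr.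
  rewrite /G !modcM !modcV -invfM.
  have S2 : modc (f z + - f 0) <= 2 * S.
    apply: le_trans (modcB _ _) _; have := fS z (on_boundary_in zb).
    by have := fS 0 ltac:(by split => /=; lra); lra.
  have zz : 0 < modc z * modc z by rewrite mulr_gt0.
  have rz : r ^+ 2 <= modc z * modc z by rewrite expr2 ler_pM// ltW.
  apply: ler_pM => //; [exact: modc_ge0|by rewrite invr_ge0 ltW|].
  by rewrite lef_pV2// posrE exprn_gt0.
have := modc_square_contour r20 cG GB; rewrite -E modcM.
have L : 4 * (r * 2 * (2 * r)^-1) <= complex.Im (square_contour (fun z => z^-1) (- r) (- r) (r * 2)).
  have den t : - r <= t <= - r + r * 2 -> (2 * r)^-1 <= r / (t ^+ 2 + r ^+ 2).
    move=> tr; have t2 : t ^+ 2 <= r ^+ 2 by nra.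
    have r2 : 0 < r ^+ 2 by rewrite exprn_gt0.
    have t2p : 0 < t ^+ 2 + r ^+ 2 by rewrite ltr_wpDl// sqr_ge0.
    rewrite ler_pdivlMr// mulrC ler_pdivrMr ?mulr_gt0//; nra.
  apply: Im_square_contour_ge => // t tr; have := den t tr.
  - by rewrite /= sqrrN mulNr opprK.
  - by rewrite (_ : - r + r * 2 = r)/= ?opprK//; ring.
  - by rewrite (_ : - r + r * 2 = r)/= 1?addrC//; ring.
  - by rewrite /= sqrrN mulNr opprK addrC.
have {}L : 4 <= modc (square_contour (fun z => z^-1) (- r) (- r) (r * 2)).
  apply: le_trans (Im_le_modc _); apply: le_trans (ler_norm _); apply: le_trans L.
    by rewrite le_eqVlt; apply/orP; left; apply/eqP; field; rewrite gt_eqF.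
move=> H; rewrite ler_pdivlMr//.
have : modc a * r * 4 <= modc a * r * modc (square_contour (fun z => z^-1) (- r) (- r) (r * 2)).
  by apply: ler_wpM2l => //; rewrite mulr_ge0 ?modc_ge0// ltW.
have : 8 * (r * 2) * (2 * S / r ^+ 2) * r = 8 * S * 4.
  by field; rewrite gt_eqF.
by move: H; rewrite -(ler_pM2r r0); lra.
Qed.

End CauchyEstimate.

(** * Limits along an ultrafilter *)

Section UltraLimit.
Variable R : realType.
Local Notation C := R[i].
Implicit Types (a b : nat -> R) (u v : nat -> C).

Lemma ultrafilter_ex : exists U : set_system nat,
  UltraFilter U /\ (\oo `<=` U)%classic.
Proof. exact: ultraFilterLemma. Qed.

(** One fixed free ultrafilter on the integers.  The limit along it is a
    linear, monotone functional defined on all bounded sequences, so that no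
    averaged quantity below has to be shown to converge. *)
Definition ultra : set_system nat := projT1 (cid ultrafilter_ex).

#[local] Instance ultra_ultra : UltraFilter ultra.
Proof. by have [] := projT2 (cid ultrafilter_ex). Qed.

#[local] Instance ultra_filter : ProperFilter ultra.
Proof. exact: ultra_proper. Qed.

Lemma ultra_eventually (P : set nat) n : (forall m, (n <= m)%N -> P m) -> ultra P.
Proof.
have [_] := projT2 (cid ultrafilter_ex); rewrite -/ultra => H nP; apply: H.
by exists n.
Qed.

Definition ulim a : R := lim (a @ ultra).

Definition bounded_seq a := exists B, forall n, `|a n| <= B.

Lemma ulim_cvg a : bounded_seq a -> a @ ultra --> ulim a.
Proof.
move=> [B aB]; suff [l al] : exists l : R, a @ ultra --> l.
  by rewrite /ulim (_ : lim (a @ ultra) = l)//; apply: cvg_lim.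
have := @segment_compact R (- B) B; rewrite compact_ultra => cB.
pose F : set_system R := a @ ultra.
have uF : UltraFilter F.
  split; first exact: fmap_proper_filter.
  move=> G pG FG; apply/seteqP; split=> [A GA|]; last exact: FG.
  have [//|nA] := in_ultra_setVsetC (a @^-1` A) ultra_ultra.
  have GnA : G (~` A) by apply: FG.
  have G0 : G set0 by rewrite -(setICr A); apply: filterI.
  by case: (@filter_not_empty _ _ pG G0).
have [|l [_ Fl]] := cB F uF; last by exists l.
by apply: (@ultra_eventually _ 0%N) => n _; rewrite /= in_itv/= -ler_norml.
Qed.

Lemma bounded_seqZ (c : R) a : bounded_seq a -> bounded_seq (fun n => c * a n).
Proof. by move=> [A aA]; exists (`|c| * A) => n; rewrite normrM ler_wpM2l. Qed.

Lemma ulimD a b : bounded_seq a -> bounded_seq b ->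
  ulim (fun n => a n + b n) = ulim a + ulim b.
Proof.
move=> ba bb; apply: cvg_lim => //.
exact: cvgD (ulim_cvg ba) (ulim_cvg bb).
Qed.

Lemma ulimZ (c : R) a : bounded_seq a -> ulim (fun n => c * a n) = c * ulim a.
Proof. by move=> ba; apply: cvg_lim => //; apply: cvgZr; exact: ulim_cvg. Qed.

Lemma ulim_le a b n : bounded_seq a -> bounded_seq b ->
  (forall m, (n <= m)%N -> a m <= b m) -> ulim a <= ulim b.
Proof.
move=> ba bb ab; apply: (ler_cvg_to (ulim_cvg ba) (ulim_cvg bb)).
exact: (@ultra_eventually _ n).
Qed.

Lemma ulim_cst (c : R) : ulim (fun=> c) = c.
Proof. by apply: cvg_lim => //; exact: cvg_cst. Qed.

Definition ulimc u : C :=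
  Complex (ulim (fun n => complex.Re (u n))) (ulim (fun n => complex.Im (u n))).

Definition bounded_seqc u := exists B, forall n, modc (u n) <= B.

Lemma bounded_seq_Re u : bounded_seqc u -> bounded_seq (fun n => complex.Re (u n)).
Proof. by move=> [B uB]; exists B => n; apply: le_trans (Re_le_modc _) _. Qed.

Lemma bounded_seq_Im u : bounded_seqc u -> bounded_seq (fun n => complex.Im (u n)).
Proof. by move=> [B uB]; exists B => n; apply: le_trans (Im_le_modc _) _. Qed.

Lemma bounded_seqcD u v : bounded_seqc u -> bounded_seqc v ->
  bounded_seqc (fun n => u n + v n).
Proof.
move=> [A aA] [B bB]; exists (A + B) => n.
by apply: le_trans (modcD _ _) _; rewrite lerD.
Qed.

Lemma bounded_seqcZ (c : C) u : bounded_seqc u -> bounded_seqc (fun n => c * u n).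
Proof. by move=> [A aA]; exists (modc c * A) => n; rewrite modcM ler_wpM2l// modc_ge0. Qed.

Lemma ulimcD u v : bounded_seqc u -> bounded_seqc v ->
  ulimc (fun n => u n + v n) = ulimc u + ulimc v.
Proof.
move=> bu bv; apply: complex_eqP; rewrite ?Re_add ?Im_add /ulimc /= -ulimD;
  do ?[exact: bounded_seq_Re|exact: bounded_seq_Im];
  by congr ulim; apply/funext => n; rewrite ?Re_add ?Im_add.
Qed.

Lemma ulimcZ (c : C) u : bounded_seqc u -> ulimc (fun n => c * u n) = c * ulimc u.
Proof.
move=> bu; have bR := bounded_seq_Re bu; have bI := bounded_seq_Im bu.
apply: complex_eqP; rewrite ?Re_mul ?Im_mul /ulimc /=.
  rewrite -mulNr -!ulimZ// -ulimD; do ?[exact: bounded_seqZ].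
  by congr ulim; apply/funext => n; rewrite Re_mul mulNr.
rewrite -!ulimZ// -ulimD; do ?[exact: bounded_seqZ].
by congr ulim; apply/funext => n; rewrite Im_mul.
Qed.

(** Bounding real and imaginary part separately would lose a factor; the modulus
    is the real part after a rotation. *)
Lemma modc_ulimc u n (b : R) : bounded_seqc u ->
  (forall m, (n <= m)%N -> modc (u m) <= b) -> modc (ulimc u) <= b.
Proof.
move=> bu ub; set z := ulimc u.
have [->|z0] := eqVneq z 0.
  by rewrite modc0; apply: le_trans (modc_ge0 (u n)) (ub n (leqnn n)).
have mz : 0 < modc z by rewrite modc_gt0.
pose c : C := conjc z.
have cz : complex.Re (c * z) = modc z * modc z.
  rewrite -expr2 modc_sqr /c; case: (z) => x y /=.
  by ring.
have bcu := bounded_seqcZ c bu.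
have : complex.Re (ulimc (fun k => c * u k)) <= modc z * b.
  rewrite -(ulim_cst (modc z * b)); apply: (@ulim_le _ _ n).
  - exact: bounded_seq_Re.
  - by exists (`|modc z * b|).
  - move=> m nm; apply: le_trans (ler_norm _) _; apply: le_trans (Re_le_modc _) _.
    by rewrite modcM modc_conj ler_wpM2l ?modc_ge0 ?ub.
by rewrite ulimcZ// cz ler_pM2l.
Qed.

Lemma ulimc_cvg u (l : C) : bounded_seqc u ->
  (forall e, 0 < e -> exists n, forall m, (n <= m)%N -> modc (u m - l) <= e) ->
  ulimc u = l.
Proof.
move=> bu ul; have bl : bounded_seqc (fun=> - l) by exists (modc (- l)).
have lE : ulimc (fun=> - l) = - l by rewrite /ulimc !ulim_cst; apply: complex_eqP.
apply/eqP; rewrite -subr_eq0; apply/eqP/modc_eq0/eqP; rewrite -lE -ulimcD//.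
rewrite eq_le modc_ge0 andbT; apply/ler_addgt0Pr => e e0; rewrite add0r.
by have [n Hn] := ul e e0; apply: (@modc_ulimc _ n) => //; exact: bounded_seqcD.
Qed.

End UltraLimit.

(** * Holomorphic functions on polydiscs *)

Section MeanValue.
Variable R : realType.
Local Notation C := R[i].
Implicit Types (g : C -> C) (f : R -> R).

Lemma is_derive_eps f (x a : R) :
  (forall e, 0 < e -> exists2 d, 0 < d & forall h, `|h| < d ->
     `|f (x + h) - f x - a * h| <= e * `|h|) -> is_derive x 1 f a.
Proof.
move=> H.
have cv : (fun h : R => h^-1 *: (f (h + x) - f x)) @ 0^' --> a.
  apply/cvgrPdist_le => e e0; have [d d0 Hd] := H e e0.
  near=> h.
  have h0 : h != 0 by near: h; exact: nbhs_dnbhs_neq.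
  have hd : `|h| < d by near: h; apply: dnbhs0_lt.
  have hn : 0 < `|h| by rewrite normr_gt0.
  rewrite distrC -(ler_pM2r hn) -normrM /GRing.scale /=.
  rewrite (_ : (_ - a) * h = f (x + h) - f x - a * h); first exact: Hd.
  by rewrite (addrC h); field.
have cv1 : (fun h : R => h^-1 *: ((f \o shift x) (h *: (1 : R)) - f x)) @ 0^' --> a.
  rewrite (_ : (fun h : R => _) = (fun h : R => h^-1 *: (f (h + x) - f x)))//.
  by apply/funext => h /=; rewrite /GRing.scale /= mulr1.
apply: DeriveDef; first by apply/cvg_ex; exists a.
by rewrite /derive; apply: cvg_lim.
Unshelve. all: by end_near. Qed.

(** The real mean value theorem applied to the component of [g] in the direction
    of its total increment. *)
Lemma complex_mean_value g (z0 t : C) (K : R) :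
    (forall s : R, 0 <= s <= 1 -> exists2 a,
       complex_derivative_at g (z0 + s%:C%C * t) a & modc a <= K) ->
  modc (g (z0 + t) - g z0) <= K * modc t.
Proof.
move=> dg; set D := g (z0 + t) - g z0.
have [D0|Dn] := eqVneq D 0.
  have [|a _ Ka] := dg 0; first by rewrite lexx ler01.
  by rewrite D0 modc0 mulr_ge0 ?modc_ge0// (le_trans (modc_ge0 a)).
have D0 : 0 < modc D by rewrite modc_gt0.
(* its increment over [0, 1] is the square of the modulus of D *)
pose f (s : R) := complex.Re (conjc D * g (z0 + s%:C%C * t)).
pose cl (s : R) := Num.min 1 (Num.max 0 s).
have cl01 s : 0 <= cl s <= 1 by rewrite le_min ler01 le_max lexx ge_min lexx.
have [a aP] := choice (fun s => let: ex_intro2 a p q := dg (cl s) (cl01 s) in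
  ex_intro (fun a => complex_derivative_at g (z0 + (cl s)%:C%C * t) a /\ modc a <= K) a (conj p q)).
have clE (s : R) : 0 <= s <= 1 -> cl s = s.
  by move=> /andP[s0 s1]; rewrite /cl max_r// min_r.
have df (s : R) : 0 <= s <= 1 -> is_derive s 1 f (complex.Re (conjc D * (a s * t))).
  move=> s01; have [da _] := aP s; rewrite clE// in da.
  apply: is_derive_eps => e e0.
  pose k := modc D * modc t + 1.
  have k0 : 0 < k by rewrite ltr_pwDr// mulr_ge0// modc_ge0.
  have [d d0 Hd] := da (e / k) (divr_gt0 e0 k0).
  exists (d / (modc t + 1)); first by rewrite divr_gt0// ltr_pwDr// modc_ge0.
  move=> h; rewrite ltr_pdivlMr ?ltr_pwDr ?modc_ge0// => hd.
  have mt := modc_ge0 t; have mh : modc (h%:C%C * t) < d.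
    by rewrite modcM modc_real; have := normr_ge0 h; nra.
  have := Hd _ mh; rewrite modcM modc_real => H.
  rewrite /f (_ : z0 + (s + h)%:C%C * t = z0 + s%:C%C * t + h%:C%C * t); last first.
    by rewrite rmorphD/=; ring.
  set gs := g (z0 + s%:C%C * t) in H *; set gh := g (_ + _) in H *.
  have -> : complex.Re (conjc D * gh) - complex.Re (conjc D * gs) -
      complex.Re (conjc D * (a s * t)) * h =
      complex.Re (conjc D * (gh - gs - a s * (h%:C%C * t))).
    move: (conjc D) (gh) (gs) (a s) (t) => [u1 u2] [v1 v2] [w1 w2] [x1 x2] [y1 y2] /=.
    by ring.
  apply: le_trans (Re_le_modc _) _; rewrite modcM modc_conj.
  apply: le_trans (ler_wpM2l (modc_ge0 D) H) _.
  rewrite (_ : modc D * _ = e * `|h| * (modc D * modc t / k)); last by field; rewrite gt_eqF.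
  apply: ler_piMr; first by rewrite mulr_ge0// ltW.
  by rewrite ler_pdivrMr// mul1r /k lerDl.
have [||c c01] := @MVT_segment R f (fun s => complex.Re (conjc D * (a s * t))) 0 1 ler01.
- by move=> s; rewrite in_itv/= => /andP[s0 s1]; apply: df; rewrite !ltW.
- apply: derivable_within_continuous => s; rewrite in_itv/= => s01.
  by have := df s s01; case.
rewrite in_itv/= in c01; rewrite subr0 mulr1 => E.
have fD : f 1 - f 0 = modc D * modc D.
  rewrite /f mul0r addr0 mul1r -Re_opp -Re_add -mulrBr -/D -expr2 modc_sqr.
  by case: (D) => x y /=; ring.
have [_ aK] := aP c.
have : f 1 - f 0 <= modc D * (K * modc t).
  rewrite E; apply: le_trans (ler_norm _) _; apply: le_trans (Re_le_modc _) _.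
  by rewrite !modcM modc_conj ler_wpM2l ?modc_ge0// ler_wpM2r ?modc_ge0.
by rewrite fD ler_pM2l.
Qed.

End MeanValue.

Section Polydisc.
Variables (R : realType) (n : nat).
Local Notation C := R[i].
Implicit Types (u v : 'rV[C]_n -> C) (Z W : 'rV[C]_n) (t h a : C) (r S : R).

Definition move_coord (l : 'I_n) t Z : 'rV[C]_n := Z + t *: delta_mx 0 l.

Lemma move_coordE l t Z i : move_coord l t Z 0 i = Z 0 i + (if i == l then t else 0).
Proof. by rewrite !mxE eqxx /=; case: eqP => _; rewrite ?mulr1 ?mulr0. Qed.

Lemma move_coord0 l Z : move_coord l 0 Z = Z.
Proof. by rewrite /move_coord scale0r addr0. Qed.

Lemma move_coordD l t s Z : move_coord l (t + s) Z = move_coord l s (move_coord l t Z).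
Proof. by rewrite /move_coord scalerDl addrA. Qed.

Lemma move_coordC l k t s Z : move_coord l t (move_coord k s Z) = move_coord k s (move_coord l t Z).
Proof. by rewrite /move_coord addrAC. Qed.

Definition polydisc r Z := forall i, modc (Z 0 i) < r.

Lemma polydiscW r r' Z : r <= r' -> polydisc r Z -> polydisc r' Z.
Proof. by move=> rr H i; apply: lt_le_trans (H i) rr. Qed.

Lemma polydisc_shift r s l t Z : polydisc r Z -> modc t < s ->
  polydisc (r + s) (move_coord l t Z).
Proof.
move=> H ts i; have s0 : 0 < s by apply: le_lt_trans ts; exact: modc_ge0.
rewrite move_coordE; case: eqP => _; last by rewrite addr0; have := H i; lra.
by apply: le_lt_trans (modcD _ _) _; have := H i; lra.
Qed.

Lemma polydisc_segment r l t Z (s : R) : 0 <= s <= 1 -> polydisc r Z ->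
  polydisc r (move_coord l t Z) -> polydisc r (move_coord l (s%:C%C * t) Z).
Proof.
move=> /andP[s0 s1] H0 H1 i; have := H0 i; have := H1 i; rewrite !move_coordE.
case: eqP => _; last by rewrite !addr0.
move=> h1 h0; rewrite (_ : Z 0 i + s%:C%C * t =
   s%:C%C * (Z 0 i + t) + (1 - s)%:C%C * Z 0 i); last by rewrite rmorphB rmorph1; ring.
apply: le_lt_trans (modcD _ _) _; rewrite !modcM !modc_real ger0_norm// ger0_norm ?subr_ge0//.
set A := modc (_ + t) in h1 *; set B := modc (Z 0 i) in h0 *.
have Mr : Num.max A B < r by rewrite gt_max h1.
have sA : s * A <= s * Num.max A B by rewrite ler_wpM2l// le_max lexx.
have sB : (1 - s) * B <= (1 - s) * Num.max A B.
  by rewrite ler_wpM2l ?subr_ge0// le_max lexx orbT.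
by apply: le_lt_trans Mr; lra.
Qed.

(** Separate holomorphy together with a bound is all that Cauchy's estimate in one
    variable asks for; joint regularity is derived from it. *)
Definition hol r S u := forall Z, polydisc r Z -> modc (u Z) <= S /\
  forall l, exists a, complex_derivative_at (fun t => u (move_coord l t Z)) 0 a.

Definition dpart (l : 'I_n) u Z : C :=
  xget 0 [set a | complex_derivative_at (fun t => u (move_coord l t Z)) 0 a].

Lemma holW r r' S S' u : r' <= r -> S <= S' -> hol r S u -> hol r' S' u.
Proof.
move=> rr SS H Z Zr; have [uS du] := H Z (polydiscW rr Zr).
by split=> //; apply: le_trans uS SS.
Qed.

Lemma hol_coord r l : hol r r (fun Z => Z 0 l).
Proof.
move=> Z hZ; split=> [|k]; first exact: ltW.
exists (l == k)%:R.
apply: complex_derivative_ext (complex_derivative_affine _ (Z 0 l) 0) => t.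
by rewrite move_coordE; case: eqP => _ /=; ring.
Qed.

Lemma complex_derivative_unique (F : C -> C) z a b :
  complex_derivative_at F z a -> complex_derivative_at F z b -> a = b.
Proof.
move=> da db; apply/eqP; rewrite -subr_eq0; apply/eqP/modc_eq0/eqP.
rewrite eq_le modc_ge0 andbT; apply/ler_addgt0Pr => e e0; rewrite add0r.
have e2 : 0 < e / 2 by rewrite divr_gt0.
have [d1 d10 H1] := da _ e2; have [d2 d20 H2] := db _ e2.
pose d := Num.min d1 d2; have d0 : 0 < d by rewrite lt_min d10.
have dd1 : d <= d1 by rewrite ge_min lexx.
have dd2 : d <= d2 by rewrite ge_min lexx orbT.
pose h : C := (d / 2)%:C%C.
have mh : modc h = d / 2 by rewrite modc_real gtr0_norm// divr_gt0.
have := H1 h ltac:(by rewrite mh; lra); have := H2 h ltac:(by rewrite mh; lra).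
set A := F (z + h) - F z => h2 h1.
have : modc ((a - b) * h) <= e / 2 * modc h + e / 2 * modc h.
  rewrite (_ : (a - b) * h = (A - b * h) - (A - a * h)); last by ring.
  by apply: le_trans (modcB _ _) _; rewrite lerD.
by rewrite modcM -mulrDl ler_pM2r ?mh ?divr_gt0//; lra.
Qed.

Lemma dpartE l u Z a : complex_derivative_at (fun t => u (move_coord l t Z)) 0 a ->
  dpart l u Z = a.
Proof.
move=> da; rewrite /dpart; case: xgetP => [b -> db|/(_ a)//].
exact: complex_derivative_unique db da.
Qed.

Lemma dpartP r S u l Z : hol r S u -> polydisc r Z ->
  complex_derivative_at (fun t => u (move_coord l t Z)) 0 (dpart l u Z).
Proof. by move=> H /H[_ /(_ l)[a da]]; rewrite (dpartE da). Qed.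

Lemma derivative_shift r S u l Z w : hol r S u -> polydisc r (move_coord l w Z) ->
  complex_derivative_at (fun t => u (move_coord l t Z)) w (dpart l u (move_coord l w Z)).
Proof.
move=> H Zw e /(dpartP l H Zw)[d d0 Hd]; exists d => // h hd.
by have := Hd h hd; rewrite add0r move_coord0 -move_coordD.
Qed.

(** The radius shrinks by the multiples of [rho] that Cauchy's estimates cost. *)
Variable rho : R.
Hypothesis rho0 : 0 < rho.

Lemma modc_dpart r S u l Z : hol (r + 2 * rho) S u -> polydisc r Z ->
  modc (dpart l u Z) <= 8 * S / rho.
Proof.
have r0 := rho0.
move=> Hu Zr.
have Z2 : polydisc (r + 2 * rho) Z by apply: polydiscW Zr; lra.
apply: (@cauchy_estimate _ (fun t => u (move_coord l t Z)) 0); last exact: (dpartP l Hu Z2).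
  exact: r0.
move=> z zr zi; rewrite add0r.
have Hs : polydisc (r + 2 * rho) (move_coord l z Z).
  move=> i; rewrite move_coordE; have := Zr i; case: eqP => _ Hi; last by rewrite addr0; lra.
  apply: le_lt_trans (modcD _ _) _; have := modc_le_ReIm z; lra.
split; first by exists (dpart l u (move_coord l z Z)); exact: (derivative_shift Hu Hs).
by have [] := Hu _ Hs.
Qed.

Lemma hol_lipschitz r S u l t Z : hol (r + 2 * rho) S u -> polydisc r Z ->
    polydisc r (move_coord l t Z) ->
  modc (u (move_coord l t Z) - u Z) <= 8 * S / rho * modc t.
Proof.
have r0 := rho0.
move=> Hu Z0 Z1.
have := @complex_mean_value _ (fun t => u (move_coord l t Z)) 0 t (8 * S / rho).
rewrite add0r move_coord0; apply => s s01; rewrite add0r.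
have Zs := polydisc_segment s01 Z0 Z1.
exists (dpart l u (move_coord l (s%:C%C * t) Z)); last exact: modc_dpart Hu Zs.
by apply: (derivative_shift Hu); apply: polydiscW Zs; lra.
Qed.

(** Difference quotients are holomorphic with bounds independent of the
    increment; the partial derivatives inherit this in the limit. *)
Definition dquot (k : 'I_n) h u Z := (u (move_coord k h Z) - u Z) / h.

Lemma dquot_derivative r S k h u l Z : hol (r + rho) S u -> modc h < rho ->
  polydisc r Z ->
  complex_derivative_at (fun t => dquot k h u (move_coord l t Z)) 0
    ((dpart l u (move_coord k h Z) - dpart l u Z) / h).
Proof.
have r0 := rho0.
move=> Hu hr Zr.
have Zh := polydisc_shift k Zr hr.
have Zr' : polydisc (r + rho) Z by apply: polydiscW Zr; lra.
have d1 := dpartP l Hu Zh; have d2 := dpartP l Hu Zr'.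
have dN := complex_derivativeM (complex_derivative_affine 0 (-1) 0) d2.
have := complex_derivativeM (complex_derivativeD d1 dN) (complex_derivative_affine 0 h^-1 0).
rewrite !mul0r !add0r !mulr0 !addr0 mulN1r => D e /D[d d0 Hd]; exists d => // w /Hd.
by rewrite /dquot !mul0r !add0r !mulN1r !(move_coordC k l).
Qed.

Lemma hol_dquot r S k h u : hol (r + 3 * rho) S u -> modc h < rho -> h != 0 ->
  hol r (8 * S / rho) (dquot k h u).
Proof.
have r0 := rho0.
move=> Hu hr h0 Z Zr; split=> [|l]; last first.
  eexists; apply: dquot_derivative hr Zr; apply: holW Hu; first by lra.
  exact: lexx.
have Zh := polydisc_shift k Zr hr.
have Zr' : polydisc (r + rho) Z by apply: polydiscW Zr; lra.
rewrite /dquot modcM modcV ler_pdivrMr ?modc_gt0//.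
apply: hol_lipschitz Zr' Zh; apply: holW Hu; first by lra.
exact: lexx.
Qed.

Lemma dpart_dquot r S k h u l Z : hol (r + rho) S u -> modc h < rho ->
  polydisc r Z -> dpart l (dquot k h u) Z = (dpart l u (move_coord k h Z) - dpart l u Z) / h.
Proof.
by move=> Hu hr Zr; apply: dpartE; exact: dquot_derivative Hu hr Zr. Qed.

Lemma dpart_lipschitz r S k h u l Z : hol (r + 5 * rho) S u -> modc h < rho ->
  polydisc r Z ->
  modc (dpart l u (move_coord k h Z) - dpart l u Z) <= 8 * (8 * S / rho) / rho * modc h.
Proof.
have r0 := rho0.
move=> Hu hr Zr; have [->|h0] := eqVneq h 0.
  by rewrite move_coord0 subrr modc0 mulr0.
have Hq : hol (r + 2 * rho) (8 * S / rho) (dquot k h u).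
  by apply: hol_dquot => //; apply: holW Hu => //; lra.
rewrite -ler_pdivrMr ?modc_gt0// -modcV -modcM.
rewrite -(@dpart_dquot (r + rho) S)//.
- exact: modc_dpart Hq Zr.
- by apply: holW Hu => //; lra.
- by apply: polydiscW Zr; lra.
Qed.

(** The partial derivative is Lipschitz by Cauchy's estimate for difference
    quotients, which makes the remainder quadratic uniformly in the base
    point. *)
Lemma hol_quadratic r S u l t Z : hol (r + 5 * rho) S u -> modc t < rho ->
  polydisc r Z ->
  modc (u (move_coord l t Z) - u Z - dpart l u Z * t) <=
    8 * (8 * S / rho) / rho * modc t ^+ 2.
Proof.
have r0 := rho0.
move=> Hu tr Zr; set K := 8 * (8 * S / rho) / rho.
have Zr5 : polydisc (r + 5 * rho) Z by apply: polydiscW Zr; lra.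
pose g (w : C) := u (move_coord l w Z) + (- dpart l u Z * w + 0).
have S0 : 0 <= S by have [uS _] := Hu Z Zr5; apply: le_trans uS; exact: modc_ge0.
have K0 : 0 <= K by rewrite /K !(divr_ge0, mulr_ge0)// ltW.
have := @complex_mean_value _ g 0 t (K * modc t).
rewrite add0r /g mulr0 !addr0 move_coord0 expr2 mulrA.
rewrite (_ : u _ - u _ - _ = u (move_coord l t Z) + - dpart l u Z * t - u Z); last by ring.
apply=> s /andP[s0 s1]; rewrite add0r.
have st : modc (s%:C%C * t) <= modc t.
  by rewrite modcM modc_real ger0_norm// ler_piMl ?modc_ge0.
have Zs : polydisc (r + rho) (move_coord l (s%:C%C * t) Z).
  by apply: polydisc_shift => //; exact: le_lt_trans st tr.
exists (dpart l u (move_coord l (s%:C%C * t) Z) + - dpart l u Z).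
  apply: complex_derivativeD (complex_derivative_affine _ _ _).
  by apply: (derivative_shift Hu); apply: polydiscW Zs; lra.
apply: le_trans (dpart_lipschitz l _ Hu _ Zr) _; first exact: le_lt_trans st tr.
exact: ler_wpM2l.
Qed.

Definition small_step (m : nat) : C := (rho / m.+2%:R)%:C%C.

Lemma small_step_neq0 m : small_step m != 0.
Proof.
by rewrite -modc_gt0 modc_real normr_gt0 mulf_neq0// gt_eqF. Qed.

Lemma modc_small_step m : modc (small_step m) = rho / m.+2%:R.
Proof.
by rewrite modc_real gtr0_norm// divr_gt0. Qed.

Lemma small_step_lt m : modc (small_step m) < rho.
Proof.
by rewrite modc_small_step ltr_pdivrMr// ltr_pMr// ltr1n. Qed.

Lemma small_step_cvg0 e : 0 < e -> exists N, forall m, (N <= m)%N -> modc (small_step m) <= e.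
Proof.
move=> e0; exists (Num.bound (rho / e)) => m Nm.
have := archi_boundP (divr_ge0 (ltW rho0) (ltW e0)).
rewrite modc_small_step ltr_pdivrMr// ler_pdivrMr// => /ltW/le_trans; apply.
rewrite mulrC ler_pM2l// ler_nat; exact: leq_trans Nm (leq_trans (leqnSn _) (leqnSn _)).
Qed.

Lemma dquot_cvg (g : C -> C) (D : C) (B : R) :
  complex_derivative_at g 0 D ->
  (forall m, modc ((g (small_step m) - g 0) / small_step m) <= B) ->
  ulimc (fun m => (g (small_step m) - g 0) / small_step m) = D.
Proof.
have r0 := rho0.
move=> dg bg; apply: ulimc_cvg; first by exists B.
move=> e /dg[d d0 H]; have [|N HN] := small_step_cvg0 (e := d / 2); first by rewrite divr_gt0.
exists N => m /HN md; have := H (small_step m) ltac:(by lra).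
rewrite add0r -ler_pdivrMr ?modc_gt0 ?small_step_neq0// -modcV -modcM.
congr (modc _ <= _); rewrite mulrBl mulfK ?small_step_neq0//.
Qed.

(** The quadratic expansions of the difference quotients in the direction [k]
    have uniform constants and pass to the limit, where the quotients become the
    [k]-th partial derivative. *)
Lemma hol_dpart_derivative r S k u l Z : hol (r + 8 * rho) S u -> polydisc r Z ->
  complex_derivative_at (fun t => dpart k u (move_coord l t Z)) 0
    (ulimc (fun m => (dpart l u (move_coord k (small_step m) Z) - dpart l u Z) / small_step m)).
Proof.
have r0 := rho0.
move=> Hu Zr; set D := ulimc _.
have Hq m : hol (r + 5 * rho) (8 * S / rho) (dquot k (small_step m) u).
  by apply: hol_dquot (small_step_lt m) (small_step_neq0 m); apply: holW Hu => //; lra.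
have Hu1 : hol (r + rho + rho) S u by apply: holW Hu => //; lra.
have qE m : dpart l (dquot k (small_step m) u) Z =
    (dpart l u (move_coord k (small_step m) Z) - dpart l u Z) / small_step m.
  by apply: (dpart_dquot _ _ Hu1 (small_step_lt m)); apply: polydiscW Zr; lra.
set K := 8 * (8 * (8 * S / rho) / rho) / rho.
have bD : bounded_seqc (fun m => (dpart l u (move_coord k (small_step m) Z) - dpart l u Z) / small_step m).
  exists (8 * (8 * S / rho) / rho) => m; rewrite -qE.
  by apply: (modc_dpart (r := r + rho)) => //; [apply: holW (Hq m) => //|apply: polydiscW Zr]; lra.
have qlim W : polydisc (r + rho) W -> bounded_seqc (fun m => dquot k (small_step m) u W) /\
    ulimc (fun m => dquot k (small_step m) u W) = dpart k u W.
  move=> Wr; have W5 : polydisc (r + 5 * rho) W by apply: polydiscW Wr; lra.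
  have bq : bounded_seqc (fun m => dquot k (small_step m) u W).
    by exists (8 * S / rho) => m; have [] := Hq m W W5.
  split=> //; pose g t := u (move_coord k t W).
  have E : (fun m => dquot k (small_step m) u W) = (fun m => (g (small_step m) - g 0) / small_step m).
    by apply/funext => m; rewrite /dquot /g move_coord0.
  rewrite E in bq *; case: bq => B bB; apply: (dquot_cvg _ bB).
  by apply: (dpartP k Hu); apply: polydiscW Wr; lra.
have key t : modc t < rho ->
    modc (dpart k u (move_coord l t Z) - dpart k u Z - D * t) <= K * modc t ^+ 2.
  move=> tr.
  have Zt := polydisc_shift l Zr tr.
  have [b1 e1] := qlim _ Zt.
  have [b2 e2] := qlim Z ltac:(by apply: polydiscW Zr; lra).
  set p := (fun m => dquot k (small_step m) u (move_coord l t Z)) in b1 e1.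
  set q := (fun m => dquot k (small_step m) u Z) in b2 e2.
  pose w m := (dpart l u (move_coord k (small_step m) Z) - dpart l u Z) / small_step m.
  have bw : bounded_seqc w := bD; have b2' := bounded_seqcZ (-1) b2.
  have bw' := bounded_seqcZ (- t) bw.
  have -> : dpart k u (move_coord l t Z) - dpart k u Z - D * t =
      ulimc (fun m => p m + -1 * q m + - t * w m).
    rewrite (ulimcD (bounded_seqcD b1 b2') bw') (ulimcD b1 b2') !ulimcZ// e1 e2 -[D]/(ulimc w).
    by ring.
  apply: (@modc_ulimc _ _ 0%N) => [|m _].
    exact: (bounded_seqcD (bounded_seqcD b1 b2') bw').
  rewrite mulN1r mulNr [t * _]mulrC /w -qE.
  exact: (hol_quadratic _ (Hq m) tr Zr).
have S0 : 0 <= S.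
  have [uS _] := Hu Z ltac:(by apply: polydiscW Zr; lra).
  by apply: le_trans uS; exact: modc_ge0.
have K0 : 0 <= K by rewrite /K !(divr_ge0, mulr_ge0)// ltW.
move=> e e0; exists (Num.min rho (e / (K + 1))); first by rewrite lt_min rho0 divr_gt0// ltr_wpDl.
move=> h; rewrite lt_min add0r move_coord0 ltr_pdivlMr ?ltr_wpDl// => /andP[/key hk he].
by apply: le_trans hk _; have := modc_ge0 h; nra.
Qed.

Lemma hol_dpart r S k u : hol (r + 8 * rho) S u -> hol r (8 * S / rho) (dpart k u).
Proof.
have r0 := rho0.
move=> Hu Z Zr; split=> [|l].
  by apply: modc_dpart Zr; apply: holW Hu => //; lra.
eexists; exact: hol_dpart_derivative Hu Zr.
Qed.

(** The derivative computed in [hol_dpart_derivative] is a limit of difference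
    quotients of [dpart l u] in the direction [k]. *)
Lemma dpartC r S k l u Z : hol (r + 8 * rho) S u -> polydisc r Z ->
  dpart l (dpart k u) Z = dpart k (dpart l u) Z.
Proof.
have r0 := rho0.
move=> Hu Zr; rewrite (dpartE (hol_dpart_derivative k l Hu Zr)).
have dk := hol_dpart_derivative l k Hu Zr; rewrite (dpartE dk).
rewrite -[RHS](dpartE dk); set D := dpart k _ Z.
have -> : dpart l u Z = dpart l u (move_coord k 0 Z) by rewrite move_coord0.
apply: (dquot_cvg (g := fun t => dpart l u (move_coord k t Z)) (B := 8 * (8 * S / rho) / rho)).
  by rewrite /D (dpartE dk).
move=> m; rewrite move_coord0 modcM modcV ler_pdivrMr ?modc_gt0 ?small_step_neq0//.
by apply: (dpart_lipschitz _ _ (holW _ (lexx S) Hu) (small_step_lt m) Zr); lra.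
Qed.

End Polydisc.

(** * A translation invariant mean on the cube *)

Section GridMean.
Variables (R : realType) (n : nat) (a : R).
Hypothesis a0 : 0 < a.
Local Notation C := R[i].
Local Notation axis := ('I_n * bool)%type.
Implicit Types (u v : 'rV[C]_n -> C) (f g : 'rV[C]_n -> R) (Z : 'rV[C]_n).

(** Functions are averaged over a cube in the real coordinates, each complex
    coordinate contributing two axes: [(k, false)] for the real and [(k, true)]
    for the imaginary part. *)
Definition cube Z := forall k, `|complex.Re (Z 0 k)| <= a /\ `|complex.Im (Z 0 k)| <= a.

Definition mesh (m : nat) : R := a * 2 / m.+1%:R.

Definition tick m (j : nat) : R := - a + mesh m * j%:R.

Definition grid_point m (p : {ffun axis -> 'I_m.+1}) : 'rV[C]_n :=
  \row_k Complex (tick m (p (k, false))) (tick m (p (k, true))).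

Lemma mesh_gt0 m : 0 < mesh m.
Proof. by rewrite divr_gt0// mulr_gt0. Qed.

Lemma mesh_small e : 0 < e -> exists N, forall m, (N <= m)%N -> mesh m < e.
Proof.
move=> e0; exists (Num.bound (a * 2 / e)) => m Nm.
have := archi_boundP (divr_ge0 (mulr_ge0 (ltW a0) (ler0n R 2)) (ltW e0) : 0 <= a * 2 / e).
rewrite /mesh ltr_pdivrMr// ltr_pdivrMr// => /lt_le_trans; apply.
by rewrite [leRHS]mulrC ler_pM2r// ler_nat (leq_trans Nm).
Qed.

Lemma tick_bound m (j : nat) : (j <= m.+1)%N -> `|tick m j| <= a.
Proof.
have a_gt0 := a0.
move=> jm; have := mesh_gt0 m => h0; have jM : mesh m * j%:R <= a * 2.
  rewrite /mesh mulrAC ler_pdivrMr// ler_pM2l ?mulr_gt0// ler_nat//.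
by rewrite ler_norml /tick; have := mulr_ge0 (ltW h0) (ler0n R j); lra.
Qed.

Lemma cube_grid_point m p : cube (@grid_point m p).
Proof. by move=> k; rewrite !mxE /=; split; apply: tick_bound; apply: ltnW. Qed.

Definition grid_mean m f : R :=
  (\sum_(p : {ffun axis -> 'I_m.+1}) f (grid_point p)) / #|{ffun axis -> 'I_m.+1}|%:R.

Lemma card_grid_gt0 m : 0 < #|{ffun axis -> 'I_m.+1}|%:R :> R.
Proof. by rewrite ltr0n card_ffun card_ord expn_gt0. Qed.

Lemma grid_mean_le m f g : (forall Z, cube Z -> f Z <= g Z) -> grid_mean m f <= grid_mean m g.
Proof.
move=> fg; rewrite ler_pM2r ?invr_gt0 ?card_grid_gt0//.
by apply: ler_sum => p _; apply: fg; exact: cube_grid_point.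
Qed.

Lemma grid_mean_cst m (c : R) : grid_mean m (fun=> c) = c.
Proof.
rewrite /grid_mean sumr_const -[c *+ _]mulr_natr mulfK//.
by rewrite gt_eqF// card_grid_gt0.
Qed.

Lemma grid_meanD m f g : grid_mean m (fun Z => f Z + g Z) = grid_mean m f + grid_mean m g.
Proof. by rewrite /grid_mean big_split mulrDl. Qed.

Lemma grid_meanZ m (c : R) f : grid_mean m (fun Z => c * f Z) = c * grid_mean m f.
Proof. by rewrite /grid_mean -mulr_sumr mulrA. Qed.

Lemma norm_grid_mean m f (b : R) : (forall Z, cube Z -> `|f Z| <= b) -> `|grid_mean m f| <= b.
Proof.
move=> fb; rewrite ler_norml -{1}(grid_mean_cst m b) -{2}(grid_mean_cst m b) -mulN1r -grid_meanZ.
by apply/andP; split; apply: grid_mean_le => Z /fb; rewrite ler_norml ?mulN1r => /andP[].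
Qed.

Definition bounded_on_cube f := exists b, forall Z, cube Z -> `|f Z| <= b.

Lemma bounded_grid_mean f : bounded_on_cube f -> bounded_seq (fun m => grid_mean m f).
Proof. by move=> [b fb]; exists b => m; exact: norm_grid_mean. Qed.

(** The ultralimit makes the mean of every bounded function meaningful and
    linear, measurable or not. *)
Definition cube_mean f : R := ulim (fun m => grid_mean m f).

Lemma cube_meanD f g : bounded_on_cube f -> bounded_on_cube g ->
  cube_mean (fun Z => f Z + g Z) = cube_mean f + cube_mean g.
Proof.
move=> /bounded_grid_mean bf /bounded_grid_mean bg; rewrite /cube_mean -ulimD//.
by congr ulim; apply/funext => m; exact: grid_meanD.
Qed.

Lemma cube_meanZ (c : R) f : bounded_on_cube f -> cube_mean (fun Z => c * f Z) = c * cube_mean f.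
Proof.
move=> /bounded_grid_mean bf; rewrite /cube_mean -ulimZ//.
by congr ulim; apply/funext => m; exact: grid_meanZ.
Qed.

Lemma cube_mean_le f g : bounded_on_cube f -> bounded_on_cube g ->
  (forall Z, cube Z -> f Z <= g Z) -> cube_mean f <= cube_mean g.
Proof.
move=> /bounded_grid_mean bf /bounded_grid_mean bg fg.
by apply: (@ulim_le _ _ _ 0%N) => // m _; exact: grid_mean_le.
Qed.

Lemma eq_cube_mean f g : (forall Z, cube Z -> f Z = g Z) -> cube_mean f = cube_mean g.
Proof.
move=> fg; congr ulim; apply/funext => m; congr (_ / _).
by apply: eq_bigr => p _; apply: fg; exact: cube_grid_point.
Qed.

Lemma cube_mean_ge0 f : bounded_on_cube f -> (forall Z, cube Z -> 0 <= f Z) -> 0 <= cube_mean f.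
Proof.
move=> bf f0; have L0 : cube_mean (fun=> 0) = 0.
  rewrite /cube_mean (_ : (fun m => _) = fun=> 0) ?ulim_cst//.
  by apply/funext => m; exact: grid_mean_cst.
by rewrite -L0; apply: cube_mean_le => //; exists 0 => Z _; rewrite normr0.
Qed.

Lemma bounded_on_cubeD f g : bounded_on_cube f -> bounded_on_cube g ->
  bounded_on_cube (fun Z => f Z + g Z).
Proof.
move=> [b fb] [c gc]; exists (b + c) => Z hZ.
by apply: le_trans (ler_normD _ _) _; rewrite lerD ?fb ?gc.
Qed.

Lemma bounded_on_cubeM f g : bounded_on_cube f -> bounded_on_cube g ->
  bounded_on_cube (fun Z => f Z * g Z).
Proof.
move=> [b fb] [c gc]; exists (b * c) => Z hZ.
by rewrite normrM ler_pM ?fb ?gc.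
Qed.

Definition axis_step (d : axis) (h : R) : C :=
  if d.2 then Complex 0 h else Complex h 0.

Definition axis_coord (d : axis) Z : R :=
  if d.2 then complex.Im (Z 0 d.1) else complex.Re (Z 0 d.1).

(** The cyclic shift wraps around at the last tick, where [f] and its translate
    both vanish. *)
Definition next_index m (d : axis) (p : {ffun axis -> 'I_m.+1}) : {ffun axis -> 'I_m.+1} :=
  [ffun j => if j == d then ordS (p j) else p j].

Lemma next_index_inj m d : injective (@next_index m d).
Proof.
move=> p q /ffunP pq; apply/ffunP => j; have := pq j; rewrite !ffunE.
by case: eqP => // _; exact: ordS_inj.
Qed.

Lemma axis_coord_grid m d p : axis_coord d (@grid_point m p) = tick m (p d).
Proof. by case: d => k [] /=; rewrite /axis_coord /= mxE. Qed.

Lemma tickS m j : tick m j.+1 = tick m j + mesh m.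
Proof. by rewrite /tick -addn1 natrD mulrDr mulr1 addrA. Qed.

(** Discrete integration by parts: as [f] vanishes on the two faces
    orthogonal to the axis, translation by one mesh only permutes the terms of the
    sum. *)
Lemma grid_mean_translate m d f :
    (forall Z, cube Z -> `|axis_coord d Z| = a -> f Z = 0) ->
  grid_mean m (fun Z => f (move_coord d.1 (axis_step d (mesh m)) Z)) = grid_mean m f.
Proof.
move=> f0; congr (_ / _); rewrite [RHS](reindex_inj (@next_index_inj m d)).
apply: eq_bigr => p _.
have tick_end : tick m m.+1 = a by rewrite /tick /mesh; field; rewrite addrC natr1.
pose q j : nat := if j == d then (p j).+1 else p j.
have sE : move_coord d.1 (axis_step d (mesh m)) (grid_point p) =
    \row_k Complex (tick m (q (k, false))) (tick m (q (k, true))).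
  apply/rowP => k; rewrite move_coordE !mxE /q; case: d {f0 q} => l [] /=;
    rewrite !xpair_eqE ?andbF ?andbT /axis_step /=;
    by case: eqP => /= _; rewrite ?tickS; apply: complex_eqP => /=; rewrite ?addr0.
have [pd|pd] := eqVneq (p d : nat) m; last first.
  congr f; rewrite sE; apply/rowP => k; rewrite !mxE !ffunE /q.
  have nE : ordS (p d) = (p d).+1 :> nat.
    by rewrite /= modn_small// ltnS ltn_neqAle pd -ltnS ltn_ord.
  by congr Complex; case: eqP => // ->; rewrite nE.
rewrite f0 ?f0//.
- exact: cube_grid_point.
- rewrite axis_coord_grid ffunE eqxx /= pd modnn /tick mulr0 addr0 normrN.
  by rewrite gtr0_norm.
- rewrite sE => k; rewrite !mxE /=; split; apply: tick_bound; rewrite /q;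
    by case: ifP => _; rewrite ?ltn_ord// ltnW.
- rewrite sE; have -> : axis_coord d (\row_k Complex (tick m (q (k, false))) (tick m (q (k, true))))
      = tick m (q d) by case: (d) => k [] /=; rewrite /axis_coord /= mxE.
  by rewrite /q eqxx pd tick_end gtr0_norm.
Qed.

(** The difference quotient with the mesh as increment has mean [0] on each
    grid and approximates [f'] uniformly. *)
Lemma cube_mean_derivative d f f' : bounded_on_cube f' ->
    (forall Z, cube Z -> `|axis_coord d Z| = a -> f Z = 0) ->
    (forall e, 0 < e -> exists2 del, 0 < del & forall h Z, 0 < h -> h < del -> cube Z ->
       `|f (move_coord d.1 (axis_step d h) Z) - f Z - h * f' Z| <= e * h) ->
  cube_mean f' = 0.
Proof.
move=> bf' f0 df; apply/eqP; rewrite -normr_eq0 eq_le normr_ge0 andbT.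
apply/ler_addgt0Pr => e e0; rewrite add0r.
have [del del0 H] := df e e0; have [N HN] := mesh_small del0.
have b m : (N <= m)%N -> `|grid_mean m f'| <= e.
  move=> Nm; have h0 := mesh_gt0 m.
  pose F Z := f (move_coord d.1 (axis_step d (mesh m)) Z) + (-1 * f Z + - mesh m * f' Z).
  have K : `|grid_mean m F| <= e * mesh m.
    apply: norm_grid_mean => Z hZ; rewrite /F mulN1r mulNr addrA.
    by apply: H => //; exact: HN.
  have E : grid_mean m F = - mesh m * grid_mean m f'.
    by rewrite !grid_meanD !grid_meanZ grid_mean_translate// mulN1r addrA subrr add0r.
  by move: K; rewrite E normrM normrN (gtr0_norm h0) [e * _]mulrC ler_pM2l.
have bb := bounded_grid_mean bf'.
have be (c : R) : bounded_seq (fun=> c) by exists `|c|.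
rewrite ler_norml; apply/andP; split.
  rewrite -[leLHS]ulim_cst; apply: (@ulim_le _ _ _ N) => // m /b.
  by rewrite ler_norml => /andP[].
rewrite -[leRHS]ulim_cst; apply: (@ulim_le _ _ _ N) => // m /b.
by rewrite ler_norml => /andP[].
Qed.

(** The grid points in the small cube around [0] make up a proportion of all grid
    points that is bounded below independently of the mesh. *)
Lemma cube_mean_gt0 f (c del : R) : bounded_on_cube f -> (forall Z, cube Z -> 0 <= f Z) ->
    0 < c -> 0 < del -> (forall Z, cube Z ->
      (forall k, `|complex.Re (Z 0 k)| <= del /\ `|complex.Im (Z 0 k)| <= del) -> c <= f Z) ->
  0 < cube_mean f.
Proof.
have a_gt0 := a0.
move=> bf f0 c0 del0 fc.
(* the ticks with index M/2 + i, i < M/q, lie within del of 0 *)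
pose q := (Num.bound (a * 2 / del)).+2.
have q0 : 0 < q%:R :> R by rewrite ltr0n.
have qdel : a * 2 <= q%:R * del.
  have := archi_boundP (divr_ge0 (mulr_ge0 (ltW a0) (ler0n R 2)) (ltW del0) : 0 <= a * 2 / del).
  rewrite ltr_pdivrMr// => /ltW/le_trans; apply; rewrite ler_pM2r// ler_nat.
  exact: leq_trans (leqnSn _) (leqnSn _).
pose kap : R := ((2 * q)%:R^-1) ^+ #|{: axis}|.
have kap0 : 0 < kap by rewrite exprn_gt0// invr_gt0 ltr0n.
apply: (@lt_le_trans _ _ (c * kap)); first exact: mulr_gt0.
rewrite -(ulim_cst (c * kap)); apply: (@ulim_le _ _ _ (2 * q)%N).
- by exists `|c * kap|.
- exact: bounded_grid_mean.
move=> m qm; pose M := m.+1.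
pose J := [set j : 'I_m.+1 | `|tick m j| <= del]%SET.
have JM : (M <= 2 * q * #|J|)%N.
  have lt_ (i : 'I_(M %/ q)) : (M %/ 2 + i < m.+1)%N.
    have := ltn_ord i; have : (M %/ q <= M %/ 2)%N by apply: leq_div2l.
    by rewrite -/M; lia.
  pose g (i : 'I_(M %/ q)) : 'I_m.+1 := Ordinal (lt_ i).
  have gi : injective g by move=> i j /(congr1 val) /= /addnI /val_inj.
  have gJ i : g i \in J.
    suff : `|tick m (g i)| <= del by rewrite inE.
    rewrite (_ : tick m (g i) = - a + mesh m * ((M %/ 2)%:R + i%:R)); last first.
      by rewrite /tick -natrD.
    rewrite /mesh -/M.
    have M0 : 0 < M%:R :> R by rewrite ltr0n.
    have i1 : i%:R * q%:R <= M%:R :> R.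
      rewrite -natrM ler_nat; apply: leq_trans (leq_divM M q).
      by rewrite leq_mul2r ltnW ?orbT.
    have [H1 H2] : (M%:R - 1 <= (M %/ 2)%:R * 2 :> R) /\ ((M %/ 2)%:R * 2 <= M%:R :> R).
      rewrite lerBlDr -natrM natr1 !ler_nat; split; lia.
    have qM : 2 * q%:R <= M%:R :> R.
      by rewrite -natrM ler_nat /M ltnW.
    rewrite (_ : - a + _ = a * ((M %/ 2)%:R * 2 - M%:R + 2 * i%:R) / M%:R); last first.
      by field; rewrite gt_eqF.
    rewrite normrM [`|_^-1|]gtr0_norm ?invr_gt0// ler_pdivrMr// normrM (gtr0_norm a0).
    have i0 : 0 <= i%:R :> R by [].
    have A1 : `|(M %/ 2)%:R * 2 - M%:R + 2 * i%:R| * q%:R <= 2 * M%:R :> R.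
      rewrite -[q%:R]gtr0_norm// -normrM ler_norml; apply/andP; split; nra.
    have A2 : 0 <= `|(M %/ 2)%:R * 2 - M%:R + 2 * i%:R| :> R by [].
    move: A1 A2; set A := `|_| => A1 A2.
    rewrite -(ler_pM2r q0).
    have : a * (A * q%:R) <= a * (2 * M%:R) by rewrite ler_pM2l.
    have : a * 2 * M%:R <= q%:R * del * M%:R by rewrite ler_pM2r.
    by lra.
  have : (M %/ q <= #|J|)%N.
    have <- : #|g @: [set: 'I_(M %/ q)]%SET| = (M %/ q)%N by rewrite card_imset// cardsT card_ord.
    by apply/subset_leq_card/fintype.subsetP => _ /imsetP[i _ ->]; exact: gJ.
  have := divn_eq M q; have : (M %% q < q)%N by rewrite ltn_mod.
  by move: qm; rewrite -/M; nia.
rewrite /grid_mean ler_pdivlMr ?card_grid_gt0//.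
pose P := [set p : {ffun axis -> 'I_m.+1} | p \in ffun_on (mem J)]%SET.
rewrite (bigID (mem P)) /= ler_wpDr//.
  by apply: sumr_ge0 => p _; apply: f0; exact: cube_grid_point.
apply: (@le_trans _ _ (\sum_(p in P) c)); last first.
  apply: ler_sum => p; rewrite inE => /ffun_onP pJ.
  apply: fc (cube_grid_point p) _ => k; rewrite !mxE /=.
  by have := pJ (k, false); have := pJ (k, true); rewrite !inE.
rewrite sumr_const cardsE card_ffun_on card_ffun card_ord -[leRHS]mulr_natr -mulrA ler_pM2l//.
rewrite /kap exprVn -natrX ler_pdivrMl ?ltr0n ?expn_gt0 ?muln_gt0//.
rewrite -natrM ler_nat -expnMn; have [->//|K0] := posnP #|{: axis}|.
by rewrite leq_exp2r.
Qed.

End GridMean.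

(** * Wirtinger calculus *)

Section Wirtinger.
Variables (R : realType) (n : nat) (a : R).
Hypothesis a0 : 0 < a.
Local Notation C := R[i].
Local Notation cube := (@cube R n a).
Local Notation cube_mean := (@cube_mean R n a).
Implicit Types (u v p q : 'rV[C]_n -> C) (f g : 'rV[C]_n -> R) (Z : 'rV[C]_n).

Definition bounded_on_cubec u := bounded_on_cube a (fun Z => modc (u Z)).

Lemma bounded_on_cubecP u : bounded_on_cubec u <->
  exists2 b, 0 <= b & forall Z, cube Z -> modc (u Z) <= b.
Proof.
split=> [[b ub]|[b b0 ub]]; last first.
  by exists b => Z /ub; rewrite ger0_norm// modc_ge0.
exists `|b|; first exact: normr_ge0.
by move=> Z /ub; rewrite ger0_norm ?modc_ge0// => /le_trans; apply; exact: ler_norm.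
Qed.

Lemma bounded_on_cubecD u v : bounded_on_cubec u -> bounded_on_cubec v ->
  bounded_on_cubec (fun Z => u Z + v Z).
Proof.
move=> /bounded_on_cubecP[b b0 ub] /bounded_on_cubecP[c c0 vc].
apply/bounded_on_cubecP; exists (b + c); first exact: addr_ge0.
by move=> Z hZ; apply: le_trans (modcD _ _) _; rewrite lerD ?ub ?vc.
Qed.

Lemma bounded_on_cubecM u v : bounded_on_cubec u -> bounded_on_cubec v ->
  bounded_on_cubec (fun Z => u Z * v Z).
Proof.
move=> /bounded_on_cubecP[b b0 ub] /bounded_on_cubecP[c c0 vc].
apply/bounded_on_cubecP; exists (b * c); first exact: mulr_ge0.
by move=> Z hZ; rewrite modcM ler_pM ?modc_ge0 ?ub ?vc.
Qed.

Lemma bounded_on_cubec_cst (c : C) : bounded_on_cubec (fun=> c).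
Proof. by apply/bounded_on_cubecP; exists (modc c); rewrite ?modc_ge0. Qed.

Lemma bounded_on_cubec_conj u : bounded_on_cubec u -> bounded_on_cubec (fun Z => conjc (u Z)).
Proof. by move=> [b ub]; exists b => Z; rewrite modc_conj; exact: ub. Qed.

Lemma bounded_on_cubec_sum (I : Type) (r : seq I) (P : pred I) (F : I -> 'rV[C]_n -> C) :
  (forall i, P i -> bounded_on_cubec (F i)) ->
  bounded_on_cubec (fun Z => \sum_(i <- r | P i) F i Z).
Proof.
move=> bF; elim: r => [|i r IH].
  rewrite (_ : (fun Z => _) = fun=> 0); first exact: bounded_on_cubec_cst.
  by apply/funext => Z; rewrite big_nil.
have [Pi|nPi] := boolP (P i).
  rewrite (_ : (fun Z => _) = fun Z => F i Z + \sum_(i <- r | P i) F i Z).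
    exact: bounded_on_cubecD (bF i Pi) IH.
  by apply/funext => Z; rewrite big_cons Pi.
rewrite (_ : (fun Z => _) = fun Z => \sum_(i <- r | P i) F i Z)//.
by apply/funext => Z; rewrite big_cons (negbTE nPi).
Qed.

Lemma bounded_Re u : bounded_on_cubec u -> bounded_on_cube a (fun Z => complex.Re (u Z)).
Proof.
move=> [b ub]; exists b => Z /ub; rewrite ger0_norm ?modc_ge0//.
by apply: le_trans; exact: Re_le_modc.
Qed.

Lemma bounded_Im u : bounded_on_cubec u -> bounded_on_cube a (fun Z => complex.Im (u Z)).
Proof.
move=> [b ub]; exists b => Z /ub; rewrite ger0_norm ?modc_ge0//.
by apply: le_trans; exact: Im_le_modc.
Qed.

Lemma bounded_on_cubec_real f : bounded_on_cube a f ->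
  bounded_on_cubec (fun Z => (f Z)%:C%C).
Proof. by move=> [b fb]; exists b => Z /fb; rewrite modc_real normr_id. Qed.

Definition cube_meanc u : C :=
  Complex (cube_mean (fun Z => complex.Re (u Z))) (cube_mean (fun Z => complex.Im (u Z))).

Lemma eq_cube_meanc u v : (forall Z, cube Z -> u Z = v Z) -> cube_meanc u = cube_meanc v.
Proof. by move=> uv; congr Complex; apply: (eq_cube_mean a0) => Z /uv ->. Qed.

Lemma cube_meancD u v : bounded_on_cubec u -> bounded_on_cubec v ->
  cube_meanc (fun Z => u Z + v Z) = cube_meanc u + cube_meanc v.
Proof.
move=> bu bv; apply: complex_eqP; rewrite ?Re_add ?Im_add /=.
  rewrite -(cube_meanD a0 (bounded_Re bu) (bounded_Re bv)).
  by apply: (eq_cube_mean a0) => Z _; rewrite Re_add.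
rewrite -(cube_meanD a0 (bounded_Im bu) (bounded_Im bv)).
by apply: (eq_cube_mean a0) => Z _; rewrite Im_add.
Qed.

Lemma cube_meancZ (c : C) u : bounded_on_cubec u -> cube_meanc (fun Z => c * u Z) = c * cube_meanc u.
Proof.
move=> bu; have bR := bounded_Re bu; have bI := bounded_Im bu.
have bZ (k : R) f : bounded_on_cube a f -> bounded_on_cube a (fun Z => k * f Z).
  by move=> bf; apply: bounded_on_cubeM bf; exists `|k|.
apply: complex_eqP; rewrite ?Re_mul ?Im_mul /=.
  rewrite -mulNr -!(cube_meanZ a0)// -(cube_meanD a0); do ?[exact: bZ].
  by apply: (eq_cube_mean a0) => Z _; rewrite Re_mul mulNr.
rewrite -!(cube_meanZ a0)// -(cube_meanD a0); do ?[exact: bZ].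
by apply: (eq_cube_mean a0) => Z _; rewrite Im_mul.
Qed.

Lemma cube_meanc_real f : cube_meanc (fun Z => (f Z)%:C%C) = (cube_mean f)%:C%C.
Proof.
rewrite /cube_meanc /=; congr Complex.
rewrite /cube_mean (_ : (fun m => _) = fun=> 0) ?ulim_cst//.
by apply/funext => m; exact: grid_mean_cst.
Qed.

Lemma cube_meanc_sum (I : Type) (r : seq I) (P : pred I) (F : I -> 'rV[C]_n -> C) :
  (forall i, P i -> bounded_on_cubec (F i)) ->
  cube_meanc (fun Z => \sum_(i <- r | P i) F i Z) = \sum_(i <- r | P i) cube_meanc (F i).
Proof.
move=> bF; elim: r => [|i r IH].
  rewrite big_nil -[RHS]/(0%:C)%C (_ : cube_meanc _ = cube_meanc (fun=> (0%:C)%C)).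
    rewrite cube_meanc_real; congr (_%:C)%C; rewrite /cube_mean (_ : (fun m => _) = fun=> 0) ?ulim_cst//.
    by apply/funext => m; exact: grid_mean_cst.
  by apply: eq_cube_meanc => Z _; rewrite big_nil.
rewrite big_cons -IH; case: ifP => [Pi|nPi].
  rewrite -cube_meancD; [|exact: bF|exact: bounded_on_cubec_sum].
  by apply: eq_cube_meanc => Z _; rewrite big_cons Pi.
by apply: eq_cube_meanc => Z _; rewrite big_cons nPi.
Qed.

Lemma modc_cube_meanc u f : bounded_on_cubec u -> bounded_on_cube a f ->
  (forall Z, cube Z -> modc (u Z) <= f Z) -> modc (cube_meanc u) <= cube_mean f.
Proof.
move=> bu bf uf; set z := cube_meanc u.
have [z0|z0] := eqVneq z 0.
  rewrite z0 modc0; apply: (cube_mean_ge0 a0) => // Z /uf; apply: le_trans; exact: modc_ge0.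
have mz : 0 < modc z by rewrite modc_gt0.
have bcu : bounded_on_cubec (fun Z => conjc z * u Z).
  exact: bounded_on_cubecM (bounded_on_cubec_cst _) bu.
have E : complex.Re (cube_meanc (fun Z => conjc z * u Z)) = modc z * modc z.
  rewrite cube_meancZ// -/z -expr2 modc_sqr; case: (z) => x y /=.
  by ring.
have bzf : bounded_on_cube a (fun Z => modc z * f Z).
  by apply: bounded_on_cubeM bf; exists `|modc z|.
have : complex.Re (cube_meanc (fun Z => conjc z * u Z)) <= modc z * cube_mean f.
  rewrite -(cube_meanZ a0)//; apply: (cube_mean_le a0 (bounded_Re bcu) bzf) => Z hZ.
  apply: le_trans (ler_norm _) _; apply: le_trans (Re_le_modc _) _.
  by rewrite modcM modc_conj ler_wpM2l ?modc_ge0 ?uf.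
by rewrite E ler_pM2l.
Qed.

(** [p] and [q] are the Wirtinger derivatives of [u] with respect to the [l]-th
    variable and its conjugate.  The expansion is uniform on the cube, as the grid
    means require, and it evaluates [u] also slightly outside of the cube. *)
Definition wirtinger (l : 'I_n) u p q :=
  [/\ bounded_on_cubec u, bounded_on_cubec p, bounded_on_cubec q &
    forall e, 0 < e -> exists2 d, 0 < d & forall t, modc t < d -> forall Z, cube Z ->
      modc (u (move_coord l t Z) - u Z - (p Z * t + q Z * conjc t)) <= e * modc t].

Lemma wirtinger_cst l (c : C) : wirtinger l (fun=> c) (fun=> 0) (fun=> 0).
Proof.
split; do ?exact: bounded_on_cubec_cst.
move=> e e0; exists 1 => // t _ Z _; rewrite subrr !mul0r addr0 subr0 modc0.
by apply: mulr_ge0; [exact: ltW|exact: modc_ge0].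
Qed.

Lemma eq_wirtinger l u p q p' q' : wirtinger l u p q ->
  (forall Z, cube Z -> p Z = p' Z) -> (forall Z, cube Z -> q Z = q' Z) ->
  wirtinger l u p' q'.
Proof.
move=> [bu [bp Hp] [bq Hq] H] pp qq; split=> //.
- by exists bp => Z hZ; rewrite -pp//; exact: Hp.
- by exists bq => Z hZ; rewrite -qq//; exact: Hq.
- move=> e /H[d d0 Hd]; exists d => // t td Z hZ; rewrite -pp// -qq//.
  exact: Hd.
Qed.

Lemma wirtinger_conj l u p q : wirtinger l u p q ->
  wirtinger l (fun Z => conjc (u Z)) (fun Z => conjc (q Z)) (fun Z => conjc (p Z)).
Proof.
move=> [bu bp bq H]; split; do ?exact: bounded_on_cubec_conj.
move=> e /H[d d0 Hd]; exists d => // t td Z hZ.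
rewrite -modc_conj; apply: le_trans (Hd t td Z hZ); rewrite le_eqVlt; apply/orP; left.
apply/eqP; congr modc.
by rewrite !(rmorphB, rmorphD, rmorphM) /= !conjcK; ring.
Qed.

Lemma wirtingerD l u1 p1 q1 u2 p2 q2 : wirtinger l u1 p1 q1 -> wirtinger l u2 p2 q2 ->
  wirtinger l (fun Z => u1 Z + u2 Z) (fun Z => p1 Z + p2 Z) (fun Z => q1 Z + q2 Z).
Proof.
move=> [bu1 bp1 bq1 H1] [bu2 bp2 bq2 H2]; split; do ?exact: bounded_on_cubecD.
move=> e e0; have e2 : 0 < e / 2 by rewrite divr_gt0.
have [d1 d10 K1] := H1 _ e2; have [d2 d20 K2] := H2 _ e2.
exists (Num.min d1 d2); first by rewrite lt_min d10.
move=> t; rewrite lt_min => /andP[td1 td2] Z hZ.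
rewrite (_ : _ - _ - _ = (u1 (move_coord l t Z) - u1 Z - (p1 Z * t + q1 Z * conjc t)) +
   (u2 (move_coord l t Z) - u2 Z - (p2 Z * t + q2 Z * conjc t))); last by ring.
by apply: le_trans (modcD _ _) _; have := K1 t td1 Z hZ; have := K2 t td2 Z hZ; lra.
Qed.

Lemma wirtinger_lipschitz l u p q : wirtinger l u p q ->
  exists2 K, 0 < K & exists2 d, 0 < d & forall t, modc t < d -> forall Z, cube Z ->
    modc (u (move_coord l t Z) - u Z) <= K * modc t.
Proof.
move=> [_ /bounded_on_cubecP[bp bp0 Hp] /bounded_on_cubecP[bq bq0 Hq] H].
have [d d0 Hd] := H 1 ltr01.
exists (1 + bp + bq); first lra.
exists d => // t td Z hZ; have := Hd t td Z hZ.
have := modcD (u (move_coord l t Z) - u Z - (p Z * t + q Z * conjc t)) (p Z * t + q Z * conjc t).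
rewrite subrK; have := modcD (p Z * t) (q Z * conjc t); rewrite !modcM modc_conj.
have m0 := modc_ge0 t.
have : modc (p Z) * modc t <= bp * modc t by rewrite ler_wpM2r ?Hp.
have : modc (q Z) * modc t <= bq * modc t by rewrite ler_wpM2r ?Hq.
lra.
Qed.

Lemma wirtingerM l u1 p1 q1 u2 p2 q2 : wirtinger l u1 p1 q1 -> wirtinger l u2 p2 q2 ->
  wirtinger l (fun Z => u1 Z * u2 Z) (fun Z => p1 Z * u2 Z + u1 Z * p2 Z)
    (fun Z => q1 Z * u2 Z + u1 Z * q2 Z).
Proof.
move=> W1 W2; have [K1 K10 [d1 d10 L1]] := wirtinger_lipschitz W1.
have [K2 K20 [d2 d20 L2]] := wirtinger_lipschitz W2.
move: W1 W2 => [bu1 bp1 bq1 H1] [bu2 bp2 bq2 H2].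
split; do ?[exact: bounded_on_cubecM|
  by apply: bounded_on_cubecD; exact: bounded_on_cubecM].
move: bu1 bu2 => /bounded_on_cubecP[b1 b10 B1] /bounded_on_cubecP[b2 b20 B2] e e0.
pose k := b1 + b2 + 1; have k0 : 0 < k by rewrite /k; lra.
have e2 : 0 < e / (2 * k) by rewrite divr_gt0// mulr_gt0.
have [d3 d30 M1] := H1 _ e2; have [d4 d40 M2] := H2 _ e2.
pose d5 := e / (2 * K1 * K2); have d50 : 0 < d5 by rewrite divr_gt0// !mulr_gt0.
exists (Num.min (Num.min d1 d2) (Num.min (Num.min d3 d4) d5)).
  by rewrite !lt_min d10 d20 d30 d40.
move=> t; rewrite !lt_min => /andP[/andP[t1 t2] /andP[/andP[t3 t4] t5]] Z hZ.
set U1 := u1 (move_coord l t Z); set U2 := u2 (move_coord l t Z).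
rewrite (_ : _ - _ - _ = (U1 - u1 Z - (p1 Z * t + q1 Z * conjc t)) * u2 Z +
   u1 Z * (U2 - u2 Z - (p2 Z * t + q2 Z * conjc t)) + (U1 - u1 Z) * (U2 - u2 Z)); last by ring.
have m0 := modc_ge0 t.
apply: le_trans (modcD _ _) _; apply: le_trans (lerD (modcD _ _) (lexx _)) _.
rewrite !modcM.
have A1 : modc (U1 - u1 Z - (p1 Z * t + q1 Z * conjc t)) * modc (u2 Z) <=
    e / (2 * k) * modc t * b2 by rewrite ler_pM ?modc_ge0 ?M1 ?B2.
have A2 : modc (u1 Z) * modc (U2 - u2 Z - (p2 Z * t + q2 Z * conjc t)) <=
    b1 * (e / (2 * k) * modc t) by rewrite ler_pM ?modc_ge0 ?M2 ?B1.
have A3 : modc (U1 - u1 Z) * modc (U2 - u2 Z) <= K1 * modc t * (K2 * modc t).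
  by rewrite ler_pM ?modc_ge0 ?L1 ?L2.
have A4 : K1 * modc t * (K2 * modc t) <= e / 2 * modc t.
  rewrite (_ : _ * (K2 * _) = (modc t * (K1 * K2)) * modc t); last by ring.
  rewrite ler_wpM2r//; move: (ltW t5); rewrite /d5 ler_pdivlMr ?mulr_gt0//.
  by lra.
have A5 : e / (2 * k) * modc t * (b1 + b2) <= e / 2 * modc t.
  rewrite (_ : e / (2 * k) * modc t * (b1 + b2) = e / 2 * modc t * ((b1 + b2) / k)).
    by rewrite ler_piMr ?mulr_ge0 ?divr_ge0 ?(ltW e0)// ler_pdivrMr// /k; lra.
  by field; rewrite gt_eqF.
by lra.
Qed.

Lemma wirtinger_sum l (I : Type) (r : seq I) (u p q : I -> 'rV[C]_n -> C) :
  (forall i, wirtinger l (u i) (p i) (q i)) ->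
  wirtinger l (fun Z => \sum_(i <- r) u i Z) (fun Z => \sum_(i <- r) p i Z)
    (fun Z => \sum_(i <- r) q i Z).
Proof.
move=> H; elim: r => [|i r IH].
  have E (F : I -> 'rV[C]_n -> C) : (fun Z => \sum_(i <- [::]) F i Z) = fun=> 0.
    by apply/funext => Z; rewrite big_nil.
  by rewrite !E; exact: wirtinger_cst.
have E (F : I -> 'rV[C]_n -> C) : (fun Z => \sum_(i <- i :: r) F i Z) =
    fun Z => F i Z + \sum_(i <- r) F i Z.
  by apply/funext => Z; rewrite big_cons.
by rewrite !E; exact: wirtingerD.
Qed.

Lemma wirtinger_prod l (I : eqType) (r : seq I) (P : pred I) (u p : I -> 'rV[C]_n -> C) :
  uniq r -> (forall i, wirtinger l (u i) (p i) (fun=> 0)) ->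
  wirtinger l (fun Z => \prod_(i <- r | P i) u i Z)
    (fun Z => \sum_(i <- r | P i) p i Z * \prod_(j <- r | P j && (j != i)) u j Z)
    (fun=> 0).
Proof.
move=> + H; elim: r => [_|i r IH /= /andP[ir /IH {}IH]].
  have -> : (fun Z => \prod_(i <- [::] | P i) u i Z) = fun=> 1.
    by apply/funext => Z; rewrite big_nil.
  by apply: eq_wirtinger (wirtinger_cst _ _) _ _ => // Z _; rewrite big_nil.
have drop k Z : k \in r -> \prod_(j <- i :: r | P j && (j != k)) u j Z =
    (if P i then u i Z else 1) * \prod_(j <- r | P j && (j != k)) u j Z.
  move=> kr; have ik : i != k by apply: contraNneq ir => ->.
  by rewrite big_cons ik andbT; case: ifP => // _; rewrite mul1r.
have dropi Z : \prod_(j <- i :: r | P j && (j != i)) u j Z = \prod_(j <- r | P j) u j Z.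
  rewrite big_cons eqxx andbF big_seq_cond [RHS]big_seq_cond.
  apply: eq_bigl => j; case: (boolP (j \in r)) => //= jr.
  by have -> : j != i by [apply: contraNneq ir => <-]; rewrite andbT.
have [Pi|nPi] := boolP (P i); last first.
  rewrite (_ : (fun Z => \prod_(i <- i :: r | P i) u i Z) = fun Z => \prod_(i <- r | P i) u i Z).
    apply: eq_wirtinger IH _ _ => // Z _; rewrite [RHS]big_cons (negbTE nPi).
    rewrite [LHS]big_seq_cond [RHS]big_seq_cond; apply: eq_bigr => k /andP[kr _].
    by rewrite drop// (negbTE nPi) mul1r.
  by apply/funext => Z; rewrite big_cons (negbTE nPi).
rewrite (_ : (fun Z => \prod_(i <- i :: r | P i) u i Z) =
    fun Z => u i Z * \prod_(i <- r | P i) u i Z).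
  apply: eq_wirtinger (wirtingerM (H i) IH) _ _ => Z _; last by rewrite mul0r mulr0 addr0.
  rewrite [RHS]big_cons Pi dropi; congr (_ + _).
  rewrite mulr_sumr [LHS]big_seq_cond [RHS]big_seq_cond; apply: eq_bigr => k /andP[kr _].
  by rewrite drop// Pi mulrCA.
by apply/funext => Z; rewrite big_cons Pi.
Qed.

Lemma wirtinger_hol (rho r S : R) l u : 0 < rho -> hol (r + 5 * rho) S u ->
    (forall Z, cube Z -> polydisc r Z) ->
    wirtinger l u (dpart l u) (fun=> 0).
Proof.
move=> rho0 Hu sub.
have sub5 Z : cube Z -> polydisc (r + 5 * rho) Z.
  by move=> /sub; apply: polydiscW; lra.
have S0 : 0 <= S.
  have [] := Hu 0; last by move=> + _; apply: le_trans; exact: modc_ge0.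
  by apply: sub5 => k; rewrite !mxE /= normr0; split; exact: ltW.
split.
- by apply/bounded_on_cubecP; exists S => // Z /sub5 /Hu[].
- apply/bounded_on_cubecP; exists (8 * S / rho).
    by rewrite divr_ge0 ?mulr_ge0// ltW.
  move=> Z /sub; apply: (modc_dpart rho0); apply: holW Hu => //.
  by lra.
- exact: bounded_on_cubec_cst.
move=> e e0; set K := 8 * (8 * S / rho) / rho.
have K0 : 0 <= K by rewrite /K !(divr_ge0, mulr_ge0)// ltW.
exists (Num.min rho (e / (K + 1))); first by rewrite lt_min rho0 divr_gt0// ltr_wpDl.
move=> t; rewrite lt_min ltr_pdivlMr ?ltr_wpDl// => /andP[tr te] Z hZ.
rewrite mul0r addr0; apply: le_trans (hol_quadratic rho0 l Hu tr (sub Z hZ)) _.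
by rewrite -/K; have := modc_ge0 t; nra.
Qed.

(** The two real partial derivatives [p + q] and [i (p - q)] have mean [0]. *)
Lemma wirtinger_mean0 l u p q : wirtinger l u p q ->
    (forall Z, cube Z -> (`|complex.Re (Z 0 l)| = a \/ `|complex.Im (Z 0 l)| = a) -> u Z = 0) ->
  cube_meanc p = 0.
Proof.
move=> [bu bp bq H] u0.
have bpq : bounded_on_cubec (fun Z => p Z + q Z) by exact: bounded_on_cubecD.
have bpq' : bounded_on_cubec (fun Z => 'i%C * (p Z + -1 * q Z)).
  apply: bounded_on_cubecM (bounded_on_cubec_cst _) (bounded_on_cubecD bp _).
  exact: bounded_on_cubecM (bounded_on_cubec_cst _) bq.
have zero (d : bool) (m : 'rV[C]_n -> C) : bounded_on_cubec m ->
    (forall h Z, m Z * h%:C%C = p Z * axis_step (l, d) h + q Z * conjc (axis_step (l, d) h)) ->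
    cube_meanc m = 0.
  move=> bm mE.
  have E e : 0 < e -> exists2 del, 0 < del & forall h Z, 0 < h -> h < del -> cube Z ->
      modc (u (move_coord l (axis_step (l, d) h) Z) - u Z - m Z * h%:C%C) <= e * h.
    move=> /H[del del0 Hd]; exists del => // h Z h0 hd hZ.
    have ms : modc (axis_step (l, d) h) = h.
      rewrite /axis_step; case: (d); rewrite /= modcE expr0n ?add0r ?addr0 sqrtr_sqr;
      exact: gtr0_norm.
    by rewrite mE; have := Hd (axis_step (l, d) h); rewrite ms; apply.
  have face Z : cube Z -> `|axis_coord (l, d) Z| = a -> u Z = 0.
    by move=> hZ; rewrite /axis_coord; case: (d) => /= E'; apply: u0 => //; [right|left].
  apply: complex_eqP => /=.
    apply: (cube_mean_derivative (d := (l, d)) (f := fun Z => complex.Re (u Z)) a0).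
    - exact: bounded_Re.
    - by move=> Z hZ /face ->.
    - move=> e /E[del del0 Hd]; exists del => // h Z h0 hd hZ.
      apply: le_trans (Hd h Z h0 hd hZ); apply: le_trans (Re_le_modc _).
      by rewrite !Re_add !Re_opp Re_mul /= mulr0 subr0 (mulrC h).
  apply: (cube_mean_derivative (d := (l, d)) (f := fun Z => complex.Im (u Z)) a0).
  - exact: bounded_Im.
  - by move=> Z hZ /face ->.
  - move=> e /E[del del0 Hd]; exists del => // h Z h0 hd hZ.
    apply: le_trans (Hd h Z h0 hd hZ); apply: le_trans (Im_le_modc _).
    by rewrite !Im_add !Im_opp Im_mul /= mulr0 add0r (mulrC h).
have Z1 : cube_meanc (fun Z => p Z + q Z) = 0.
  apply: (zero false) => // h Z; rewrite -[axis_step _ h]/(h%:C)%C conjc_real.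
  by ring.
have Z2 : cube_meanc (fun Z => 'i%C * (p Z + -1 * q Z)) = 0.
  apply: (zero true) => // h Z.
  have -> : axis_step (l, true) h = 'i%C * h%:C%C by apply: complex_eqP => /=; ring.
  have -> : conjc ('i%C * h%:C%C) = - ('i%C * h%:C%C) :> C.
    by apply: complex_eqP => /=; ring.
  by ring.
have b1 : bounded_on_cubec (fun Z => -1 * q Z).
  exact: bounded_on_cubecM (bounded_on_cubec_cst _) bq.
have b2 : bounded_on_cubec (fun Z => p Z + -1 * q Z) by exact: bounded_on_cubecD.
move: Z1 Z2; rewrite (cube_meancD bp bq) (cube_meancZ _ b2) (cube_meancD bp b1) (cube_meancZ _ bq) => Z1 Z2.
have {}Z2 : cube_meanc p + -1 * cube_meanc q = 0.
  have i0 : 'i%C != 0 :> C by rewrite eq_complex /= oner_eq0 andbF.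
  by apply: (mulfI i0); rewrite Z2 mulr0.
have : 2 * cube_meanc p = (cube_meanc p + cube_meanc q) + (cube_meanc p + -1 * cube_meanc q) by ring.
by rewrite Z1 Z2 addr0 => /eqP; rewrite mulf_eq0 pnatr_eq0 /= => /eqP.
Qed.

End Wirtinger.

(** * Integration by parts against powers of the distance *)

Section ByParts.
Variables (R : realType) (n : nat) (a : R).
Hypothesis a0 : 0 < a.
Local Notation C := R[i].
Local Notation cube := (@cube R n a).
Local Notation cube_meanc := (@cube_meanc R n a).
Local Notation bdd := (@bounded_on_cubec R n a).
Local Notation wirtinger := (@wirtinger R n a).

Definition vanishes_on_faces (u : 'rV[C]_n -> C) := forall Z l, cube Z ->
  (`|complex.Re (Z 0 l)| = a \/ `|complex.Im (Z 0 l)| = a) -> u Z = 0.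

(** The square of the positive part is continuously differentiable: the weights
    need no smoother cut-off. *)
Lemma max_sqr_expand (x y : R) :
  `|Num.max 0 y ^+ 2 - Num.max 0 x ^+ 2 - 2 * Num.max 0 x * (y - x)| <= (y - x) ^+ 2.
Proof.
have p2 := sqr_ge0 (y - x); have y2 := sqr_ge0 y.
have [x0|x0] := leP x 0; have [y0|y0] := leP y 0; rewrite ler_norml.
- by apply/andP; split; lra.
- have xy : x * y <= 0 by rewrite mulr_le0_ge0// ltW.
  by have x2 := sqr_ge0 x; apply/andP; split; lra.
- have xy : x * y <= 0 by rewrite mulr_ge0_le0// ltW.
  by have x2 := sqr_ge0 x; apply/andP; split; lra.
- by apply/andP; split; lra.
Qed.

Lemma wirtinger_max_sqr l (f : 'rV[C]_n -> R) p q :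
  wirtinger l (fun Z => (f Z)%:C%C) p q ->
  wirtinger l (fun Z => (Num.max 0 (f Z) ^+ 2)%:C%C)
    (fun Z => (2 * Num.max 0 (f Z))%:C%C * p Z) (fun Z => (2 * Num.max 0 (f Z))%:C%C * q Z).
Proof.
move=> W; have [K K0 [d1 d10 L]] := wirtinger_lipschitz W.
move: W => [bu bp bq H].
have [b b0 fb] : exists2 b, 0 <= b & forall Z, cube Z -> `|f Z| <= b.
  by case/bounded_on_cubecP: bu => b b0 ub; exists b => // Z /ub; rewrite modc_real.
have m0 Z : 0 <= Num.max 0 (f Z) by rewrite le_max lexx.
have mb Z : cube Z -> Num.max 0 (f Z) <= b.
  by move=> /fb hb; rewrite ge_max b0 (le_trans (ler_norm _) hb).
have bm : bdd (fun Z => (2 * Num.max 0 (f Z))%:C%C).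
  apply/bounded_on_cubecP; exists (2 * b); first by rewrite mulr_ge0.
  by move=> Z /mb hb; rewrite modc_real ger0_norm ?mulr_ge0// ler_pM2l.
split; do ?exact: bounded_on_cubecM.
  apply/bounded_on_cubecP; exists (b ^+ 2); first exact: exprn_ge0.
  by move=> Z /mb hb; rewrite modc_real ger0_norm ?exprn_ge0// lerXn2r ?nnegrE.
move=> e e0; have k0 : 0 < 4 * (b + 1) by rewrite mulr_gt0// ltr_wpDl.
have [d2 d20 H2] := H (e / (4 * (b + 1))) (divr_gt0 e0 k0).
have d30 : 0 < e / (2 * K ^+ 2) by rewrite divr_gt0// mulr_gt0// exprn_gt0.
exists (Num.min d1 (Num.min d2 (e / (2 * K ^+ 2)))); first by rewrite !lt_min d10 d20.
move=> t; rewrite !lt_min => /andP[t1 /andP[t2 t3]] Z hZ.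
set y := f (move_coord l t Z); set x := f Z.
have E1 := H2 t t2 Z hZ; have E2 := L t t1 Z hZ; rewrite -/x -/y in E1 E2.
rewrite -rmorphB modc_real in E2.
rewrite (_ : _ - _ - _ = (Num.max 0 y ^+ 2 - Num.max 0 x ^+ 2 - 2 * Num.max 0 x * (y - x))%:C%C
   + (2 * Num.max 0 x)%:C%C * (y%:C%C - x%:C%C - (p Z * t + q Z * conjc t))); last first.
  by rewrite !(rmorphB, rmorphM) /=; ring.
apply: le_trans (modcD _ _) _; rewrite modcM !modc_real.
have A1 := max_sqr_expand x y; have M0 := modc_ge0 t.
have A2 : (y - x) ^+ 2 <= e / 2 * modc t.
  rewrite -real_normK ?num_real//.
  apply: (@le_trans _ _ ((K * modc t) ^+ 2)); first by rewrite lerXn2r ?nnegrE ?mulr_ge0// ltW.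
  move: (ltW t3); rewrite ler_pdivlMr ?mulr_gt0 ?exprn_gt0// => t3'.
  by rewrite exprMn expr2 [modc t ^+ 2]expr2; nra.
have A3 : `|2 * Num.max 0 x| * modc (y%:C%C - x%:C%C - (p Z * t + q Z * conjc t)) <=
    2 * b * (e / (4 * (b + 1)) * modc t).
  apply: ler_pM; [exact: normr_ge0|exact: modc_ge0| |exact: E1].
  have := m0 Z; rewrite -/x => mx; rewrite ger0_norm ?mulr_ge0//.
  by rewrite ler_pM2l//; exact: mb.
have A4 : 2 * b * (e / (4 * (b + 1)) * modc t) <= e / 2 * modc t.
  rewrite (_ : 2 * b * _ = e / 2 * modc t * (b / (b + 1))).
    rewrite ler_piMr ?mulr_ge0 ?divr_ge0 ?(ltW e0)//.
    by rewrite ler_pdivrMr ?ltr_wpDl//; lra.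
  by field; rewrite gt_eqF// ltr_wpDl.
by lra.
Qed.

(** A holomorphic map of [C^n] is carried together with its first and second
    partial derivatives, of which only the Wirtinger expansions and the symmetry
    of the second ones matter. *)
Variables (G : 'I_n -> 'rV[C]_n -> C) (DG : 'I_n -> 'I_n -> 'rV[C]_n -> C).
Variable D2 : 'I_n -> 'I_n -> 'I_n -> 'rV[C]_n -> C.
Hypothesis HG : forall i l, wirtinger l (G i) (DG i l) (fun=> 0).
Hypothesis HDG : forall i l m, wirtinger m (DG i l) (D2 i l m) (fun=> 0).
Hypothesis D2C : forall i l m Z, cube Z -> D2 i l m Z = D2 i m l Z.

Definition jacobian_mx Z : 'M[C]_n := \matrix_(i, l) DG i l Z.
Definition jacobian_det Z := \det (jacobian_mx Z).

Let bDG i l : bdd (DG i l). Proof. by case: (HG i l). Qed.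

Lemma bounded_prod (I : Type) (r : seq I) (P : pred I) (u : I -> 'rV[C]_n -> C) :
  (forall i, bdd (u i)) -> bdd (fun Z => \prod_(i <- r | P i) u i Z).
Proof.
move=> bu; elim: r => [|i r IH].
  have -> : (fun Z => \prod_(i <- [::] | P i) u i Z) = fun=> 1.
    by apply/funext => Z; rewrite big_nil.
  exact: bounded_on_cubec_cst.
have -> : (fun Z => \prod_(i <- i :: r | P i) u i Z) =
   fun Z => (if P i then u i Z else 1) * \prod_(i <- r | P i) u i Z.
  by apply/funext => Z; rewrite big_cons; case: ifP => // _; rewrite mul1r.
apply: bounded_on_cubecM IH; case: (P i) => //; exact: bounded_on_cubec_cst.
Qed.

(** The Piola identity: the rows of the cofactor matrix of a Jacobian are
    divergence free.  The terms of the divergence cancel in pairs, because exchanging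
    the values of a permutation at [i] and [j] changes its sign and only
    exchanges the two differentiations of the [i]-th component. *)
Lemma piola j Z : cube Z ->
  \sum_(s : {perm 'I_n}) (-1) ^+ s *
    (\sum_(i | i != j) D2 i (s i) (s j) Z *
       \prod_(k | (k != j) && (k != i)) DG k (s k) Z) = 0.
Proof.
move=> hZ; under eq_bigr do rewrite mulr_sumr.
rewrite exchange_big /= big1// => i ij.
set S := \sum_s _; have : S = - S.
  rewrite {1}/S (reindex_inj (mulgI (tperm i j))) /= -sumrN; apply: eq_bigr => s _.
  rewrite odd_permM odd_tperm ij addTb signrN mulNr; congr (- _); congr (_ * _).
  rewrite !permM tpermL tpermR D2C//; congr (_ * _).
  by apply: eq_bigr => k /andP[kj ki]; rewrite permM tpermD// eq_sym.
by move=> /eqP; rewrite -addr_eq0 -mulr2n mulrn_eq0 /= => /eqP.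
Qed.

(** The divergence of [phi] times a row of cofactors is
    [\sum_l phip l * cofactor], the derivatives of the cofactors cancelling by
    [piola]; the mean of a divergence is [0]. *)
Lemma cofactor_mean0 j (phi : 'rV[C]_n -> C) (phip phiq : 'I_n -> 'rV[C]_n -> C) :
    (forall l, wirtinger l phi (phip l) (phiq l)) -> vanishes_on_faces phi ->
  cube_meanc (fun Z => \sum_l phip l Z * cofactor (jacobian_mx Z) j l) = 0.
Proof.
move=> Hphi phi0.
pose T (s : {perm 'I_n}) Z := \prod_(i | i != j) DG i (s i) Z.
pose T' (s : {perm 'I_n}) Z := \sum_(i | i != j) D2 i (s i) (s j) Z *
  \prod_(k | (k != j) && (k != i)) DG k (s k) Z.
have WT (s : {perm 'I_n}) : wirtinger (s j) (T s) (T' s) (fun=> 0).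
  apply: (@wirtinger_prod _ _ _ _ _ _ _ (fun i => DG i (s i)) (fun i => D2 i (s i) (s j))).
    exact: index_enum_uniq.
  by move=> i; exact: HDG.
have WV (s : {perm 'I_n}) := wirtingerM (Hphi (s j)) (WT s).
have L0 (s : {perm 'I_n}) : cube_meanc (fun Z => phip (s j) Z * T s Z + phi Z * T' s Z) = 0.
  by apply: (wirtinger_mean0 a0 (WV s)) => Z hZ f; rewrite (phi0 Z (s j))// mul0r.
have bV (s : {perm 'I_n}) : bdd (fun Z => phip (s j) Z * T s Z + phi Z * T' s Z) by case: (WV s).
have E Z : cube Z -> \sum_l phip l Z * cofactor (jacobian_mx Z) j l =
    \sum_(s : {perm 'I_n}) (-1) ^+ s * (phip (s j) Z * T s Z + phi Z * T' s Z).
  move=> hZ; under eq_bigr do rewrite expand_cofactor mulr_sumr.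
  under [RHS]eq_bigr do rewrite mulrDr.
  rewrite big_split /=.
  have -> : \sum_(s : {perm 'I_n}) (-1) ^+ s * (phi Z * T' s Z) = 0.
    under eq_bigr do rewrite mulrCA.
    by rewrite -mulr_sumr piola// mulr0.
  rewrite addr0 (partition_big (fun s : {perm 'I_n} => s j) predT) //=.
  apply: eq_bigr => l _; apply: eq_bigr => s /eqP sl.
  rewrite mulrCA sl; congr (_ * (_ * _)).
  by apply: eq_big => k; [rewrite eq_sym|rewrite !mxE].
rewrite (eq_cube_meanc a0 E) (cube_meanc_sum a0)//; last first.
  by move=> s _; exact: (bounded_on_cubecM (bounded_on_cubec_cst n a ((-1) ^+ s)) (bV s)).
by rewrite big1// => s _; rewrite (cube_meancZ a0)// L0 mulr0.
Qed.

Variables (W : 'I_n -> C) (eps : R).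
Hypothesis eps0 : 0 < eps.

(** Normalised so that the weights are supported where [G Z] lies in the ball
    of radius [eps] around [W]. *)
Definition sqdist Z : R := (\sum_j modc (G j Z - W j) ^+ 2) / eps ^+ 2.

Definition weight k Z : R := Num.max 0 (1 - sqdist Z) ^+ k.

Let c2 : C := (eps ^- 2)%:C%C.

Definition sqdistp l Z : C := c2 * \sum_j conjc (G j Z - W j) * DG j l Z.

Lemma modc_sqrE (z : C) : (modc z ^+ 2)%:C%C = z * conjc z.
Proof. by rewrite modc_sqr; case: z => x y; apply: complex_eqP => /=; ring. Qed.

Lemma sqdistE Z : (sqdist Z)%:C%C = c2 * \sum_j (G j Z - W j) * conjc (G j Z - W j).
Proof.
rewrite /sqdist rmorphM /= mulrC; congr (_ * _); rewrite rmorph_sum /=.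
by apply: eq_bigr => j _; rewrite modc_sqrE.
Qed.

Lemma wirtinger_sqdist l : exists q,
  wirtinger l (fun Z => (1 - sqdist Z)%:C%C) (fun Z => - sqdistp l Z) q.
Proof.
pose u j (Z : 'rV[C]_n) := G j Z + - W j.
have Wu j : wirtinger l (u j) (DG j l) (fun=> 0).
  apply: eq_wirtinger (wirtingerD (HG j l) (wirtinger_cst _ l (- W j))) _ _ => Z _;
  by rewrite addr0.
have Wcu j : wirtinger l (fun Z => conjc (u j Z)) (fun=> 0) (fun Z => conjc (DG j l Z)).
  by apply: eq_wirtinger (wirtinger_conj (Wu j)) _ _ => // Z _; exact: conjc0.
have Wj j := wirtingerM (Wu j) (Wcu j).
have Ws := wirtinger_sum (index_enum 'I_n) Wj.
have Wc := wirtingerM (wirtinger_cst _ l (- c2)) Ws.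
have := wirtingerD (wirtinger_cst _ l 1) Wc.
rewrite (_ : (fun Z => 1 + _) = fun Z => (1 - sqdist Z)%:C%C); last first.
  by apply/funext => Z; rewrite rmorphB /= sqdistE mulNr.
move=> WW; eexists; apply: eq_wirtinger WW _ (fun _ _ => erefl) => Z _ /=.
rewrite mul0r !add0r /sqdistp mulNr; congr (- (_ * _)).
by apply: eq_bigr => j _; rewrite /u mulr0 addr0 mulrC.
Qed.

Lemma weight_ge0 k Z : 0 <= weight k Z.
Proof. by rewrite exprn_ge0// le_max lexx. Qed.

Lemma weightS k Z : weight k.+2 Z = (1 - sqdist Z) * weight k.+1 Z.
Proof.
rewrite /weight exprS; have [x0|x0] := leP (1 - sqdist Z) 0.
  by rewrite !expr0n /= !mulr0.
by [].
Qed.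

(** The exponent starts at [2], where the positive part becomes
    differentiable. *)
Lemma wirtinger_weight l k : exists q, wirtinger l (fun Z => (weight k.+2 Z)%:C%C)
  (fun Z => - (k.+2%:R * (weight k.+1 Z)%:C%C * sqdistp l Z)) q.
Proof.
have [q Ws] := wirtinger_sqdist l.
elim: k => [|k [q' IH]].
  eexists; apply: eq_wirtinger (wirtinger_max_sqr Ws) _ (fun _ _ => erefl) => Z _.
  by rewrite rmorphM /= rmorph_nat mulrN.
have := wirtingerM Ws IH.
rewrite (_ : (fun Z => _ * _) = fun Z => (weight k.+3 Z)%:C%C); last first.
  by apply/funext => Z; rewrite -rmorphM -weightS.
move=> WW; eexists; apply: eq_wirtinger WW _ (fun _ _ => erefl) => Z _ /=.
rewrite weightS rmorphM /= -(natr1 k.+2).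
by ring.
Qed.

Lemma jacobian_expand (Z : 'rV[C]_n) m j :
  \sum_l DG m l Z * cofactor (jacobian_mx Z) j l = jacobian_det Z *+ (m == j).
Proof.
have := congr1 (fun A : 'M[C]_n => A m j) (mul_mx_adj (jacobian_mx Z)).
rewrite !mxE => <-; apply: eq_bigr => l _.
by rewrite !mxE.
Qed.

(** In the target, the radial field with coefficient [weight k.+2] has as
    divergence [n * weight k.+2] plus a radial derivative, a multiple of
    [sqdist * weight k.+1 = weight k.+1 - weight k.+2].  It is pulled back by [G];
    an antiholomorphic factor [g] contributes nothing. *)
Lemma weight_recurrence k (g : 'rV[C]_n -> C) :
    (forall l, exists q, wirtinger l g (fun=> 0) q) ->
    vanishes_on_faces (fun Z => (weight 1 Z)%:C%C) ->
  cube_meanc (fun Z => g Z * jacobian_det Z *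
    ((n + k.+2)%:R * (weight k.+2 Z)%:C%C - k.+2%:R * (weight k.+1 Z)%:C%C)) = 0.
Proof.
move=> Hg w0.
pose phi j Z := (G j Z + - W j) * (weight k.+2 Z)%:C%C * g Z.
pose phip j l Z := (DG j l Z * (weight k.+2 Z)%:C%C +
  (G j Z + - W j) * - (k.+2%:R * (weight k.+1 Z)%:C%C * sqdistp l Z)) * g Z.
have Hphi j l : exists q, wirtinger l (phi j) (phip j l) q.
  have [q Wg] := Hg l; have [q' Ww] := wirtinger_weight l k.
  have := wirtingerM (wirtingerM (wirtingerD (HG j l) (wirtinger_cst _ l (- W j))) Ww) Wg.
  move=> WW; eexists; apply: eq_wirtinger WW _ (fun _ _ => erefl) => Z _ /=.
  by rewrite mulr0 !addr0.
have face j : vanishes_on_faces (phi j).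
  move=> Z l hZ /(w0 Z l hZ) /(congr1 (@complex.Re R)) /= w1.
  rewrite /phi (_ : weight k.+2 Z = 0); first by rewrite mulr0 mul0r.
  by rewrite /weight -addn1 exprD -/(weight 1 Z) w1 mulr0.
have L0 j : cube_meanc (fun Z => \sum_l phip j l Z * cofactor (jacobian_mx Z) j l) = 0.
  have [q qP] := choice (Hphi j).
  exact: cofactor_mean0 qP (face j).
have bnd j : bdd (fun Z => \sum_l phip j l Z * cofactor (jacobian_mx Z) j l).
  apply: bounded_on_cubec_sum => l _; have [q [_ bp _ _]] := Hphi j l.
  apply: bounded_on_cubecM bp _.
  have -> : (fun Z => cofactor (jacobian_mx Z) j l) = (fun Z =>
      \sum_(s : {perm 'I_n} | s j == l) (-1) ^+ s * \prod_(i | j != i) DG i (s i) Z).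
    apply/funext => Z; rewrite expand_cofactor; apply: eq_bigr => s _; congr (_ * _).
    by apply: eq_bigr => i _; rewrite mxE.
  apply: bounded_on_cubec_sum => s _.
  apply: bounded_on_cubecM (bounded_on_cubec_cst _ _ _) (bounded_prod _ _ _).
  by move=> i; exact: bDG.
have S0 : \sum_j cube_meanc (fun Z => \sum_l phip j l Z * cofactor (jacobian_mx Z) j l) = 0.
  by rewrite big1.
rewrite -[RHS]S0 -(cube_meanc_sum a0)//; apply: (eq_cube_meanc a0) => Z hZ.
have cofs j : \sum_l phip j l Z * cofactor (jacobian_mx Z) j l =
    jacobian_det Z * g Z * ((weight k.+2 Z)%:C%C -
    k.+2%:R * (weight k.+1 Z)%:C%C * c2 * ((G j Z - W j) * conjc (G j Z - W j))).
  have -> : \sum_l phip j l Z * cofactor (jacobian_mx Z) j l =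
     (weight k.+2 Z)%:C%C * g Z * (\sum_l DG j l Z * cofactor (jacobian_mx Z) j l) -
     (G j Z - W j) * k.+2%:R * (weight k.+1 Z)%:C%C * g Z *
        \sum_l sqdistp l Z * cofactor (jacobian_mx Z) j l.
    rewrite !mulr_sumr -sumrB; apply: eq_bigr => l _; rewrite /phip.
    by ring.
  rewrite jacobian_expand eqxx mulr1n.
  have -> : \sum_l sqdistp l Z * cofactor (jacobian_mx Z) j l =
     c2 * (conjc (G j Z - W j) * jacobian_det Z).
    rewrite /sqdistp; under eq_bigr do rewrite -mulrA mulr_suml.
    rewrite -mulr_sumr exchange_big /=; congr (_ * _).
    under eq_bigr => m _.
      under eq_bigr do rewrite -mulrA.
      rewrite -mulr_sumr jacobian_expand.
      over.
    rewrite (bigD1 j)//= eqxx mulr1n big1 ?addr0// => m /negbTE ->.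
    by rewrite mulr0n mulr0.
  by ring.
under [RHS]eq_bigr do rewrite cofs.
rewrite -mulr_sumr sumrB sumr_const card_ord -mulr_sumr -[_ * c2 * _]mulrA -sqdistE.
have -> : (weight k.+2 Z)%:C%C = (1 - (sqdist Z)%:C%C) * (weight k.+1 Z)%:C%C :> C.
  by rewrite weightS rmorphM rmorphB.
rewrite natrD -mulr_natl.
set w := (weight k.+1 Z)%:C%C.
by ring.
Qed.

Lemma weight_le1 k Z : weight k Z <= 1.
Proof.
apply: exprn_ile1; rewrite ?le_max ?lexx// ge_max ler01 /= gerBl.
by rewrite divr_ge0 ?exprn_ge0 ?(ltW eps0)// sumr_ge0// => j _; exact: sqr_ge0.
Qed.

Lemma bounded_jacobian : bdd jacobian_det.
Proof.
have -> : jacobian_det = fun Z =>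
    \sum_(s : {perm 'I_n}) (-1) ^+ s * \prod_i DG i (s i) Z.
  apply/funext => Z; apply: eq_bigr => s _; congr (_ * _).
  by apply: eq_bigr => i _; rewrite mxE.
apply: bounded_on_cubec_sum => s _.
apply: bounded_on_cubecM (bounded_on_cubec_cst _ _ _) (bounded_prod _ _ _).
by move=> i; exact: bDG.
Qed.

Lemma wirtinger_jacobian l : exists p, wirtinger l jacobian_det p (fun=> 0).
Proof.
pose T (s : {perm 'I_n}) Z := \prod_i DG i (s i) Z.
pose T' (s : {perm 'I_n}) Z := \sum_i D2 i (s i) l Z * \prod_(k | true && (k != i)) DG k (s k) Z.
have WT (s : {perm 'I_n}) : wirtinger l (T s) (T' s) (fun=> 0).
  apply: (@wirtinger_prod _ _ _ _ _ _ _ (fun i => DG i (s i)) (fun i => D2 i (s i) l)).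
    exact: index_enum_uniq.
  by move=> i; exact: HDG.
have Ws (s : {perm 'I_n}) := wirtingerM (wirtinger_cst a l ((-1) ^+ s)) (WT s).
have := wirtinger_sum (index_enum {perm 'I_n}) Ws.
have -> : (fun Z => \sum_(s : {perm 'I_n}) (-1) ^+ s * T s Z) = jacobian_det.
  apply/funext => Z; apply: eq_bigr => s _; congr (_ * _).
  by apply: eq_bigr => i _; rewrite mxE.
move=> WW; eexists; apply: eq_wirtinger WW (fun _ _ => erefl) _ => Z _ /=.
by rewrite big1// => s _; rewrite mul0r mulr0 addr0.
Qed.

Definition weighted_mean k : R := cube_mean a (fun Z => modc (jacobian_det Z) ^+ 2 * weight k Z).

(** The factor [f] enters conjugated: together with the conjugate of
    [jacobian_det] it is antiholomorphic, as [weight_recurrence] needs. *)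
Definition weighted_integral (f : 'rV[C]_n -> C) k : C :=
  cube_meanc (fun Z => conjc (f Z) * (modc (jacobian_det Z) ^+ 2 * weight k Z)%:C%C).

Fixpoint weight_ratio k : R :=
  if k is k'.+1 then k'.+2%:R / (n + k'.+2)%:R * weight_ratio k' else 1.

Lemma weight_ratio_gt0 k : 0 < weight_ratio k.
Proof. by elim: k => //= k IH; rewrite mulr_gt0// divr_gt0// ltr0n addnS. Qed.

Lemma bounded_weighted k : bounded_on_cube a (fun Z => modc (jacobian_det Z) ^+ 2 * weight k Z).
Proof.
have /bounded_on_cubecP[b b0 Jb] := bounded_jacobian.
exists (b ^+ 2) => Z hZ.
rewrite (ger0_norm (mulr_ge0 (exprn_ge0 2 (modc_ge0 _)) (weight_ge0 k Z))).
rewrite -[leRHS]mulr1; apply: ler_pM; last exact: weight_le1.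
- by rewrite exprn_ge0// modc_ge0.
- exact: weight_ge0.
- by rewrite lerXn2r ?nnegrE ?modc_ge0 ?Jb.
Qed.

Lemma bounded_weighted_integrand (f : 'rV[C]_n -> C) k : bdd f ->
  bdd (fun Z => conjc (f Z) * (modc (jacobian_det Z) ^+ 2 * weight k Z)%:C%C).
Proof.
move=> bf; apply: bounded_on_cubecM; first exact: bounded_on_cubec_conj.
exact/bounded_on_cubec_real/bounded_weighted.
Qed.

Lemma weighted_integral_ratio (f : 'rV[C]_n -> C) k : bdd f ->
    (forall l, exists p, wirtinger l f p (fun=> 0)) ->
    vanishes_on_faces (fun Z => (weight 1 Z)%:C%C) ->
  weighted_integral f k.+1 = (weight_ratio k)%:C%C * weighted_integral f 1.
Proof.
move=> bf Hf w0; elim: k => [|k IH]; first by rewrite mul1r.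
have bI i := bounded_weighted_integrand i bf.
have Hg l : exists q, wirtinger l (fun Z => conjc (f Z * jacobian_det Z)) (fun=> 0) q.
  have [p Wf] := Hf l; have [p' WJ] := wirtinger_jacobian l.
  have := wirtinger_conj (wirtingerM Wf WJ) => WW.
  eexists; apply: eq_wirtinger WW _ (fun _ _ => erefl) => Z _ /=.
  by rewrite mul0r mulr0 addr0; exact: conjc0.
have := weight_recurrence k Hg w0.
have nk : (n + k.+2)%:R != 0 :> C by rewrite pnatr_eq0 addnS.
rewrite (_ : cube_meanc _ = (n + k.+2)%:R * weighted_integral f k.+2 +
   - k.+2%:R * weighted_integral f k.+1).
  move=> /eqP; rewrite mulNr subr_eq0 => /eqP E; apply: (mulfI nk); rewrite E IH /=.
  rewrite !rmorphM /= fmorphV !rmorph_nat.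
  by move: nk; set x : C := (n + k.+2)%:R => x0; field.
rewrite -!(cube_meancZ a0)// -(cube_meancD a0); do ?[exact: bounded_on_cubecM (bounded_on_cubec_cst _ _ _) (bI _)].
apply: (eq_cube_meanc a0) => Z _.
have rE (x y : R) : (x * y)%:C%C = x%:C%C * y%:C%C :> C by rewrite rmorphM.
by rewrite !(rE _ (weight _ _)) modc_sqrE rmorphM /=; ring.
Qed.

Lemma weighted_integral1 k : weighted_integral (fun=> 1) k = (weighted_mean k)%:C%C.
Proof.
rewrite -cube_meanc_real; apply: (eq_cube_meanc a0) => Z _.
by rewrite conjc1 mul1r.
Qed.

Lemma weighted_mean_ratio k : vanishes_on_faces (fun Z => (weight 1 Z)%:C%C) ->
  weighted_mean k.+1 = weight_ratio k * weighted_mean 1.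
Proof.
move=> w0; apply: (@complexI R); rewrite rmorphM /= -!weighted_integral1.
apply: weighted_integral_ratio => //; first exact: bounded_on_cubec_cst.
by move=> l; exists (fun=> 0); exact: wirtinger_cst.
Qed.

Lemma weighted_mean_ge0 k : 0 <= weighted_mean k.
Proof.
apply: (cube_mean_ge0 a0 (bounded_weighted k)) => Z _.
exact: mulr_ge0 (exprn_ge0 2 (modc_ge0 _)) (weight_ge0 k Z).
Qed.

End ByParts.

(** * Compactness of the cube *)

Section Compactness.
Variables (R : realType) (n : nat) (a : R).
Hypothesis a0 : 0 < a.
Local Notation C := R[i].
Local Notation cube := (@cube R n a).

#[local] Existing Instance ultra_filter.

Lemma ultra_near_ulimc (u : nat -> C) e : bounded_seqc u -> 0 < e ->
  ultra (fun m => modc (u m - ulimc u) <= e).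
Proof.
move=> bu e0; have e2 : 0 < e / 2 by rewrite divr_gt0.
have /cvgrPdist_le /(_ _ e2) HR := ulim_cvg (bounded_seq_Re bu).
have /cvgrPdist_le /(_ _ e2) HI := ulim_cvg (bounded_seq_Im bu).
apply: filterS2 HR HI => m hR hI; apply: le_trans (modc_le_ReIm _) _.
by rewrite Re_add Im_add Re_opp Im_opp distrC [X in _ + X]distrC /=; lra.
Qed.

(** The limit of the coordinates along the ultrafilter is an accumulation
    point. *)
Lemma cube_compact (Zs : nat -> 'rV[C]_n) : (forall m, cube (Zs m)) ->
  exists2 Z, cube Z & forall e, 0 < e -> forall N, exists2 m, (N <= m)%N &
    forall k, modc (Zs m 0 k - Z 0 k) <= e.
Proof.
move=> hZ; pose Z : 'rV[C]_n := \row_k ulimc (fun m => Zs m 0 k).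
have bZ k : bounded_seqc (fun m => Zs m 0 k).
  exists (a + a) => m; apply: le_trans (modc_le_ReIm _) _.
  by have [h1 h2] := hZ m k; rewrite lerD.
have bc (u : nat -> R) : (forall m, `|u m| <= a) -> `|ulim u| <= a.
  move=> ua; have bu : bounded_seq u by exists a.
  have bk (c : R) : bounded_seq (fun=> c) by exists `|c|.
  rewrite ler_norml; apply/andP; split.
    rewrite -[leLHS]ulim_cst; apply: (@ulim_le _ _ _ 0%N) => // m _.
    by have := ua m; rewrite ler_norml => /andP[].
  rewrite -[leRHS]ulim_cst; apply: (@ulim_le _ _ _ 0%N) => // m _.
  by have := ua m; rewrite ler_norml => /andP[].
exists Z.
  by move=> k; rewrite mxE; split; apply: bc => m; have [] := hZ m k.
move=> e e0 N.
have near (s : seq 'I_n) : ultra (fun m => forall k, k \in s -> modc (Zs m 0 k - Z 0 k) <= e).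
  elim: s => [|k s IH]; first by apply: filterS filterT => m _ k.
  apply: filterS2 (ultra_near_ulimc (bZ k) e0) IH => m hk hs j.
  by rewrite inE => /predU1P[->|/hs//]; rewrite mxE.
have big := @ultra_eventually (fun m => (N <= m)%N) N (fun _ h => h).
have [m [mN hm]] := filter_ex (filterI big (near (enum 'I_n))).
by exists m => // k; apply: hm; rewrite mem_enum.
Qed.

Lemma hol_lipschitz_partials (r S kap : R) (u : 'rV[C]_n -> C) Z Z' : hol r S u ->
    (forall l Y, polydisc r Y -> modc (dpart l u Y) <= kap) ->
    polydisc r Z -> polydisc r Z' ->
  modc (u Z - u Z') <= kap * \sum_l modc (Z 0 l - Z' 0 l).
Proof.
move=> Hu Hk hZ hZ'.
(* the coordinates are changed one at a time *)
pose W (s : seq 'I_n) : 'rV[C]_n := \row_k (if k \in s then Z 0 k else Z' 0 k).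
have hW s : polydisc r (W s) by move=> k; rewrite mxE; case: ifP.
have key s : modc (u (W s) - u Z') <= kap * \sum_(k <- s) modc (Z 0 k - Z' 0 k).
  elim: s => [|k s IH].
    rewrite big_nil mulr0 (_ : W [::] = Z'); first by rewrite subrr modc0.
    by apply/rowP => k; rewrite mxE.
  have k0 : 0 <= kap := le_trans (modc_ge0 _) (Hk k Z hZ).
  rewrite big_cons mulrDr; have [ks|ks] := boolP (k \in s).
    rewrite (_ : W (k :: s) = W s); first by apply: le_trans IH _; rewrite lerDr mulr_ge0 ?modc_ge0.
    by apply/rowP => j; rewrite !mxE inE; case: eqP => // ->; rewrite ks.
  pose t := Z 0 k - Z' 0 k.
  have E : W (k :: s) = move_coord k t (W s).
    apply/rowP => j; rewrite move_coordE !mxE inE; case: eqP => /= [->|_]; last by rewrite addr0.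
    by rewrite (negbTE ks) addrC subrK.
  have L : modc (u (W (k :: s)) - u (W s)) <= kap * modc t.
    have := @complex_mean_value _ (fun w => u (move_coord k w (W s))) 0 t kap.
    rewrite add0r move_coord0 -E; apply=> x x01; rewrite add0r.
    have hx : polydisc r (move_coord k (x%:C%C * t) (W s)).
      by apply: polydisc_segment x01 (hW _) _; rewrite -E.
    by exists (dpart k u (move_coord k (x%:C%C * t) (W s)));
      [exact: (derivative_shift Hu hx)|exact: Hk].
  have := modcD (u (W (k :: s)) - u (W s)) (u (W s) - u Z').
  by rewrite addrA subrK /t in L *; lra.
have := key (index_enum 'I_n); congr (modc (u _ - _) <= _).
by apply/rowP => k; rewrite mxE mem_index_enum.
Qed.

Lemma hol_joint_lipschitz (r rho S : R) (u : 'rV[C]_n -> C) Z Z' : 0 < rho ->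
    hol (r + 2 * rho) S u -> polydisc r Z -> polydisc r Z' ->
  modc (u Z - u Z') <= 8 * S / rho * \sum_k modc (Z 0 k - Z' 0 k).
Proof.
move=> rho0 Hu; apply: (hol_lipschitz_partials (S := S)) => [|l Y hY].
  by apply: holW Hu => //; lra.
exact: (modc_dpart rho0 l Hu hY).
Qed.

Lemma cube_polydisc Z : cube Z -> polydisc (3 * a) Z.
Proof.
have a_gt0 := a0.
move=> hZ k; have [h1 h2] := hZ k; apply: le_lt_trans (modc_le_ReIm _) _.
by lra.
Qed.

Lemma hol_cube_limit S (u : 'rV[C]_n -> C) Z e : hol (5 * a) S u -> cube Z -> 0 < e ->
  exists2 d, 0 < d & forall Z', cube Z' -> (forall k, modc (Z' 0 k - Z 0 k) <= d) ->
    modc (u Z' - u Z) <= e.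
Proof.
have a_gt0 := a0.
move=> Hu hZ e0; have Hu' : hol (3 * a + 2 * a) S u by apply: holW Hu => //; lra.
have S0 : 0 <= 8 * S / a.
  have [|uS _] := Hu' Z; first by apply: polydiscW (cube_polydisc hZ); lra.
  by rewrite divr_ge0 ?mulr_ge0 ?(le_trans (modc_ge0 _) uS)// ltW.
pose K := 8 * S / a * n%:R + 1.
have K0 : 0 < K by rewrite ltr_wpDl// mulr_ge0.
exists (e / K); first exact: divr_gt0.
move=> Z' hZ' near.
apply: le_trans (hol_joint_lipschitz a0 Hu' (cube_polydisc hZ') (cube_polydisc hZ)) _.
apply: (@le_trans _ _ (8 * S / a * (n%:R * (e / K)))).
  apply: ler_wpM2l => //.
  apply: le_trans (ler_sum _ (fun k _ => near k)) _.
  by rewrite sumr_const card_ord mulr_natl.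
rewrite (_ : _ * (n%:R * (e / K)) = e * (8 * S / a * n%:R / K)); last by ring.
by apply: ler_piMr; rewrite ?(ltW e0)// ler_pdivrMr// mul1r /K lerDl.
Qed.

Variables (F : 'I_n -> 'rV[C]_n -> C) (SF : R).
Hypothesis HF : forall i, hol (16 * a) SF (F i).

(** By compactness: points where [F] tends to [W] and [u] stays away from [c]
    would accumulate at a point of the fibre. *)
Lemma fiber_modulus S (u : 'rV[C]_n -> C) (W : 'I_n -> C) c e : hol (16 * a) S u ->
    (forall Z, cube Z -> (forall j, F j Z = W j) -> u Z = c) -> 0 < e ->
  exists2 kap, 0 < kap & forall Z, cube Z -> (forall j, modc (F j Z - W j) <= kap) ->
    modc (u Z - c) <= e.
Proof.
have a_gt0 := a0.
move=> Hu fib e0; apply: contrapT => no.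
have bad m : exists Z, [/\ cube Z, forall j, modc (F j Z - W j) <= m.+1%:R^-1 & e < modc (u Z - c)].
  apply: contrapT => no_m; apply: no; exists m.+1%:R^-1; first by rewrite invr_gt0.
  move=> Z hZ hF; rewrite leNgt; apply/negP => lt; apply: no_m; exists Z; split=> //.
have [Zs ZsP] := choice bad.
have [Z hZ acc] := cube_compact (fun m => let: And3 h _ _ := ZsP m in h).
have FW j : F j Z = W j.
  apply/eqP; rewrite -subr_eq0; apply/eqP/modc_eq0/eqP.
  rewrite eq_le modc_ge0 andbT; apply/ler_addgt0Pr => d d0; rewrite add0r.
  have d2 : 0 < d / 2 by rewrite divr_gt0.
  have HF5 : hol (5 * a) SF (F j) by apply: holW (HF j) => //; lra.
  have [del del0 Hdel] := hol_cube_limit HF5 hZ d2.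
  have [m mN near] := acc del del0 (Num.bound (d / 2)^-1).
  have [hm Fm _] := ZsP m.
  have h1 := Hdel _ hm near.
  have h2 : m.+1%:R^-1 <= d / 2.
    rewrite -[leRHS]invrK lef_pV2 ?posrE ?invr_gt0//.
    have := archi_boundP (ltW (_ : 0 < (d / 2)^-1)); rewrite invr_gt0 => /(_ d2).
    move=> /ltW /le_trans; apply; rewrite ler_nat; exact: leq_trans mN (leqnSn _).
  have := modcB (F j (Zs m) - W j) (F j (Zs m) - F j Z).
  have -> : F j (Zs m) - W j - (F j (Zs m) - F j Z) = F j Z - W j by ring.
  have Fj := le_trans (Fm j) h2; by lra.
have e2 : 0 < e / 2 by rewrite divr_gt0.
have Hu5 : hol (5 * a) S u by apply: holW Hu => //; lra.
have [del del0 Hdel] := hol_cube_limit Hu5 hZ e2.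
have [m _ near] := acc del del0 0%N.
have [hm _ um] := ZsP m; have := Hdel _ hm near; rewrite (fib Z hZ FW).
by lra.
Qed.

Hypothesis F_isolated : forall Z, cube Z -> (forall j, F j Z = 0) -> Z = 0.

(** The zero of [F] is at the centre, so [fiber_modulus] applies to the
    coordinate functions. *)
Lemma face_bound : exists2 del, 0 < del & forall Z l, cube Z ->
  (`|complex.Re (Z 0 l)| = a \/ `|complex.Im (Z 0 l)| = a) ->
  exists j, del <= modc (F j Z).
Proof.
have a_gt0 := a0.
have near0 (l : 'I_n) : exists kap : R, 0 < kap /\ forall Z, cube Z ->
    (forall j, modc (F j Z) <= kap) -> modc (Z 0 l) <= a / 2.
  have [||kap k0 H] := fiber_modulus (W := fun=> 0) (c := 0) (e := a / 2)
    (@hol_coord R n (16 * a) l).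
  - by move=> Z hZ /(F_isolated hZ) ->; rewrite mxE.
  - by rewrite divr_gt0.
  exists kap; split=> // Z hZ Fk; have := H Z hZ; rewrite subr0; apply=> j.
  by rewrite subr0.
have [kap kapP] := choice near0.
pose del := \big[Num.min/1]_l kap l.
exists del.
  rewrite /del; elim/big_rec: _ => // l x _ x0; rewrite lt_min x0 andbT.
  by have [] := kapP l.
move=> Z l hZ face; apply: contrapT => no.
have [_ H] := kapP l.
have dl : del <= kap l by rewrite /del (bigD1 l)//= ge_min lexx.
have Zl : modc (Z 0 l) <= a / 2.
  apply: H => // j; rewrite leNgt; apply/negP => lt; apply: no; exists j.
  exact: ltW (le_lt_trans dl lt).
have := Re_le_modc (Z 0 l); have := Im_le_modc (Z 0 l).
by case: face => ->; lra.
Qed.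

End Compactness.

(** * Values of functions constant on a fibre of a finite map *)

Section RatioDecay.
Variables (R : realType) (n : nat).

(** The [k]-th ratio is a product of [j / (n + j)] and decays only like a power of
    [k]. *)
Lemma ratio_beats_geometric (q B e : R) : 0 <= q -> q < 1 -> 0 <= B -> 0 < e ->
  exists k, B * q ^+ k <= e * weight_ratio R n k.
Proof.
move=> q0 q1 B0 e0.
have [p [p0 p1 qp]] : exists p, [/\ 0 < p, p < 1 & 0 < p - q].
  by exists ((1 + q) / 2); split; lra.
pose K := Num.bound (q * n%:R / (p - q)).
have step j : (K <= j)%N -> q * weight_ratio R n j <= p * weight_ratio R n j.+1.
  move=> Kj; rewrite /= mulrA ler_wpM2r ?(ltW (weight_ratio_gt0 _ _ _))//.
  have nj : 0 < (n + j.+2)%:R :> R by rewrite ltr0n addnS.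
  rewrite mulrA ler_pdivlMr//.
  have := archi_boundP (divr_ge0 (mulr_ge0 q0 (ler0n R n)) (ltW qp)).
  rewrite ltr_pdivrMr// -/K => hK.
  have : K%:R * (p - q) <= j.+2%:R * (p - q).
    rewrite ler_wpM2r ?(ltW qp)// ler_nat.
    exact: leq_trans Kj (leq_trans (leqnSn _) (leqnSn _)).
  by rewrite natrD; lra.
have rK := weight_ratio_gt0 R n K.
have bnd i : q ^+ i * weight_ratio R n K <= p ^+ i * weight_ratio R n (K + i).
  elim: i => [|i IH]; first by rewrite addn0.
  rewrite addnS !exprS -!mulrA.
  apply: le_trans (ler_wpM2l q0 IH) _; rewrite mulrCA [leRHS]mulrCA.
  apply: ler_wpM2l; first by rewrite exprn_ge0// ltW.
  by apply: step; rewrite leq_addr.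
have [i Hi] := geometric_small (B * q ^+ K / weight_ratio R n K) (ltW p0) p1 e0.
exists (K + i)%N; rewrite exprD mulrA.
have r1 := weight_ratio_gt0 R n (K + i).
apply: (@le_trans _ _ (B * q ^+ K / weight_ratio R n K * p ^+ i * weight_ratio R n (K + i))); last first.
  by rewrite ler_pM2r.
have c0 : 0 <= B * q ^+ K / weight_ratio R n K.
  by rewrite divr_ge0 ?(ltW rK)// mulr_ge0// exprn_ge0.
have := ler_wpM2l c0 (bnd i); rewrite [leRHS]mulrA; congr (_ <= _).
by field; rewrite gt_eqF.
Qed.

End RatioDecay.

Section SmallPerturbation.
Variables (R : realType) (n : nat).
Local Notation C := R[i].

(** The characteristic polynomial of [- A] has at most [n] roots; [n + 1] values
    are tried. *)
Lemma det_perturb (A : 'M[C]_n) (b : R) : 0 < b ->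
  exists2 s : C, modc s < b & \det (A + s%:M) != 0.
Proof.
move=> b0; apply: contrapT => no.
pose rs := [seq small_step b (nat_of_ord i) | i <- enum 'I_n.+1].
have urs : uniq rs.
  rewrite map_inj_uniq ?enum_uniq// => i j /(congr1 (@complex.Re R)) /=.
  move=> /(mulfI (lt0r_neq0 b0)) /invr_inj /eqP; rewrite eqr_nat => /eqP [ij].
  exact: val_inj.
have p0 : char_poly (- A) != 0 by rewrite monic_neq0// char_poly_monic.
have roots : all (root (char_poly (- A))) rs.
  apply/allP => _ /mapP[i _ ->]; rewrite /root; apply/eqP.
  have -> : (char_poly (- A)).[small_step b i] = \det (A + (small_step b i)%:M).
    rewrite /char_poly -horner_evalE -det_map_mx; congr (\det _).
    apply/matrixP => j k; rewrite !mxE /= /horner_eval.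
    by rewrite hornerD hornerN hornerMn hornerX hornerC opprK addrC.
  apply/eqP; apply: contrapT => /negP dn; apply: no; exists (small_step b i) => //.
  exact: small_step_lt.
have := max_poly_roots p0 roots urs.
by rewrite size_char_poly size_map size_enum_ord ltnn.
Qed.

End SmallPerturbation.

Section KeyEstimate.
Variables (R : realType) (n : nat) (a : R).
Hypothesis a0 : 0 < a.
Local Notation C := R[i].
Local Notation cube := (@cube R n a).

Variables (F : 'I_n -> 'rV[C]_n -> C) (SF : R).
Hypothesis HF : forall i, hol (16 * a) SF (F i).
Hypothesis F0 : forall i, F i 0 = 0.
Hypothesis F_isolated : forall Z, cube Z -> (forall j, F j Z = 0) -> Z = 0.

(** The Jacobian of [F] may be singular at the origin, where the positivity of the
    weighted means is tested; that of the perturbed map is not. *)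
Definition perturb (s : C) j (Z : 'rV[C]_n) : C := F j Z + s * Z 0 j.

Let SG := `|SF| + 16 * a.

Lemma perturb_derivative s j Z l : polydisc (16 * a) Z ->
  complex_derivative_at (fun t => perturb s j (move_coord l t Z)) 0
    (dpart l (F j) Z + s *+ (j == l)).
Proof.
move=> hZ e e0; have [d d0 H] := dpartP l (HF j) hZ e0.
exists d => // h hd; apply: le_trans (H h hd); rewrite le_eqVlt; apply/orP; left.
apply/eqP; congr modc; rewrite /perturb !move_coordE add0r.
by case: eqP => _; rewrite ?mulr1n ?mulr0n; ring.
Qed.

Lemma hol_perturb s j : modc s <= 1 -> hol (16 * a) SG (perturb s j).
Proof.
move=> s1 Z hZ; split=> [|l]; last by eexists; exact: perturb_derivative.
apply: le_trans (modcD _ _) _; apply: lerD.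
  by have [h _] := HF j hZ; exact: le_trans h (ler_norm _).
rewrite modcM -[leRHS]mul1r ler_pM ?modc_ge0// ltW//.
Qed.

Definition dperturb s i l := dpart l (perturb s i).

Let sub Z : cube Z -> polydisc (3 * a) Z := @cube_polydisc R n a a0 Z.

Lemma wirtinger_perturb s : modc s <= 1 ->
  forall i l, wirtinger a l (perturb s i) (dperturb s i l) (fun=> 0).
Proof.
have a_gt0 := a0.
move=> s1 i l; have Hp : hol (3 * a + 5 * a) SG (perturb s i).
  by apply: holW (hol_perturb i s1) => //; lra.
exact: (wirtinger_hol a0 l a0 Hp sub).
Qed.

Lemma hol_dperturb s : modc s <= 1 -> forall i l,
  hol (3 * a + 5 * a) (8 * SG / a) (dperturb s i l).
Proof.
have a_gt0 := a0.
move=> s1 i l; apply: hol_dpart => //.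
by apply: holW (hol_perturb i s1) => //; lra.
Qed.

Lemma wirtinger_dperturb s : modc s <= 1 -> forall i l m,
  wirtinger a m (dperturb s i l) (dpart m (dperturb s i l)) (fun=> 0).
Proof. by move=> s1 i l m; exact: (wirtinger_hol a0 m a0 (hol_dperturb s1 i l) sub). Qed.

Lemma dperturbC s : modc s <= 1 -> forall i l m Z, cube Z ->
  dpart m (dperturb s i l) Z = dpart l (dperturb s i m) Z.
Proof.
have a_gt0 := a0.
move=> s1 i l m Z /sub hZ; apply: (dpartC (r := 3 * a) (S := SG) a0) hZ.
by apply: holW (hol_perturb i s1) => //; lra.
Qed.

(** Any lower bound for [F] on the faces serves; half of it is the radius of the
    weights, which therefore vanish on the faces for small [s] and [W]. *)
Variable del : R.
Hypothesis del0 : 0 < del.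
Hypothesis del_face : forall Z l, cube Z ->
  (`|complex.Re (Z 0 l)| = a \/ `|complex.Im (Z 0 l)| = a) ->
  exists j, del <= modc (F j Z).

Let eps := del / 2.
Let eps0 : 0 < eps. Proof. by rewrite divr_gt0. Qed.

Definition admissible (s : C) := modc s <= 1 /\ modc s * (2 * a) <= del / 4.
Definition admissible_target (W : 'I_n -> C) := forall j, modc (W j) <= del / 4.

Notation wt s W := (weight (perturb s) W eps).
Notation wmean s W := (weighted_mean a (perturb s) (dperturb s) W eps).
Notation wintegral s W := (weighted_integral a (perturb s) (dperturb s) W eps).

Lemma cube_modc Z j : cube Z -> modc (Z 0 j) <= 2 * a.
Proof.
move=> hZ; have [h1 h2] := hZ j; apply: le_trans (modc_le_ReIm _) _.
by lra.
Qed.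

Lemma perturb_close s Z j : cube Z -> modc (perturb s j Z - F j Z) <= modc s * (2 * a).
Proof.
move=> hZ; rewrite /perturb addrAC subrr add0r modcM.
by apply: ler_wpM2l; rewrite ?modc_ge0// cube_modc.
Qed.

Lemma weight_faces s W : admissible s -> admissible_target W ->
  vanishes_on_faces a (fun Z => (wt s W 1 Z)%:C%C).
Proof.
have d_gt0 := del0; have e_gt0 := eps0.
move=> [_ s2] hW Z l hZ /(del_face hZ)[j Fj].
have far : eps <= modc (perturb s j Z - W j).
  have h1 := perturb_close s j hZ; have h2 := hW j.
  have := modcB (perturb s j Z - W j) (perturb s j Z - F j Z - W j).
  have := modcB (perturb s j Z - F j Z) (W j).
  rewrite (_ : perturb s j Z - W j - _ = F j Z); last by ring.
  by rewrite /eps; lra.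
rewrite /weight expr1 max_l// subr_le0 /sqdist ler_pdivlMr ?exprn_gt0// mul1r.
rewrite (bigD1 j)//= ler_wpDr//; first by apply: sumr_ge0 => k _; exact: sqr_ge0.
by rewrite lerXn2r ?nnegrE ?modc_ge0 ?(ltW eps0).
Qed.

Lemma hol_wirtinger S (u : 'rV[C]_n -> C) : hol (16 * a) S u -> bounded_on_cubec a u /\
  forall l, exists p, wirtinger a l u p (fun=> 0).
Proof.
have a_gt0 := a0.
move=> Hu; have Hu' : hol (3 * a + 5 * a) S u by apply: holW Hu => //; lra.
split=> [|l]; last by exists (dpart l u); exact: (wirtinger_hol a0 l a0 Hu' sub).
exists S => Z /sub hZ; rewrite ger0_norm ?modc_ge0//.
by have [] := Hu' Z ltac:(by apply: polydiscW hZ; lra).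
Qed.

Lemma wintegral_ratio S (u : 'rV[C]_n -> C) s W k : hol (16 * a) S u -> admissible s -> admissible_target W ->
  wintegral s W u k.+1 = (weight_ratio R n k)%:C%C * wintegral s W u 1.
Proof.
move=> Hu hs hW; have [bu Wu] := hol_wirtinger Hu; have [s1 _] := hs.
apply: (weighted_integral_ratio a0 (wirtinger_perturb s1) (wirtinger_dperturb s1)
  (dperturbC s1) eps0 k bu Wu).
exact: weight_faces.
Qed.

Lemma wmean_ratio s W k : admissible s -> admissible_target W ->
  wmean s W k.+1 = weight_ratio R n k * wmean s W 1.
Proof.
move=> hs hW; have [s1 _] := hs.
apply: (weighted_mean_ratio a0 (wirtinger_perturb s1) (wirtinger_dperturb s1)
  (dperturbC s1) eps0 k).
exact: weight_faces.
Qed.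

Lemma wmean_ge0 s W k : admissible s -> 0 <= wmean s W k.
Proof. by move=> [s1 _]; exact: (weighted_mean_ge0 a0 (wirtinger_perturb s1) _ eps0). Qed.

Lemma bounded_wmean_integrand s W k : admissible s -> bounded_on_cube a
  (fun Z => modc (jacobian_det (dperturb s) Z) ^+ 2 * wt s W k Z).
Proof. by move=> [s1 _]; exact: (bounded_weighted (wirtinger_perturb s1) _ eps0). Qed.

(** High weights concentrate near the fibre of [W], where [u] is close to
    [c]; as the ratios of weighted means do not depend on [u], the second weight
    already sees the value [c]. *)
Lemma concentration S (u : 'rV[C]_n -> C) W (c : C) e : hol (16 * a) S u -> 0 < e ->
    admissible_target W -> (forall Z, cube Z -> (forall j, F j Z = W j) -> u Z = c) ->
  exists2 s0, 0 < s0 & forall s, modc s < s0 -> admissible s ->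
    modc (wintegral s W u 2 - conjc c * (wmean s W 2)%:C%C) <= e * wmean s W 2.
Proof.
have a_gt0 := a0; have e_gt0 := eps0.
move=> Hu e0 hW fib; have e2 : 0 < e / 2 by rewrite divr_gt0.
have [kap kap0 Hk] := fiber_modulus a0 HF Hu fib e2.
exists (kap / (4 * a)); first by rewrite divr_gt0// mulr_gt0.
move=> s; rewrite ltr_pdivlMr ?mulr_gt0// => ss hs.
pose q := Num.max 0 (1 - (kap / 2) ^+ 2 / eps ^+ 2).
have q0 : 0 <= q by rewrite le_max lexx.
have q1 : q < 1.
  by rewrite gt_max ltr01 gtrBl divr_gt0// exprn_gt0// divr_gt0.
pose B := `|S| + modc c; have B0 : 0 <= B by rewrite addr_ge0// modc_ge0.
have [k Hrk] := ratio_beats_geometric n q0 q1 B0 e2.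
have [bu _] := hol_wirtinger Hu; have [s1 _] := hs.
pose P Z := modc (jacobian_det (dperturb s) Z) ^+ 2.
have P0 Z : 0 <= P Z by rewrite exprn_ge0// modc_ge0.
have w0 i Z := weight_ge0 (perturb s) W eps i Z.
have bP i : bounded_on_cube a (fun Z => P Z * wt s W i Z) by exact: bounded_wmean_integrand.
have bZ (r : R) i : bounded_on_cube a (fun Z => r * (P Z * wt s W i Z)).
  by apply: bounded_on_cubeM (bP i); exists `|r|.
have bPc i := bounded_on_cubec_real (bP i).
have pt Z : cube Z -> modc ((conjc (u Z) - conjc c) * (P Z * wt s W k.+1 Z)%:C%C) <=
    e / 2 * (P Z * wt s W k.+1 Z) + B * q ^+ k * (P Z * wt s W 1 Z).
  move=> hZ; rewrite modcM modc_real (ger0_norm (mulr_ge0 (P0 Z) (w0 k.+1 Z))).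
  rewrite -rmorphB modc_conj.
  have [near|far] := pselect (forall j, modc (perturb s j Z - W j) <= kap / 2).
    have uc : modc (u Z - c) <= e / 2.
      apply: Hk => // j; have := modcB (perturb s j Z - W j) (perturb s j Z - F j Z).
      rewrite (_ : _ - _ - _ = F j Z - W j); last by ring.
      by have := near j; have := perturb_close s j hZ; lra.
    have t1 : modc (u Z - c) * (P Z * wt s W k.+1 Z) <= e / 2 * (P Z * wt s W k.+1 Z).
      by apply: ler_wpM2r => //; exact: mulr_ge0.
    have t2 : 0 <= B * q ^+ k * (P Z * wt s W 1 Z).
      exact: mulr_ge0 (mulr_ge0 B0 (exprn_ge0 k q0)) (mulr_ge0 (P0 Z) (w0 1%N Z)).
    by lra.
  have [j fj] : exists j, kap / 2 < modc (perturb s j Z - W j).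
    apply: contrapT => no; apply: far => j; rewrite leNgt; apply/negP => lt.
    by apply: no; exists j.
  have mq : Num.max 0 (1 - sqdist (perturb s) W eps Z) <= q.
    rewrite /q ge_max le_max lexx /= le_max lerB ?orbT// /sqdist.
    rewrite ler_pM2r ?invr_gt0 ?exprn_gt0// (bigD1 j)//= ler_wpDr//.
      by apply: sumr_ge0 => i _; exact: sqr_ge0.
    by rewrite lerXn2r ?nnegrE ?modc_ge0 ?(ltW fj)// divr_ge0// ltW.
  have wk : wt s W k.+1 Z <= q ^+ k * wt s W 1 Z.
    rewrite /weight exprSr expr1; apply: ler_wpM2r; first by rewrite le_max lexx.
    by apply: lerXn2r; rewrite ?nnegrE// le_max lexx.
  have uB : modc (u Z - c) <= B.
    apply: le_trans (modcB _ _) _; rewrite lerD2r.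
    have [uS _] := Hu Z ltac:(by apply: polydiscW (sub hZ); lra).
    exact: le_trans uS (ler_norm _).
  have t0 : 0 <= e / 2 * (P Z * wt s W k.+1 Z) by exact: mulr_ge0 (ltW e2) (mulr_ge0 (P0 Z) (w0 k.+1 Z)).
  have t1 : modc (u Z - c) * (P Z * wt s W k.+1 Z) <= B * (P Z * (q ^+ k * wt s W 1 Z)).
    apply: ler_pM uB _; [exact: modc_ge0|exact: mulr_ge0 (P0 Z) (w0 k.+1 Z)|].
    exact: ler_wpM2l.
  rewrite (_ : B * q ^+ k * _ = B * (P Z * (q ^+ k * wt s W 1 Z))); last by ring.
  by lra.
have bpt : bounded_on_cube a (fun Z => e / 2 * (P Z * wt s W k.+1 Z) + B * q ^+ k * (P Z * wt s W 1 Z)).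
  exact: bounded_on_cubeD.
have bI := bounded_weighted_integrand (wirtinger_perturb s1) W eps0 k.+1 bu.
have IE : wintegral s W u k.+1 - conjc c * (wmean s W k.+1)%:C%C =
    cube_meanc a (fun Z => (conjc (u Z) - conjc c) * (P Z * wt s W k.+1 Z)%:C%C).
  have bc : bounded_on_cubec a (fun Z => - conjc c * (P Z * wt s W k.+1 Z)%:C%C).
    exact: bounded_on_cubecM (bounded_on_cubec_cst _ _ _) (bPc _).
  rewrite /weighted_mean -cube_meanc_real -mulNr -(cube_meancZ a0 _ (bPc _)) -(cube_meancD a0 bI bc).
  by apply: (eq_cube_meanc a0) => Z _; rewrite mulrBl mulNr.
have bu' : bounded_on_cubec a (fun Z => (conjc (u Z) - conjc c) * (P Z * wt s W k.+1 Z)%:C%C).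
  apply: bounded_on_cubecM (bPc _).
  apply: bounded_on_cubecD (bounded_on_cubec_cst _ _ _); exact: bounded_on_cubec_conj.
have HH : modc (wintegral s W u k.+1 - conjc c * (wmean s W k.+1)%:C%C) <=
    e / 2 * wmean s W k.+1 + B * q ^+ k * wmean s W 1.
  by have := modc_cube_meanc a0 bu' bpt pt; rewrite -IE (cube_meanD a0 (bZ _ _) (bZ _ _)) !(cube_meanZ a0 _ (bP _)).
have m1 := wmean_ge0 W 1 hs.
have Bm : B * q ^+ k * wmean s W 1 <= e / 2 * weight_ratio R n k * wmean s W 1 by apply: ler_wpM2r.
have rk := weight_ratio_gt0 R n k.
have E (i : nat) : wintegral s W u i.+1 - conjc c * (wmean s W i.+1)%:C%C =
    (weight_ratio R n i)%:C%C * (wintegral s W u 1 - conjc c * (wmean s W 1)%:C%C).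
  rewrite (wintegral_ratio i Hu hs hW) (wmean_ratio i hs hW) rmorphM /=.
  by ring.
move: HH; rewrite E (wmean_ratio k hs hW) modcM modc_real (gtr0_norm rk) => HH.
have H1 : modc (wintegral s W u 1 - conjc c * (wmean s W 1)%:C%C) <= e * wmean s W 1.
  by rewrite -(ler_pM2l rk); lra.
rewrite (E 1) (wmean_ratio 1 hs hW) modcM modc_real (gtr0_norm (weight_ratio_gt0 _ _ _)).
rewrite mulrCA ler_wpM2l//; exact: ltW (weight_ratio_gt0 _ _ _).
Qed.

Let K := (2 * SG + del) / eps ^+ 2.

Lemma bounded_perturb s j Z : modc s <= 1 -> cube Z -> modc (perturb s j Z) <= SG.
Proof.
have a_gt0 := a0.
move=> s1 /sub hZ; have [] // := hol_perturb j s1 (Z := Z).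
by apply: polydiscW hZ; lra.
Qed.

(** The difference of the squares factors into the difference of the positive
    parts, which is Lipschitz in [W], and their sum, which is controlled by the first
    weights. *)
Lemma weight_compare s W Z : modc s <= 1 -> admissible_target W -> cube Z ->
  `|wt s W 2 Z - wt s (fun=> 0) 2 Z| <=
    K * (\sum_j modc (W j)) * (wt s W 1 Z + wt s (fun=> 0) 1 Z).
Proof.
have d_gt0 := del0.
move=> s1 hW hZ; rewrite /weight !expr1.
set x := 1 - sqdist _ W eps Z; set y := 1 - sqdist _ _ eps Z.
have lip : `|Num.max 0 x - Num.max 0 y| <= `|x - y|.
  have n1 := ler_norm (x - y); have n2 := ler_norm (- (x - y)); rewrite normrN in n2.
  rewrite ler_norml; have [x0|x0] := leP x 0; have [y0|y0] := leP y 0; lra.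
have xy : `|x - y| <= K * \sum_j modc (W j).
  rewrite (_ : x - y = sqdist (perturb s) (fun=> 0) eps Z - sqdist (perturb s) W eps Z);
    last by rewrite /x /y; ring.
  rewrite /sqdist -mulrBl -sumrB normrM [`|_^-1|]gtr0_norm ?invr_gt0 ?exprn_gt0//.
  rewrite /K -mulrA [_^-1 * _]mulrC mulrA ler_pM2r ?invr_gt0 ?exprn_gt0//.
  apply: le_trans (ler_norm_sum _ _ _) _; rewrite mulr_sumr; apply: ler_sum => j _.
  rewrite subr0; set g := perturb s j Z.
  have gS : modc g <= SG by exact: bounded_perturb.
  have t1 : `|modc g - modc (g - W j)| <= modc (W j).
    have h1 := modcB g (g - W j); have h2 := modcB g (W j).
    have h3 := modcD (g - W j) (W j); rewrite subrK in h3.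
    by rewrite ler_norml; lra.
  have t2 : modc g + modc (g - W j) <= 2 * SG + del.
    by have h2 := modcB g (W j); have := hW j; lra.
  rewrite subr_sqr normrM mulrC.
  by apply: ler_pM => //; rewrite ger0_norm ?addr_ge0 ?modc_ge0.
have mm : 0 <= Num.max 0 x + Num.max 0 y by rewrite addr_ge0// le_max lexx.
rewrite subr_sqr normrM (ger0_norm mm).
exact: ler_wpM2r mm _ _ (le_trans lip xy).
Qed.

Lemma wintegral_compare S (u : 'rV[C]_n -> C) s W : bounded_on_cubec a u ->
    (forall Z, cube Z -> modc (u Z) <= S) -> admissible s -> admissible_target W ->
  modc (wintegral s W u 2 - wintegral s (fun=> 0) u 2) <=
    S * (K * (\sum_j modc (W j))) * (wmean s W 1 + wmean s (fun=> 0) 1).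
Proof.
move=> bu uS hs hW; have [s1 _] := hs.
have b2 V k := bounded_wmean_integrand V k hs.
have bI V := bounded_weighted_integrand (wirtinger_perturb s1) V eps0 2 bu.
pose J2 Z := modc (jacobian_det (dperturb s) Z) ^+ 2.
have IE : wintegral s W u 2 - wintegral s (fun=> 0) u 2 =
    cube_meanc a (fun Z => conjc (u Z) * (J2 Z * wt s W 2 Z)%:C%C +
      -1 * (conjc (u Z) * (J2 Z * wt s (fun=> 0) 2 Z)%:C%C)).
  rewrite (cube_meancD a0 (bI _)); last exact: bounded_on_cubecM (bounded_on_cubec_cst _ _ _) (bI _).
  by rewrite (cube_meancZ a0 _ (bI _)) mulN1r.
set c := S * (K * _).
have bb : bounded_on_cube a (fun Z => J2 Z * wt s W 1 Z + J2 Z * wt s (fun=> 0) 1 Z).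
  exact: bounded_on_cubeD (b2 _ _) (b2 _ _).
have -> : c * (wmean s W 1 + wmean s (fun=> 0) 1) =
    cube_mean a (fun Z => c * (J2 Z * wt s W 1 Z + J2 Z * wt s (fun=> 0) 1 Z)).
  by rewrite (cube_meanZ a0 _ bb) (cube_meanD a0 (b2 _ _) (b2 _ _)).
rewrite IE; apply: (modc_cube_meanc a0).
- apply: bounded_on_cubecD (bI _) _.
  exact: bounded_on_cubecM (bounded_on_cubec_cst _ _ _) (bI _).
- by apply: bounded_on_cubeM bb; exists `|c|.
move=> Z hZ.
rewrite (_ : _ + _ = conjc (u Z) * (J2 Z * (wt s W 2 Z - wt s (fun=> 0) 2 Z))%:C%C); last first.
  by rewrite mulrBr rmorphB /=; ring.
rewrite modcM modc_conj modc_real normrM (ger0_norm (exprn_ge0 2 (modc_ge0 _))).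
have cmp := weight_compare s1 hW hZ.
rewrite /c -mulrA; apply: ler_pM; rewrite ?modc_ge0 ?uS//.
  exact: mulr_ge0 (exprn_ge0 2 (modc_ge0 _)) (normr_ge0 _).
by rewrite -mulrDr mulrCA ler_wpM2l// exprn_ge0// modc_ge0.
Qed.

Lemma wmean_compare s W : admissible s -> admissible_target W ->
  `|wmean s W 2 - wmean s (fun=> 0) 2| <=
    K * (\sum_j modc (W j)) * (wmean s W 1 + wmean s (fun=> 0) 1).
Proof.
move=> hs hW.
have one Z : cube Z -> modc (1 : C) <= 1 by rewrite modc1.
have := wintegral_compare (bounded_on_cubec_cst n a 1) one hs hW.
rewrite !(weighted_integral1 a0) mul1r; apply: le_trans; rewrite -modc_real.
by rewrite le_eqVlt; apply/orP; left; apply/eqP; congr modc; rewrite rmorphB.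
Qed.

Definition continuous_at0 (u : 'rV[C]_n -> C) := forall e, 0 < e ->
  exists2 d, 0 < d & forall Z, cube Z -> (forall k, modc (Z 0 k) <= d) ->
    modc (u Z - u 0) <= e.

Lemma cube0 : cube 0.
Proof. by move=> k; rewrite !mxE /= normr0 (ltW a0). Qed.

Lemma hol_continuous_at0 S u : hol (5 * a) S u -> continuous_at0 u.
Proof.
move=> Hu e e0; have [d d0 H] := hol_cube_limit a0 Hu cube0 e0.
by exists d => // Z hZ Zd; apply: H => // k; rewrite mxE subr0.
Qed.

Lemma continuous_at0D u v : continuous_at0 u -> continuous_at0 v ->
  continuous_at0 (fun Z => u Z + v Z).
Proof.
move=> cu cv e e0; have e2 : 0 < e / 2 by rewrite divr_gt0.
have [d1 d10 H1] := cu _ e2; have [d2 d20 H2] := cv _ e2.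
exists (Num.min d1 d2); first by rewrite lt_min d10.
move=> Z hZ Zd; rewrite opprD addrACA; apply: le_trans (modcD _ _) _.
have h1 : modc (u Z - u 0) <= e / 2.
  by apply: H1 => // k; apply: le_trans (Zd k) _; rewrite ge_min lexx.
have h2 : modc (v Z - v 0) <= e / 2.
  by apply: H2 => // k; apply: le_trans (Zd k) _; rewrite ge_min lexx orbT.
by lra.
Qed.

Lemma continuous_at0M u v : continuous_at0 u -> continuous_at0 v ->
  continuous_at0 (fun Z => u Z * v Z).
Proof.
move=> cu cv e e0.
pose m := modc (u 0) + modc (v 0) + 1.
have m1 : 1 <= m by rewrite /m; have := modc_ge0 (u 0); have := modc_ge0 (v 0); lra.
have m0 : 0 < m by lra.
pose f := Num.min 1 (e / m).
have f0 : 0 < f by rewrite lt_min ltr01 divr_gt0.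
have f1 : f <= 1 by rewrite ge_min lexx.
have fm : f * m <= e by rewrite -ler_pdivlMr// ge_min lexx orbT.
have [d1 d10 H1] := cu _ f0; have [d2 d20 H2] := cv _ f0.
exists (Num.min d1 d2); first by rewrite lt_min d10.
move=> Z hZ Zd.
have h1 : modc (u Z - u 0) <= f.
  by apply: H1 => // k; apply: le_trans (Zd k) _; rewrite ge_min lexx.
have h2 : modc (v Z - v 0) <= f.
  by apply: H2 => // k; apply: le_trans (Zd k) _; rewrite ge_min lexx orbT.
rewrite (_ : _ - _ = (u Z - u 0) * (v Z - v 0) + ((u Z - u 0) * v 0 + u 0 * (v Z - v 0)));
  last by ring.
apply: le_trans (modcD _ _) _; apply: le_trans (lerD (lexx _) (modcD _ _)) _.
rewrite !modcM.
have t1 : modc (u Z - u 0) * modc (v Z - v 0) <= f * 1.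
  by apply: ler_pM; rewrite ?modc_ge0// (le_trans h2).
have t2 : modc (u Z - u 0) * modc (v 0) <= f * modc (v 0) by rewrite ler_wpM2r ?modc_ge0.
have t3 : modc (u 0) * modc (v Z - v 0) <= modc (u 0) * f by rewrite ler_wpM2l ?modc_ge0.
by move: fm; rewrite /m; lra.
Qed.

Lemma continuous_at0_cst (c : C) : continuous_at0 (fun=> c).
Proof. by move=> e e0; exists 1 => // Z _ _; rewrite subrr modc0 ltW. Qed.

Lemma continuous_at0_sum (I : Type) (r : seq I) (u : I -> 'rV[C]_n -> C) :
  (forall i, continuous_at0 (u i)) -> continuous_at0 (fun Z => \sum_(i <- r) u i Z).
Proof.
move=> cu; elim: r => [|i r IH].
  have -> : (fun Z => \sum_(i <- [::]) u i Z) = fun=> 0.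
    by apply/funext => Z; rewrite big_nil.
  exact: continuous_at0_cst.
have -> : (fun Z => \sum_(i <- i :: r) u i Z) = fun Z => u i Z + \sum_(i <- r) u i Z.
  by apply/funext => Z; rewrite big_cons.
exact: continuous_at0D.
Qed.

Lemma continuous_at0_prod (I : Type) (r : seq I) (u : I -> 'rV[C]_n -> C) :
  (forall i, continuous_at0 (u i)) -> continuous_at0 (fun Z => \prod_(i <- r) u i Z).
Proof.
move=> cu; elim: r => [|i r IH].
  have -> : (fun Z => \prod_(i <- [::]) u i Z) = fun=> 1.
    by apply/funext => Z; rewrite big_nil.
  exact: continuous_at0_cst.
have -> : (fun Z => \prod_(i <- i :: r) u i Z) = fun Z => u i Z * \prod_(i <- r) u i Z.
  by apply/funext => Z; rewrite big_cons.
exact: continuous_at0M.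
Qed.

Lemma continuous_jacobian s : modc s <= 1 -> continuous_at0 (jacobian_det (dperturb s)).
Proof.
have a_gt0 := a0.
move=> s1.
have cD i l : continuous_at0 (fun Z => jacobian_mx (dperturb s) Z i l).
  have -> : (fun Z => jacobian_mx (dperturb s) Z i l) = dperturb s i l.
    by apply/funext => Z; rewrite mxE.
  apply: (hol_continuous_at0 (S := 8 * SG / a)).
  by apply: holW (hol_dperturb s1 i l) => //; lra.
apply: continuous_at0_sum => q; apply: continuous_at0M; first exact: continuous_at0_cst.
by apply: continuous_at0_prod => i; exact: cD.
Qed.

(** Near the origin the integrand is bounded below, as the Jacobian does not vanish
    and [F] is small there. *)
Lemma wmean_gt0 s : admissible s -> jacobian_det (dperturb s) 0 != 0 ->
  0 < wmean s (fun=> 0) 2.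
Proof.
have a_gt0 := a0.
move=> hs J0; have [s1 _] := hs.
have mJ : 0 < modc (jacobian_det (dperturb s) 0) by rewrite modc_gt0.
have mJ2 : 0 < modc (jacobian_det (dperturb s) 0) / 2 by rewrite divr_gt0.
have [d1 d10 H1] := continuous_jacobian s1 mJ2.
have csq : continuous_at0 (fun Z => \sum_j (modc (perturb s j Z))%:C%C * (modc (perturb s j Z))%:C%C).
  apply: continuous_at0_sum => j.
  have cp : continuous_at0 (fun Z => (modc (perturb s j Z))%:C%C).
    have cp : continuous_at0 (perturb s j).
      by apply: (hol_continuous_at0 (S := SG)); apply: holW (hol_perturb j s1) => //; lra.
    move=> e /cp[d d0 H]; exists d => // Z hZ /(H Z hZ); apply: le_trans.
    rewrite -rmorphB modc_real ler_norml.
    have h1 := modcD (perturb s j Z - perturb s j 0) (perturb s j 0).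
    have h2 := modcB (perturb s j Z) (perturb s j Z - perturb s j 0).
    rewrite subrK in h1; rewrite subKr in h2.
    by apply/andP; split; lra.
  exact: continuous_at0M.
have e2 : 0 < eps ^+ 2 / 2 by rewrite divr_gt0// exprn_gt0.
have [d2 d20 H2] := csq _ e2.
have sqE Z : \sum_j (modc (perturb s j Z))%:C%C * (modc (perturb s j Z))%:C%C =
    (\sum_j modc (perturb s j Z - 0) ^+ 2)%:C%C :> C.
  by rewrite rmorph_sum; apply: eq_bigr => j _; rewrite subr0 expr2 rmorphM.
have sq0 : \sum_j modc (perturb s j 0 - 0) ^+ 2 = 0.
  by rewrite big1// => j _; rewrite /perturb F0 mxE mulr0 addr0 subr0 modc0 expr0n.
pose lo := (modc (jacobian_det (dperturb s) 0) / 2) ^+ 2 * (1 / 2) ^+ 2.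
apply: (cube_mean_gt0 (c := lo) (del := Num.min d1 d2 / 2) a0 (bounded_wmean_integrand _ _ hs)).
- by move=> Z _; exact: mulr_ge0 (exprn_ge0 2 (modc_ge0 _)) (weight_ge0 _ _ _ _ _).
- by rewrite mulr_gt0// exprn_gt0// divr_gt0.
- by rewrite divr_gt0// lt_min d10.
move=> Z hZ Zd.
have Zm k : modc (Z 0 k) <= Num.min d1 d2.
  by apply: le_trans (modc_le_ReIm _) _; have [h1 h2] := Zd k; lra.
have J1 := H1 Z hZ (fun k => le_trans (Zm k) (ltac:(by rewrite ge_min lexx) : Num.min d1 d2 <= d1)).
have W1 := H2 Z hZ (fun k => le_trans (Zm k) (ltac:(by rewrite ge_min lexx orbT) : Num.min d1 d2 <= d2)).
rewrite !sqE sq0 subr0 modc_real in W1.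
have h := modcB (jacobian_det (dperturb s) Z) (jacobian_det (dperturb s) Z - jacobian_det (dperturb s) 0).
rewrite subKr in h.
apply: ler_pM; rewrite ?exprn_ge0 ?(ltW mJ2) ?divr_ge0//.
  by apply: lerXn2r; rewrite ?nnegrE ?modc_ge0 ?(ltW mJ2)//; lra.
have sq : sqdist (perturb s) (fun=> 0) eps Z <= 1 / 2.
  rewrite /sqdist ler_pdivrMr ?exprn_gt0//.
  by apply: le_trans (ler_norm _) _; apply: le_trans W1 _; lra.
rewrite /weight; apply: lerXn2r; rewrite ?nnegrE ?le_max ?lexx ?divr_ge0//.
by apply/orP; right; lra.
Qed.

(** With [X] and [Y] the second weighted means for [W] and [0]: [X] and [Y]
    differ by [O(|W|) (X + Y)], hence are comparable; the integrals of [u] differ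
    by [O(|W|) (X + Y)] as well, and they are close to [(conj c) X] and [0]. *)
Lemma fiber_value_estimate_faces : exists K' om, [/\ 0 <= K', 0 < om &
  forall S (u : 'rV[C]_n -> C) W c, hol (16 * a) S u -> u 0 = 0 ->
    \sum_j modc (W j) <= om ->
    (forall Z, cube Z -> (forall j, F j Z = W j) -> u Z = c) ->
  modc c <= K' * S * \sum_j modc (W j)].
Proof.
have a_gt0 := a0; have d_gt0 := del0.
have r1 := weight_ratio_gt0 R n 1; set rr := weight_ratio R n 1 in r1.
have K0 : 0 <= K.
  rewrite /K divr_ge0 ?exprn_ge0 ?(ltW eps0)// addr_ge0 ?(ltW del0)// mulr_ge0//.
  by rewrite /SG addr_ge0 ?mulr_ge0 ?(ltW a0).
pose K1 := K / rr; have K10 : 0 <= K1 by rewrite divr_ge0// ltW.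
have K11 : 0 < 2 * (K1 + 1) by rewrite mulr_gt0// ltr_wpDl.
exists (4 * K1), (Num.min (del / 4) (2 * (K1 + 1))^-1); split.
- by rewrite mulr_ge0.
- by rewrite lt_min divr_gt0//= invr_gt0.
move=> S u W c Hu u0; set Wn := \sum_j _; rewrite le_min => /andP[Wd WK] fib.
have Wn0 : 0 <= Wn by apply: sumr_ge0 => j _; exact: modc_ge0.
have hW : admissible_target W.
  move=> j; apply: le_trans Wd; rewrite /Wn (bigD1 j)//= lerDl.
  by apply: sumr_ge0 => k _; exact: modc_ge0.
have hW0 : admissible_target (fun=> 0) by move=> j; rewrite modc0 divr_ge0// ltW.
have KW : K1 * Wn <= 1 / 2.
  move: WK; rewrite -[_^-1]mul1r ler_pdivlMr// => WK.
  by lra.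
have uS Z : cube Z -> modc (u Z) <= S.
  by move=> /sub hZ; have [] // := Hu Z; apply: polydiscW hZ; lra.
have S0 : 0 <= S := le_trans (modc_ge0 _) (uS 0 cube0).
have [bu _] := hol_wirtinger Hu.
apply/ler_addgt0Pr => e e0; have e4 : 0 < e / 4 by rewrite divr_gt0.
have [s1 s10 H1] := concentration Hu e4 hW fib.
have [|s2 s20 H2] := concentration (W := fun=> 0) (c := 0) Hu e4 hW0.
  by move=> Z hZ /(F_isolated hZ) ->.
pose A : 'M[C]_n := \matrix_(i, l) dpart l (F i) 0.
have b0 : 0 < Num.min (Num.min s1 s2) (Num.min 1 (del / (8 * a))).
  by rewrite !lt_min s10 s20 ltr01 divr_gt0// mulr_gt0.
have [s] := det_perturb A b0; rewrite !lt_min => /andP[/andP[ss1 ss2] /andP[ss3 ss4]] dA.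
have hs : admissible s.
  split; first exact: ltW.
  by move: (ltW ss4); rewrite ler_pdivlMr ?mulr_gt0//; lra.
have J0 : jacobian_det (dperturb s) 0 != 0.
  rewrite (_ : jacobian_det _ 0 = \det (A + s%:M))//; congr (\det _).
  apply/matrixP => i l; rewrite !mxE /dperturb; apply: dpartE.
  by apply: perturb_derivative => k; rewrite mxE modc0 mulr_gt0.
have Y0 := wmean_gt0 hs J0; set Y := wmean s (fun=> 0) 2 in Y0.
pose X := wmean s W 2.
have mX : wmean s W 1 = X / rr.
  by rewrite /X (wmean_ratio 1 hs hW) -/rr mulrC mulKf// gt_eqF.
have mY : wmean s (fun=> 0) 1 = Y / rr.
  by rewrite /Y (wmean_ratio 1 hs hW0) -/rr mulrC mulKf// gt_eqF.
have C1 := H1 s ss1 hs; have C2 := H2 s ss2 hs.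
have C3 := wintegral_compare bu uS hs hW; have C4 := wmean_compare hs hW.
rewrite -/X -/Y -/Wn mX mY in C1 C2 C3 C4.
rewrite conjc0 mul0r subr0 in C2.
have KE : K * Wn * (X / rr + Y / rr) = K1 * Wn * (X + Y).
  by rewrite /K1; field; rewrite gt_eqF.
have X0 : 0 <= X by exact: wmean_ge0.
have KXY : K1 * Wn * (X + Y) <= 1 / 2 * (X + Y).
  by apply: ler_wpM2r => //; rewrite addr_ge0// ltW.
have YX : Y <= 3 * X.
  by move: C4; rewrite KE ler_norml => /andP[]; lra.
have Xp : 0 < X by lra.
have cX : modc c * X = modc (conjc c * X%:C%C).
  by rewrite modcM modc_conj modc_real ger0_norm.
have I1 : modc c * X <= modc (wintegral s W u 2) + e / 4 * X.
  rewrite cX; have := modcB (wintegral s W u 2) (wintegral s W u 2 - conjc c * X%:C%C).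
  by rewrite subKr; move: C1; lra.
have I2 : modc (wintegral s W u 2) <= S * (K1 * Wn * (X + Y)) + e / 4 * Y.
  have := modcD (wintegral s W u 2 - wintegral s (fun=> 0) u 2) (wintegral s (fun=> 0) u 2).
  rewrite subrK => /le_trans; apply; apply: lerD C2.
  by apply: le_trans C3 _; rewrite -mulrA KE.
have I3 : S * (K1 * Wn * (X + Y)) <= S * (K1 * Wn * (4 * X)).
  apply: ler_wpM2l => //; apply: ler_wpM2l; first exact: mulr_ge0.
  by rewrite (_ : 4 * X = X + 3 * X) ?lerD2l//; ring.
have I4 : e / 4 * Y <= e / 4 * (3 * X) by rewrite ler_wpM2l// ltW.
by rewrite -(ler_pM2r Xp); lra.
Qed.

End KeyEstimate.

(** The quantitative form of the finiteness of [F]: the value [c] of [u] on the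
    fibre is bounded linearly in [W], with a constant that
    depends on [u] only through its bound [S]. *)
Theorem fiber_value_estimate (R : realType) (n : nat) (a : R) (F : 'I_n -> 'rV[R[i]]_n -> R[i])
    (SF : R) : 0 < a -> (forall i, hol (16 * a) SF (F i)) -> (forall i, F i 0 = 0) ->
    (forall Z, cube a Z -> (forall j, F j Z = 0) -> Z = 0) ->
  exists K om : R, [/\ 0 <= K, 0 < om &
  forall S (u : 'rV[R[i]]_n -> R[i]) W c, hol (16 * a) S u -> u 0 = 0 ->
    \sum_j modc (W j) <= om ->
    (forall Z, cube a Z -> (forall j, F j Z = W j) -> u Z = c) ->
  modc c <= K * S * \sum_j modc (W j)].
Proof.
move=> a0 HF F0 Fiso; have [del del0 H] := face_bound a0 HF Fiso.
exact: (fiber_value_estimate_faces a0 HF F0 Fiso del0 H).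
Qed.

(** A finite map covers a neighbourhood of the origin: over a value that is
    not taken, the constant function [0] could be assigned the value [1]. *)
Corollary finite_map_onto (R : realType) (n : nat) (a : R) (F : 'I_n -> 'rV[R[i]]_n -> R[i])
    (SF : R) : 0 < a -> (forall i, hol (16 * a) SF (F i)) -> (forall i, F i 0 = 0) ->
    (forall Z, cube a Z -> (forall j, F j Z = 0) -> Z = 0) ->
  exists2 om : R, 0 < om & forall W : 'I_n -> R[i], \sum_j modc (W j) <= om ->
    exists2 Z, cube a Z & forall j, F j Z = W j.
Proof.
move=> a0 HF F0 Fiso; have [K [om [K0 om0 H]]] := fiber_value_estimate a0 HF F0 Fiso.
exists om => // W Wom; apply: contrapT => no.
have hol0 : hol (16 * a) 0 (fun _ : 'rV[R[i]]_n => 0 : R[i]).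
  move=> Z _; split=> [|l]; first by rewrite modc0.
  exists 0; apply: complex_derivative_ext (complex_derivative_affine 0 0 0) => w.
  by rewrite mul0r addr0.
have fib Z : cube a Z -> (forall j, F j Z = W j) -> (0 : R[i]) = 1.
  by move=> hZ FW; case: no; exists Z.
by have := H 0 (fun=> 0) W 1 hol0 erefl Wom fib; rewrite modc1 mulr0 mul0r ler10.
Qed.

(** * Transversality for fibred maps *)

Section Expansion.
Variables (R : realType) (n : nat).
Local Notation C := R[i].
Implicit Types (u : 'rV[C]_n -> C) (Y Z : 'rV[C]_n).

Variable b : R.
Hypothesis b0 : 0 < b.

Lemma dpart_joint_lipschitz S u : hol (16 * b) S u ->
  forall l Z Z', polydisc b Z -> polydisc b Z' ->
    modc (dpart l u Z - dpart l u Z') <=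
    8 * (8 * S / b) / b * \sum_k modc (Z 0 k - Z' 0 k).
Proof.
have b_gt0 := b0.
move=> Hu l Z Z' hZ hZ'.
have Hd : hol (b + 2 * b) (8 * S / b) (dpart l u).
  by apply: hol_dpart => //; apply: holW Hu => //; lra.
exact: hol_joint_lipschitz Hd hZ hZ'.
Qed.

(** The partial derivatives of the remainder are small by
    [dpart_joint_lipschitz]. *)
Lemma hol_taylor1 S u : hol (16 * b) S u ->
  forall Y, polydisc (b / (2 * n.+1%:R)) Y ->
    modc (u Y - u 0 - \sum_l Y 0 l * dpart l u 0) <=
    2 * (8 * (8 * S / b) / b) * n%:R * (\sum_l modc (Y 0 l)) ^+ 2.
Proof.
have b_gt0 := b0.
move=> Hu; have HK := dpart_joint_lipschitz Hu.
have S0 : 0 <= S.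
  have [h _] := Hu 0 ltac:(by move=> i; rewrite mxE modc0 mulr_gt0).
  by apply: le_trans h; exact: modc_ge0.
have [K [KE K0]] : exists K, 8 * (8 * S / b) / b = K /\ 0 <= K.
  by eexists; split; first reflexivity; rewrite !(divr_ge0, mulr_ge0)// ltW.
rewrite KE in HK *.
move=> Y hY; set T := \sum_l modc _.
have T0 : 0 <= T by apply: sumr_ge0 => l _; exact: modc_ge0.
have YT l : modc (Y 0 l) <= T.
  by rewrite /T (bigD1 l)//= lerDl; apply: sumr_ge0 => k _; exact: modc_ge0.
have [T00|Tp] := eqVneq T 0.
  have Y0 : Y = 0.
    apply/rowP => l; rewrite mxE; apply/modc_eq0/eqP.
    by rewrite eq_le modc_ge0 andbT -T00.
  rewrite T00 expr0n mulr0 Y0 subrr big1 ?subrr ?modc0// => l _.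
  by rewrite mxE mul0r.
have {}Tp : 0 < T by rewrite lt0r Tp.
have Tb : 2 * T <= b.
  have : T <= \sum_(l < n) (b / (2 * n.+1%:R)) by apply: ler_sum => l _; exact: ltW.
  rewrite sumr_const card_ord -[leRHS]mulr_natr => hT.
  have nn : n%:R / n.+1%:R <= 1 :> R by rewrite ler_pdivrMr// mul1r ler_nat.
  have hb : b * (n%:R / n.+1%:R) <= b by rewrite ler_piMr// ltW.
  have E : b / (2 * n.+1%:R) * n%:R = b * (n%:R / n.+1%:R) / 2.
    by field; rewrite addrC natr1.
  by rewrite E in hT; move: (b * _) hb hT => B; lra.
pose w Z := u Z - \sum_l Z 0 l * dpart l u 0.
have sub Z : polydisc (2 * T) Z -> polydisc b Z by apply: polydiscW.
have z0 : polydisc (2 * T) (0 : 'rV[C]_n) by move=> i; rewrite mxE modc0 mulr_gt0.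
have hY2 : polydisc (2 * T) Y by move=> i; have := YT i; lra.
have dw Z l : polydisc b Z ->
    complex_derivative_at (fun t => w (move_coord l t Z)) 0 (dpart l u Z - dpart l u 0).
  move=> hZ; have du := dpartP l Hu (polydiscW (ltac:(by lra) : b <= 16 * b) hZ).
  have := complex_derivativeD du (complex_derivative_affine (- dpart l u 0)
    (- \sum_k Z 0 k * dpart k u 0) 0).
  apply: complex_derivative_ext => t; rewrite /w.
  have -> : \sum_k move_coord l t Z 0 k * dpart k u 0 =
      \sum_k Z 0 k * dpart k u 0 + t * dpart l u 0.
    under eq_bigr do rewrite move_coordE mulrDl.
    rewrite big_split /= [in X in _ + X](bigD1 l)//= eqxx [in X in _ + X]big1 ?addr0//.
    by move=> k /negbTE ->; rewrite mul0r.
  by ring.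
have Hw : exists Sw, hol (2 * T) Sw w.
  exists (S + \sum_l b * modc (dpart l u 0)) => Z hZ; split=> [|l].
    apply: le_trans (modcB _ _) _; apply: lerD.
      have [h _] := Hu Z ltac:(by apply: polydiscW hZ; lra).
      exact: h.
    apply: le_trans (modc_sum _ _ _) _; apply: ler_sum => l _.
    by rewrite modcM ler_wpM2r ?modc_ge0// ltW// sub.
  by eexists; apply: dw; exact: sub.
have [Sw {}Hw] := Hw.
have := hol_lipschitz_partials (kap := K * (2 * T * n%:R)) Hw _ hY2 z0.
have w0 : w 0 = u 0 by rewrite /w big1 ?subr0// => l _; rewrite mxE mul0r.
rewrite w0 /w => H.
have {}H : modc (u Y - \sum_l Y 0 l * dpart l u 0 - u 0) <=
    K * (2 * T * n%:R) * \sum_l modc (Y 0 l - (0 : 'rV[C]_n) 0 l).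
  apply: H => l Z hZ; rewrite (dpartE (dw Z l (sub Z hZ))).
  have zb : polydisc b (0 : 'rV[C]_n) by move=> i; rewrite mxE modc0.
  apply: le_trans (HK l Z 0 (sub Z hZ) zb) _; apply: ler_wpM2l => //.
  apply: (@le_trans _ _ (\sum_(k < n) 2 * T)); last by rewrite sumr_const card_ord mulr_natr.
  by apply: ler_sum => k _; rewrite mxE subr0 ltW.
rewrite addrAC; apply: le_trans H _.
under eq_bigr do rewrite mxE subr0.
rewrite -/T le_eqVlt; apply/orP; left; apply/eqP.
by ring.
Qed.

End Expansion.

Section Transversality.
Variables (R : realType) (N d : nat) (r S : R).
Local Notation C := R[i].
Variables (h : 'I_N -> 'rV[C]_N -> C) (g : 'I_d -> 'rV[C]_(N + d) -> C).
Hypothesis r0 : 0 < r.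
Hypothesis hol_h : forall i, hol r S (h i).
Hypothesis hol_g : forall j, hol r S (g j).
Hypothesis h0 : forall i, h i 0 = 0.
Hypothesis g0 : forall j, g j 0 = 0.
Hypothesis h_isolated : forall Z, polydisc r Z -> (forall i, h i Z = 0) -> Z = 0.
(** The last [d] coordinates are chosen adapted to [g]; only the differential at
    the origin is normalised. *)
Hypothesis g_graph : forall j k, dpart (rshift N k) (g j) 0 = (j == k)%:R.
(** The zero set of [g] is a union of fibres of [h], the coordinates [eta] being
    kept fixed. *)
Hypothesis saturated : forall Z Z' eta,
  polydisc r (row_mx Z eta) -> polydisc r (row_mx Z' eta) ->
  (forall i, h i Z = h i Z') -> (forall j, g j (row_mx Z eta) = 0) ->
  forall j, g j (row_mx Z' eta) = 0.

Implicit Types (Z : 'rV[C]_N) (eta : 'rV[C]_d) (Y : 'rV[C]_(N + d)).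

Lemma polydisc_row s Z eta : polydisc s (row_mx Z eta) <-> polydisc s Z /\ polydisc s eta.
Proof.
split=> [H|[HZ He] l]; first split=> l.
- by have := H (lshift d l); rewrite row_mxEl.
- by have := H (rshift N l); rewrite row_mxEr.
by case: (split_ordP l) => k ->; rewrite ?row_mxEl ?row_mxEr.
Qed.

Lemma move_coord_rshift (k : 'I_d) t Z eta :
  move_coord (rshift N k) t (row_mx Z eta) = row_mx Z (move_coord k t eta).
Proof.
apply/rowP => l; rewrite move_coordE; case: (split_ordP l) => j ->.
  by rewrite !row_mxEl eq_lrshift addr0.
by rewrite !row_mxEr move_coordE eq_rshift.
Qed.

Lemma lsubmx_move_coord (k : 'I_N) t Y :
  lsubmx (move_coord (lshift d k) t Y) = move_coord k t (lsubmx Y).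
Proof.
by apply/rowP => l; rewrite mxE !move_coordE mxE eq_lshift.
Qed.

Lemma lsubmx_move_coord_r (k : 'I_d) t Y : lsubmx (move_coord (rshift N k) t Y) = lsubmx Y.
Proof.
by apply/rowP => l; rewrite mxE move_coordE mxE eq_lrshift addr0.
Qed.

(** Close to the origin [g (Z, _)] is a perturbation of the identity with small
    Lipschitz constant. *)
Lemma fibre_injective : exists2 s, 0 < s <= r & forall Z eta eta',
  polydisc s (row_mx Z eta) -> polydisc s (row_mx Z eta') ->
  (forall j, g j (row_mx Z eta) = g j (row_mx Z eta')) -> eta = eta'.
Proof.
have r_gt0 := r0.
pose b := r / 16; have bE : 16 * b = r by rewrite /b; field.
have b0 : 0 < b by rewrite /b; lra.
have HK j : hol (16 * b) S (g j) by rewrite bE.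
pose K := `|8 * (8 * S / b) / b|.
have K0 : 0 <= K by exact: normr_ge0.
have lip j l Y Y' : polydisc b Y -> polydisc b Y' ->
    modc (dpart l (g j) Y - dpart l (g j) Y') <= K * \sum_k modc (Y 0 k - Y' 0 k).
  move=> hY hY'; apply: le_trans (dpart_joint_lipschitz b0 (HK j) l hY hY') _.
  by apply: ler_wpM2r (ler_norm _); apply: sumr_ge0 => k _; exact: modc_ge0.
(* a Lipschitz constant c per component sums up to less than 1 *)
pose c : R := (2 * d.+1%:R)^-1.
have c0 : 0 < c by rewrite invr_gt0 mulr_gt0.
pose D := K * (N + d)%:R + 1.
have D0 : 0 < D by rewrite ltr_pwDr// mulr_ge0.
exists (Num.min b (c / D)).
  by rewrite lt_min b0 divr_gt0//= ge_min /b; apply/orP; left; lra.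
set s := Num.min _ _.
have s0 : 0 < s by rewrite lt_min b0 divr_gt0.
have sb : s <= b by rewrite ge_min lexx.
have sc : s * D <= c by rewrite -ler_pdivlMr// ge_min lexx orbT.
have KN : K * ((N + d)%:R * s) <= c.
  by rewrite mulrA; apply: le_trans sc; rewrite [leRHS]mulrC ler_wpM2r ?ltW// ltrDl.
move=> Z eta eta' hY hY' E.
have [hZ he] := (polydisc_row _ _ _).1 hY; have [_ he'] := (polydisc_row _ _ _).1 hY'.
have dw j k x : polydisc s x -> complex_derivative_at
    (fun t => g j (row_mx Z (move_coord k t x)) - move_coord k t x 0 j) 0
    (dpart (rshift N k) (g j) (row_mx Z x) - (j == k)%:R).
  move=> hx.
  have hr : polydisc r (row_mx Z x).
    have hs : polydisc s (row_mx Z x) by apply/polydisc_row.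
    by apply: polydiscW hs; rewrite /b in sb; lra.
  have := complex_derivativeD (dpartP (rshift N k) (hol_g j) hr)
    (complex_derivative_affine (- (j == k)%:R) (- x 0 j) 0).
  apply: complex_derivative_ext => t; rewrite move_coord_rshift move_coordE.
  by case: eqP => _ /=; ring.
have Hw j : hol s (S + s) (fun x => g j (row_mx Z x) - x 0 j).
  move=> x hx; split=> [|k]; last by eexists; exact: dw.
  apply: le_trans (modcB _ _) _; apply: lerD; last exact: ltW.
  have hs : polydisc s (row_mx Z x) by apply/polydisc_row.
  by have [] := hol_g j (polydiscW (ltac:(by rewrite /b in sb; lra) : s <= r) hs).
pose T := \sum_k modc (eta 0 k - eta' 0 k).
have est j : modc (eta 0 j - eta' 0 j) <= c * T.
  have := hol_lipschitz_partials (kap := c) (Hw j) _ he he'.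
  rewrite E -/T => H; rewrite modcBC.
  have -> : eta' 0 j - eta 0 j =
    g j (row_mx Z eta') - eta 0 j - (g j (row_mx Z eta') - eta' 0 j) by ring.
  apply: H => k x hx; rewrite (dpartE (dw j k x hx)) -g_graph.
  have hs : polydisc s (row_mx Z x) by apply/polydisc_row.
  have z0 : polydisc b (0 : 'rV[C]_(N + d)) by move=> l; rewrite mxE modc0.
  apply: le_trans (lip j _ _ _ (polydiscW sb hs) z0) _; apply: le_trans KN.
  apply: ler_wpM2l => //; rewrite mulr_natl -[X in _ *+ X]card_ord -sumr_const.
  by apply: ler_sum => l _; rewrite [X in _ - X]mxE subr0 ltW.
have T0 : T <= 0.
  have : T <= \sum_(k < d) c * T by apply: ler_sum => k _; exact: est.
  rewrite sumr_const card_ord -[leRHS]mulr_natr.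
  have T_ge0 : 0 <= T by apply: sumr_ge0 => k _; exact: modc_ge0.
  have cd : c * d%:R <= 2^-1.
    rewrite /c invfM -mulrA ler_piMr// mulrC ler_pdivrMr// mul1r ler_nat //.
  have := ler_wpM2r T_ge0 cd; rewrite mulrAC.
  by move: (c * _ * _) => B; lra.
apply/rowP => j; apply/eqP; rewrite -subr_eq0; apply/eqP/modc_eq0/eqP.
rewrite eq_le modc_ge0 andbT; apply: le_trans (est j) _.
by rewrite pmulr_rle0.
Qed.

(** The pair [(h, g)] as a family indexed by ['I_(N + d)]. *)
Definition fibred_map (l : 'I_(N + d)) Y : C :=
  match fintype.split l with inl i => h i (lsubmx Y) | inr j => g j Y end.

Lemma fibred_map_l i Y : fibred_map (lshift d i) Y = h i (lsubmx Y).
Proof. by rewrite /fibred_map (unsplitK (inl i)). Qed.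

Lemma fibred_map_r j Y : fibred_map (rshift N j) Y = g j Y.
Proof. by rewrite /fibred_map (unsplitK (inr j)). Qed.

Lemma polydisc_lsubmx s Y : polydisc s Y -> polydisc s (lsubmx Y).
Proof. by move=> H i; rewrite mxE. Qed.

Lemma hol_fibred_map l : hol r S (fibred_map l).
Proof.
case: (split_ordP l) => i ->; last first.
  by rewrite (_ : fibred_map _ = g i) //; apply/funext => Y; rewrite fibred_map_r.
move=> Y /polydisc_lsubmx hY; rewrite fibred_map_l.
split=> [|k]; first by have [] := hol_h i hY.
case: (split_ordP k) => j ->.
  have [_ /(_ j)[a da]] := hol_h i hY; exists a.
  by apply: complex_derivative_ext da => t; rewrite fibred_map_l lsubmx_move_coord.
exists 0; apply: complex_derivative_ext (complex_derivative_affine 0 (h i (lsubmx Y)) 0).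
by move=> t; rewrite fibred_map_l lsubmx_move_coord_r mul0r add0r.
Qed.

Lemma linear_le_quadratic (A B t0 : R) : 0 < t0 ->
  (forall t, 0 < t -> t <= t0 -> t * A <= B * t ^+ 2) -> A <= 0.
Proof.
move=> t00 H; rewrite leNgt; apply/negP => A0.
have B0 : 0 < `|B| + 1 by rewrite ltr_wpDl.
pose t := Num.min t0 (A / (`|B| + 1) / 2).
have tp : 0 < t by rewrite lt_min t00 !divr_gt0.
have tt : t <= t0 by rewrite ge_min lexx.
have tA : t * 2 * (`|B| + 1) <= A.
  by rewrite -ler_pdivlMr// -ler_pdivlMr// ge_min lexx orbT.
have := H t tp tt; rewrite expr2 mulrCA ler_pM2l// => AB.
have : B * t <= `|B| * t by rewrite ler_wpM2r ?ler_norm// ltW.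
by rewrite -mulrA in tA; nra.
Qed.

Lemma small_line (w : 'rV[C]_N) e : 0 < e ->
  exists2 t0 : R, 0 < t0 & forall t, 0 < t -> t <= t0 -> polydisc e (t%:C%C *: w).
Proof.
move=> e0; pose T := \sum_l modc (w 0 l) + 1.
have wT l : modc (w 0 l) < T.
  rewrite /T (bigD1 l)//= -addrA ltrDl ltr_wpDl//.
  by apply: sumr_ge0 => k _; exact: modc_ge0.
have T0 : 0 < T by rewrite ltr_wpDl// sumr_ge0// => l _; exact: modc_ge0.
exists (e / T) => [|t t0 te l]; first by rewrite divr_gt0.
rewrite mxE modcM modc_real gtr0_norm//.
by rewrite ler_pdivlMr// in te; apply: lt_le_trans te; rewrite ltr_pM2l.
Qed.

(** All points of the fibre of [fibred_map] over [(h (t v), 0)] have the same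
    [eta]: saturation gives [g (t v, eta) = 0], and [fibre_injective] applies.
    As [h (t v)] is of second order in [t], [fiber_value_estimate] makes this
    [eta] of second order, too; hence the first-order term of
    [g (t v, eta) = 0] vanishes. *)
Theorem kernel_transversal (v : 'rV[C]_N) :
  (forall i, \sum_l v 0 l * dpart l (h i) 0 = 0) ->
  forall j, \sum_l v 0 l * dpart (lshift d l) (g j) 0 = 0.
Proof.
have r_gt0 := r0.
move=> hv j0; have [s /andP[s0 sr] inj] := fibre_injective.
pose a := s / 16; have a16 : 16 * a = s by rewrite /a; field.
have a0 : 0 < a by rewrite /a; lra.
have HG l : hol (16 * a) S (fibred_map l).
  by rewrite a16; apply: holW (hol_fibred_map l).
have cs Y : cube a Y -> polydisc s Y.
  by move=> /(cube_polydisc a0); apply: polydiscW; rewrite /a; lra.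
have G0 l : fibred_map l 0 = 0.
  case: (split_ordP l) => i ->; rewrite ?fibred_map_l ?fibred_map_r ?g0//.
  by rewrite (_ : lsubmx (0 : 'rV[C]_(N + d)) = 0) ?h0//; apply/rowP => k; rewrite !mxE.
have row00 : row_mx 0 0 = 0 :> 'rV[C]_(N + d) by rewrite row_mx0.
have Giso Y : cube a Y -> (forall l, fibred_map l Y = 0) -> Y = 0.
  move=> /cs hY GY; rewrite -(hsubmxK Y).
  have L : lsubmx Y = 0.
    apply: h_isolated => [|i]; last by rewrite -fibred_map_l GY.
    exact: polydiscW sr (polydisc_lsubmx hY).
  rewrite L (_ : rsubmx Y = 0) ?row00//; apply: (inj 0).
  - by rewrite -L hsubmxK.
  - by rewrite row00 => l; rewrite mxE modc0.
  - by move=> j; rewrite -{1}L hsubmxK row00 g0 -(fibred_map_r j) GY.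
have [K [om [K0 om0 Hest]]] := fiber_value_estimate a0 HG G0 Giso.
have [om' om'0 Honto] := finite_map_onto a0 HG G0 Giso.
pose b := r / 16; have bE : 16 * b = r by rewrite /b; field.
have b0 : 0 < b by rewrite /b; lra.
have Hhb i : hol (16 * b) S (h i) by rewrite bE.
have Hgb j : hol (16 * b) S (g j) by rewrite bE.
pose bN := b / (2 * N.+1%:R); pose bD := b / (2 * (N + d).+1%:R).
have bN0 : 0 < bN by rewrite divr_gt0// mulr_gt0.
have bD0 : 0 < bD by rewrite divr_gt0// mulr_gt0.
pose T := \sum_l modc (v 0 l).
have T0 : 0 <= T by apply: sumr_ge0 => l _; exact: modc_ge0.
pose C1 := 2 * (8 * (8 * S / b) / b) * N%:R * T ^+ 2.
pose C2 := N%:R * `|C1|.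
have C20 : 0 <= C2 by rewrite mulr_ge0.
(* along the line spanned by v the map h vanishes to second order *)
have hline t : 0 < t -> polydisc bN (t%:C%C *: v) ->
    \sum_i modc (h i (t%:C%C *: v)) <= C2 * t ^+ 2.
  move=> t0 ht; apply: (@le_trans _ _ (\sum_(i < N) `|C1| * t ^+ 2)); last first.
    by rewrite sumr_const card_ord -[leLHS]mulr_natl mulrA.
  apply: ler_sum => i _.
  have := hol_taylor1 b0 (Hhb i) ht; rewrite h0 subr0.
  have -> : \sum_l (t%:C%C *: v) 0 l * dpart l (h i) 0 = 0.
    under eq_bigr do rewrite mxE -mulrA.
    by rewrite -mulr_sumr hv mulr0.
  have -> : \sum_l modc ((t%:C%C *: v) 0 l) = t * T.
    rewrite mulr_sumr; apply: eq_bigr => l _.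
    by rewrite mxE modcM modc_real gtr0_norm.
  rewrite subr0 => /le_trans; apply.
  have -> : 2 * (8 * (8 * S / b) / b) * N%:R * (t * T) ^+ 2 = C1 * t ^+ 2 by rewrite /C1; ring.
  by apply: ler_wpM2r (ler_norm _); rewrite exprn_ge0// ltW.
pose C3 := K * s * C2.
have C30 : 0 <= C3 by rewrite !mulr_ge0// ltW.
pose C4 := 2 * (8 * (8 * S / b) / b) * (N + d)%:R.
(* over a point of the line there is a zero of g whose fibre coordinates are
   constant on the fibre of the finite map, hence of second order *)
have fib t : 0 < t -> polydisc s (t%:C%C *: v) -> polydisc bN (t%:C%C *: v) ->
    C2 * t ^+ 2 <= om -> C2 * t ^+ 2 <= om' ->
    exists eta : 'rV[C]_d, [/\ polydisc s eta, forall j, g j (row_mx (t%:C%C *: v) eta) = 0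
      & forall j, modc (eta 0 j) <= C3 * t ^+ 2].
  move=> t0 hs hN hom hom'.
  pose w := t%:C%C *: v.
  pose W (l : 'I_(N + d)) := match fintype.split l with inl i => h i w | inr _ => 0 end.
  have Wl i : W (lshift d i) = h i w by rewrite /W (unsplitK (inl i)).
  have Wr j : W (rshift N j) = 0 by rewrite /W (unsplitK (inr j)).
  have sW : \sum_l modc (W l) <= C2 * t ^+ 2.
    rewrite big_split_ord /= [X in _ + X]big1 => [|j _]; last by rewrite Wr modc0.
    by rewrite addr0; under eq_bigr do rewrite Wl; exact: hline.
  have over Y : cube a Y -> (forall l, fibred_map l Y = W l) ->
      polydisc s (row_mx w (rsubmx Y)) /\ forall j, g j (row_mx w (rsubmx Y)) = 0.
    move=> /cs hY GY.
    have hwY : polydisc s (row_mx w (rsubmx Y)).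
      by apply/polydisc_row; split=> // j; rewrite mxE.
    split=> //; apply: (@saturated (lsubmx Y)).
    - by rewrite hsubmxK; exact: polydiscW sr hY.
    - exact: polydiscW sr hwY.
    - by move=> i; rewrite -fibred_map_l GY Wl.
    - by move=> j; rewrite hsubmxK -fibred_map_r GY Wr.
  have [Y hY GY] := Honto W (le_trans sW hom').
  have [hwY gY] := over Y hY GY.
  exists (rsubmx Y); split=> // [|j]; first by have [] := (polydisc_row _ _ _).1 hwY.
  have fc Y' : cube a Y' -> (forall l, fibred_map l Y' = W l) ->
      Y' 0 (rshift N j) = rsubmx Y 0 j.
    move=> hY' GY'; have [hwY' gY'] := over Y' hY' GY'.
    have <- : rsubmx Y' = rsubmx Y by apply: (inj w) => // k; rewrite gY gY'.
    by rewrite mxE.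
  have Hc : hol (16 * a) s (fun Y : 'rV[C]_(N + d) => Y 0 (rshift N j)).
    by rewrite a16; exact: hol_coord.
  have u0 : (0 : 'rV[C]_(N + d)) 0 (rshift N j) = 0 by rewrite mxE.
  apply: le_trans (Hest s _ W _ Hc u0 (le_trans sW hom) fc) _.
  by rewrite /C3 -[leRHS]mulrA ler_wpM2l// mulr_ge0// ltW.
apply: modc_eq0; apply/eqP; rewrite eq_le modc_ge0 andbT.
have [e [e0 eb]] : exists e : R, 0 < e /\ [/\ e <= s, e <= bN & e <= bD].
  exists (Num.min s (Num.min bN bD)); rewrite !lt_min s0 bN0 bD0; split=> //.
  by rewrite !ge_min !lexx !orbT.
have [es eN eD] := eb.
have [t1 t10 Ht1] := @small_line v e e0.
pose t2 : R := Num.min 1 (Num.min (Num.min om om' / (C2 + 1)) (e / (C3 + 1))).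
have C2p : 0 < C2 + 1 by rewrite ltr_wpDl.
have C3p : 0 < C3 + 1 by rewrite ltr_wpDl.
have t20 : 0 < t2 by rewrite !lt_min ltr01 !divr_gt0// lt_min om0.
apply: (@linear_le_quadratic _ (C3 + C4 * (T + d%:R * C3) ^+ 2) (Num.min t1 t2)).
  by rewrite lt_min t10.
move=> t tp; rewrite le_min => /andP[/(Ht1 t tp) htv].
rewrite /t2 !le_min => /andP[tl1 /andP[]].
rewrite !ler_pdivlMr// le_min => /andP[tom tom'] tC3.
have t2t : t ^+ 2 <= t by rewrite expr2 ler_piMl// ltW.
have [||||eta [eS g0' eta2]] := fib t tp; try exact: polydiscW htv.
- by move: C2 C20 tom {C2p t2 t20 tom' hline C3 C30 C3p tC3 fib} => c; nra.
- by move: C2 C20 tom' {C2p t2 t20 tom hline C3 C30 C3p tC3 fib} => c; nra.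
have etae : polydisc e eta.
  move=> j; apply: le_lt_trans (eta2 j) _.
  by apply: lt_le_trans tC3; rewrite mulrDr mulr1; nra.
have hY : polydisc bD (row_mx (t%:C%C *: v) eta).
  by apply/polydisc_row; split; [exact: polydiscW htv|exact: polydiscW etae].
have := hol_taylor1 b0 (Hgb j0) hY; rewrite g0 g0' subr0 sub0r modcN -/C4.
set X := \sum_(l < N) _.
have -> : \sum_l row_mx (t%:C%C *: v) eta 0 l * dpart l (g j0) 0 = t%:C%C * X + eta 0 j0.
  rewrite big_split_ord /=; congr (_ + _).
    by rewrite mulr_sumr; apply: eq_bigr => l _; rewrite row_mxEl mxE mulrA.
  rewrite (bigD1 j0)//= row_mxEr g_graph eqxx mulr1 big1 ?addr0// => k /negbTE kj.
  by rewrite g_graph eq_sym kj mulr0.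
have -> : \sum_l modc (row_mx (t%:C%C *: v) eta 0 l) = t * T + \sum_k modc (eta 0 k).
  rewrite big_split_ord /=; congr (_ + _); last by apply: eq_bigr => k _; rewrite row_mxEr.
  rewrite mulr_sumr; apply: eq_bigr => l _.
  by rewrite row_mxEl mxE modcM modc_real gtr0_norm.
move=> Ht.
have se : \sum_k modc (eta 0 k) <= t * (d%:R * C3).
  apply: (@le_trans _ _ (\sum_(k < d) C3 * t)).
    by apply: ler_sum => k _; apply: le_trans (eta2 k) _; rewrite ler_wpM2l.
  rewrite sumr_const card_ord -[leLHS]mulr_natr le_eqVlt; apply/orP; left; apply/eqP.
  by ring.
have se0 : 0 <= \sum_k modc (eta 0 k) by apply: sumr_ge0 => k _; exact: modc_ge0.
have tX : t * modc X = modc (t%:C%C * X) by rewrite modcM modc_real gtr0_norm.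
have tX' : modc (t%:C%C * X) <= modc (t%:C%C * X + eta 0 j0) + modc (eta 0 j0).
  by rewrite -{1}(addrK (eta 0 j0) (t%:C%C * X)); exact: modcB.
have S0 : 0 <= S.
  have [hS _] := hol_g j0 (ltac:(by move=> l; rewrite mxE modc0) : polydisc r 0).
  by apply: le_trans hS; exact: modc_ge0.
have q0 : 0 <= 8 * (8 * S / b) / b by rewrite !(divr_ge0, mulr_ge0)// ltW.
have C40 : 0 <= C4 by rewrite /C4 mulr_ge0// mulr_ge0.
have e2 := eta2 j0.
have sq : (t * T + \sum_k modc (eta 0 k)) ^+ 2 <= (T + d%:R * C3) ^+ 2 * t ^+ 2.
  have TdC : 0 <= T + d%:R * C3 by rewrite addr_ge0// mulr_ge0.
  rewrite -exprMn; apply: lerXn2r; rewrite ?nnegrE.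
  - by rewrite addr_ge0// mulr_ge0// ltW.
  - by rewrite mulr_ge0// ltW.
  - by rewrite mulrDl mulrC lerD2l mulrC.
have := ler_wpM2l C40 sq; rewrite mulrA => sq'.
rewrite tX mulrDl; move: e2 Ht tX' sq'; clear; lra.
Qed.

End Transversality.

(** * Differentials and polydiscs *)

Section Norms.
Variable (R : realType).
Local Notation C := R[i].

Lemma complex_gt0 (e : C) : 0 < e -> e = (complex.Re e)%:C%C /\ 0 < complex.Re e.
Proof.
by case: e => a b; rewrite ltcE /= => /andP[/eqP -> a0]; split.
Qed.

(** Balls for the norm are products of balls, so that strict bounds can be read
    off coordinatewise. *)
Lemma row_norm_lt n (Z : 'rV[C]_n) (c : R) : 0 < c -> (`|Z| < c%:C%C) <-> polydisc c Z.
Proof.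
move=> c0; have c0' : 0 < c%:C%C by rewrite ltcR.
have -> : (`|Z| < c%:C%C) = ball (0 : 'rV[C]_n) c%:C%C Z :> Prop.
  by rewrite mx_norm_ball /ball_ /= sub0r normrN.
split=> [[_ H] l|H]; last (split=> // i l; rewrite ord1; have := H l).
  by have := H 0 l; rewrite -ball_normE /ball_ /= mxE sub0r normrN ltcR.
by rewrite -ball_normE /ball_ /= mxE sub0r normrN ltcR.
Qed.

Lemma real_row_norm_lt n (x : 'rV[R]_n) (c : R) : 0 < c ->
  (`|x| < c) <-> forall l, `|x 0 l| < c.
Proof.
move=> c0; have -> : (`|x| < c) = ball (0 : 'rV[R]_n) c x :> Prop.
  by rewrite mx_norm_ball /ball_ /= sub0r normrN.
split=> [[_ H] l|H]; last (split=> // i l; rewrite ord1; have := H l).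
  by have := H 0 l; rewrite -ball_normE /ball_ /= mxE sub0r normrN.
by rewrite -ball_normE /ball_ /= mxE sub0r normrN.
Qed.

Lemma near_polydisc n (p : 'rV[C]_n) (P : set 'rV[C]_n) : (\forall Z \near p, P Z) ->
  exists2 r : R, 0 < r & forall Z, polydisc r Z -> P (p + Z).
Proof.
move=> /nbhs_normP[e /complex_gt0[-> e0] H]; exists (complex.Re e) => // Z hZ.
by apply: H; rewrite /ball_ /= opprD addrA subrr sub0r normrN; apply/row_norm_lt.
Qed.

Lemma near_polydisc2 n m (p : 'rV[C]_n) (q : 'rV[C]_m) (P : set ('rV[C]_n * 'rV[C]_m)) :
    (\forall w \near (p, q), P w) ->
  exists2 r : R, 0 < r & forall Z Y, polydisc r Z -> polydisc r Y -> P (p + Z, q + Y).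
Proof.
move=> [[A B] /= [/near_polydisc[r r0 HA] /near_polydisc[s s0 HB]] H].
exists (Num.min r s) => [|Z Y hZ hY]; first by rewrite lt_min r0.
apply: H; split=> /=; [apply: HA|apply: HB].
  by apply: polydiscW hZ; rewrite ge_min lexx.
by apply: polydiscW hY; rewrite ge_min lexx orbT.
Qed.

Lemma pair_norm_lt n m (Z : 'rV[C]_n) (Y : 'rV[C]_m) (c : R) : 0 < c ->
  (`|(Z, Y)| < c%:C%C) <-> polydisc c Z /\ polydisc c Y.
Proof.
move=> c0; rewrite prod_normE /=; rewrite comparable_gt_max ?real_comparable ?normr_real//.
by split=> [/andP[/(row_norm_lt _ c0) ? /(row_norm_lt _ c0) ?]|[/(row_norm_lt _ c0) ? /(row_norm_lt _ c0) ?]]; [|apply/andP].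
Qed.

(** Restricting to a complex line turns a differential over [R[i]] into a complex
    derivative; this yields both separate holomorphy and the values of the partial
    derivatives. *)
Lemma differential_line (V : normedModType C) n (f : V -> 'rV[C]_n) x v j :
  differentiable f x ->
  complex_derivative_at (fun t => f (x + t *: v) 0 j) 0 ('d f x v 0 j).
Proof.
move=> df e e0; have := diff_derivable (v := v) df; rewrite /derivable => cv.
have {cv} : (fun h : C => h^-1 *: ((f \o shift x) (h *: v) - f x)) @ 0^' --> 'd f x v.
  by rewrite -deriveE.
have e0' : 0 < e%:C%C by rewrite ltcR.
move=> /cvgrPdist_lt /(_ _ e0').
rewrite /= -nbhs_nearE /dnbhs /within /=.
move=> /nbhs_normP[d /complex_gt0[-> d0] H]; exists (complex.Re d) => // h hd.
rewrite add0r scale0r addr0.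
have [->|hn] := eqVneq h 0.
  by rewrite scale0r addr0 subrr mulr0 subr0 modc0 mulr0.
have : `|'d f x v - h^-1 *: (f (h *: v + x) - f x)| < e%:C%C.
  by apply: H hn; rewrite /ball_ /= sub0r normrN ltcR.
move=> /(row_norm_lt _ e0) /(_ j); rewrite !mxE [h *: v + x]addrC => L.
rewrite (_ : f (x + h *: v) 0 j - f x 0 j - 'd f x v 0 j * h =
  - (h * ('d f x v 0 j - h^-1 * (f (x + h *: v) 0 j - f x 0 j)))).
  by rewrite modcN modcM mulrC ler_wpM2r ?modc_ge0// ltW.
by field.
Qed.

Lemma differential_expansion n m k (f : 'rV[C]_n * 'rV[C]_m -> 'rV[C]_k) p q (e : R) :
  differentiable f (p, q) -> 0 < e -> exists2 r : R, 0 < r & forall c Z Y, 0 < c -> c <= r ->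
    polydisc c Z -> polydisc c Y ->
    polydisc (e * c) (f (p + Z, q + Y) - f (p, q) - 'd f (p, q) (Z, Y)).
Proof.
move=> df e0; have e0' : 0 < e%:C%C by rewrite ltcR.
have := diff_locally df => /eqaddoP /(_ _ e0').
move=> /near_polydisc2[r r0 H]; exists r => // c Z Y c0 cr hZ hY.
have := H Z Y (polydiscW cr hZ) (polydiscW cr hY).
rewrite !add0r /= => L; apply/row_norm_lt; first exact: mulr_gt0.
have : `|(Z, Y)| < c%:C%C by apply/pair_norm_lt.
have -> : f (p + Z, q + Y) - f (p, q) - 'd f (p, q) (Z, Y) =
  f ((Z, Y) + (p, q)) - (f (p, q) + 'd f (p, q) (Z, Y)).
  by rewrite opprD addrA; congr (f _ - _ - _); congr (_, _); rewrite addrC.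
move=> ZYc; apply: le_lt_trans L _.
by rewrite rmorphM ltr_pM2l.
Qed.

End Norms.

Section RealDifferential.
Variables (R : realType) (N d : nat).
Local Notation C := R[i].
Variables (rho : 'rV[C]_N -> 'rV[R]_d) (rhoC : 'rV[C]_N * 'rV[C]_N -> 'rV[C]_d).
Variable (p0 : 'rV[C]_N).
Hypothesis diff_rhoC : differentiable rhoC (p0, conj_row p0).
Hypothesis diagonal : \forall Z \near p0, rhoC (Z, conj_row Z) = map_mx (real_complex R) (rho Z).

Local Notation D := ('d rhoC (p0, conj_row p0)).

Lemma to_realK (Z : 'rV[C]_N) : to_complex (to_real Z) = Z.
Proof. by apply/rowP => j; rewrite mxE row_mxEl row_mxEr !mxE; case: (Z 0 j). Qed.

Lemma to_complexD (x y : 'rV[R]_(N + N)) : to_complex (x + y) = to_complex x + to_complex y.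
Proof. by apply/rowP => j; rewrite !mxE. Qed.

Lemma to_complexZ (t : R) (x : 'rV[R]_(N + N)) : to_complex (t *: x) = t%:C%C *: to_complex x.
Proof. by apply/rowP => j; rewrite !mxE /real_complex_def; simpc. Qed.

Lemma conj_rowD (Z Y : 'rV[C]_N) : conj_row (Z + Y) = conj_row Z + conj_row Y.
Proof. by apply/rowP => j; rewrite !mxE rmorphD. Qed.

Lemma conj_rowZ (c : C) (Z : 'rV[C]_N) : conj_row (c *: Z) = conjc c *: conj_row Z.
Proof. by apply/rowP => j; rewrite !mxE rmorphM. Qed.

Lemma polydisc_conj r (Z : 'rV[C]_N) : polydisc r (conj_row Z) <-> polydisc r Z.
Proof. by split=> H j; have := H j; rewrite mxE modc_conj. Qed.

Lemma diagonal_base : rhoC (p0, conj_row p0) = map_mx (real_complex R) (rho p0).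
Proof. exact: nbhs_singleton diagonal. Qed.

Lemma diagonal_expansion e : 0 < e -> exists2 r : R, 0 < r & forall c Z, 0 < c -> c <= r ->
  polydisc c Z -> polydisc (e * c)
    (map_mx (real_complex R) (rho (p0 + Z) - rho p0) - D (Z, conj_row Z)).
Proof.
move=> e0; have [r r0 H] := differential_expansion diff_rhoC e0.
have [s s0 Hs] := near_polydisc diagonal.
exists (Num.min r s) => [|c Z c0]; first by rewrite lt_min r0.
rewrite le_min => /andP[cr cs] hZ.
have := H c Z (conj_row Z) c0 cr hZ ((polydisc_conj _ _).2 hZ).
by rewrite -conj_rowD (Hs _ (polydiscW cs hZ)) diagonal_base map_mxB.
Qed.

(** On the diagonal [rhoC] is real, and so are its increments along
    [(t v, t conj v)] for real [t]. *)
Lemma differential_diagonal_real v j : complex.Im (D (v, conj_row v) 0 j) = 0.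
Proof.
apply/eqP; rewrite -normr_le0; apply/ler_addgt0Pl => e0 e00; rewrite addr0.
pose T := \sum_l modc (v 0 l) + 1.
have vT : polydisc T v.
  move=> l; rewrite /T (bigD1 l)//= -addrA ltrDl ltr_wpDl//.
  by apply: sumr_ge0 => k _; exact: modc_ge0.
have T0 : 0 < T by rewrite ltr_wpDl// sumr_ge0// => l _; exact: modc_ge0.
have [r r0 H] := diagonal_expansion (divr_gt0 e00 T0).
pose t := r / T; have t0 : 0 < t by rewrite divr_gt0.
have ht : polydisc r (t%:C%C *: v).
  move=> l; rewrite mxE modcM modc_real gtr0_norm// /t mulrAC ltr_pdivrMr//.
  by rewrite ltr_pM2l.
have := H r _ r0 (lexx _) ht j; rewrite !mxE.
have -> : (t%:C%C *: v, conj_row (t%:C%C *: v)) = t%:C%C *: (v, conj_row v).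
  by rewrite conj_rowZ conjc_real.
rewrite linearZ /= mxE => L.
have : t * `|complex.Im (D (v, conj_row v) 0 j)| < e0 / T * r.
  apply: le_lt_trans L; apply: le_trans (Im_le_modc _).
  case: (D _ 0 j) => a b; rewrite /real_complex_def /=; simpc => /=.
  by rewrite normrN normrM gtr0_norm.
have -> : e0 / T * r = t * e0 by rewrite /t; ring.
by rewrite ltr_pM2l// => /ltW.
Qed.

(** The candidate for the differential of [rho] in real coordinates; the real part
    is all of the value by [differential_diagonal_real]. *)
Definition real_part_differential (x : 'rV[R]_(N + N)) : 'rV[R]_d :=
  map_mx (@complex.Re R) (D (to_complex x, conj_row (to_complex x))).

Lemma real_part_differential_linear : linear real_part_differential.
Proof.
move=> t x y; apply/rowP => j; rewrite !mxE to_complexD to_complexZ conj_rowD conj_rowZ conjc_real.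
have -> : (t%:C%C *: to_complex x + to_complex y,
    t%:C%C *: conj_row (to_complex x) + conj_row (to_complex y)) =
  t%:C%C *: (to_complex x, conj_row (to_complex x)) + (to_complex y, conj_row (to_complex y)).
  by [].
rewrite linearP !mxE Re_add.
by case: (D _ 0 j) => a b; rewrite /real_complex_def; simpc.
Qed.

HB.instance Definition _ := GRing.isLinear.Build R _ _ _ real_part_differential
  real_part_differential_linear.

Lemma near_real_row (c : R) : 0 < c -> \forall x \near (0 : 'rV[R]_(N + N)), `|x| < c.
Proof. exact: pseudometric_normed_Zmodule.nbhs0_lt. Qed.

Lemma polydisc_to_complex (h : 'rV[R]_(N + N)) c : 0 < c -> `|h| < c -> polydisc (2 * c) (to_complex h).
Proof.
move=> c0 /(real_row_norm_lt _ c0) hc j; rewrite mxE.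
apply: le_lt_trans (modc_le_ReIm _) _ => /=.
by have := hc (lshift N j); have := hc (rshift N j); lra.
Qed.

Lemma real_differential_part h :
  'd (fun x => rho (to_complex x)) (to_real p0) h = real_part_differential h.
Proof.
suff -> : 'd (fun x => rho (to_complex x)) (to_real p0) = real_part_differential :> (_ -> _) by [].
apply: diff_unique.
  apply: bounded_linear_continuous; apply/ex_bound; exists 1.
  have : {for 0, continuous D} by apply: diff_continuous.
  rewrite /prop_for /continuous_at linear0 => /cvgrPdist_lt /(_ 1 ltr01).
  move=> /near_polydisc2[r r0 H].
  have r20 : 0 < r / 2 by rewrite divr_gt0.
  near=> y.
  have hr : `|y| < r / 2 by near: y; exact: near_real_row.
  rewrite /=.
  have := polydisc_to_complex r20 hr; rewrite mulrC divfK ?pnatr_eq0// => hp.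
  have := H _ _ hp ((polydisc_conj _ _).2 hp).
  rewrite !add0r normrN => /(row_norm_lt _ ltr01) h1.
  apply/ltW/real_row_norm_lt => // l; rewrite mxE.
  by apply: le_lt_trans (Re_le_modc _) (h1 l).
apply/eqaddoP => e e0.
have e30 : 0 < e / 3 by rewrite divr_gt0.
have [r r0 H] := diagonal_expansion e30.
near=> y.
have yr : `|y| < r / 3 by near: y; apply: near_real_row; rewrite divr_gt0.
rewrite !fctE /= to_complexD to_realK [to_complex y + _]addrC.
have [->|y0] := eqVneq y 0.
  have -> : to_complex (0 : 'rV[R]_(N + N)) = 0 by apply/rowP => j; rewrite !mxE.
  by rewrite linear0 !addr0 subrr !normr0 mulr0.
have y1 : 0 < `|y| by rewrite normr_gt0.
have y2 : `|y| < 3 / 2 * `|y| by lra.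
have c0 : 0 < 3 * `|y| by lra.
have hp : polydisc (3 * `|y|) (to_complex y).
  have := polydisc_to_complex (lt_trans y1 y2) y2.
  by rewrite (_ : 2 * (3 / 2 * `|y|) = 3 * `|y|) //; field.
have cr : 3 * `|y| <= r by lra.
have := H _ _ c0 cr hp; rewrite (_ : e / 3 * (3 * `|y|) = e * `|y|); last by field.
move=> hj; apply/ltW/real_row_norm_lt => [|l]; first exact: mulr_gt0.
apply: le_lt_trans (hj l); apply: le_trans (Re_le_modc _); rewrite !mxE.
case: (D _ 0 l) => a b /=; rewrite /real_complex_def; simpc => /=.
by rewrite addrA.
Unshelve. all: by end_near. Qed.

Lemma real_differential h :
  map_mx (real_complex R) ('d (fun x => rho (to_complex x)) (to_real p0) h) =
  D (to_complex h, conj_row (to_complex h)).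
Proof.
rewrite real_differential_part; apply/rowP => j; rewrite !mxE.
have := differential_diagonal_real (to_complex h) j.
by case: (D _ 0 j) => a b /= ->.
Qed.

End RealDifferential.

(** * Generic submanifolds and the rank of the Jacobian *)

Section LinearAlgebra.
Variables (R : realType) (N d : nat).
Local Notation C := R[i].
Variable D : {linear ('rV[C]_N * 'rV[C]_N)%type -> 'rV[C]_d}.

Lemma linear_fst (I : finType) (c : I -> C) (z : I -> 'rV[C]_N) :
  D (\sum_i c i *: z i, 0) = \sum_i c i *: D (z i, 0).
Proof.
have -> : (\sum_i c i *: z i, 0) = \sum_i c i *: (z i, 0) :> ('rV[C]_N * 'rV[C]_N)%type.
  elim/big_ind2: _ => [//|x ? y ? <- <-|i _].
    by congr (_, _); rewrite /= addr0.
  by congr (_, _); rewrite /= scaler0.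
by rewrite linear_sum; apply: eq_bigr => i _; rewrite linearZ.
Qed.

Hypothesis onto : forall b : 'rV[R]_d, exists w, D (w, conj_row w) = map_mx (real_complex R) b.
Hypothesis tangent_span : forall w, exists u v,
  [/\ w = u + 'i%C *: v, D (u, conj_row u) = 0 & D (v, conj_row v) = 0].

(** If [w = u + i v] with [u] and [v] tangent, then
    [D (w, conj w) = i D (v, - conj v)], and [(v, - conj v)] agrees up to sign with
    [2 (v, 0)] and with [2 (0, conj v)] modulo [(v, conj v)], where [D]
    vanishes. *)
Lemma partial_differentials_onto (b : 'rV[R]_d) :
  (exists z, D (z, 0) = map_mx (real_complex R) b) /\
  (exists z, D (0, z) = map_mx (real_complex R) b).
Proof.
have [w <-] := onto b; have [u [v [-> Du Dv]]] := tangent_span w.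
have ci : conjc 'i%C = - 'i%C :> C by rewrite /=; simpc.
have E : (u + 'i%C *: v, conj_row (u + 'i%C *: v)) =
    (u, conj_row u) + 'i%C *: (v, - conj_row v) :> ('rV[C]_N * 'rV[C]_N)%type.
  by rewrite conj_rowD conj_rowZ ci scaleNr -scalerN.
rewrite E linearD Du add0r; split.
  exists (('i%C * 2) *: v).
  have -> : (v, - conj_row v) = 2 *: (v, 0) - (v, conj_row v) :> ('rV[C]_N * 'rV[C]_N)%type.
    by congr (_, _); rewrite /= ?scaler0 ?add0r// scaler_nat mulr2n addrK.
  rewrite linearZ linearB Dv subr0 -linearZ; congr (D _); congr (_, _); rewrite /= ?scaler0//.
  by rewrite scalerA.
exists ((- 'i%C * 2) *: conj_row v).
have -> : (v, - conj_row v) = (v, conj_row v) - 2 *: (0, conj_row v) :> ('rV[C]_N * 'rV[C]_N)%type.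
  congr (_, _); rewrite /= ?scaler0 ?subr0// scaler_nat mulr2n opprD addrA subrr add0r//.
rewrite linearZ linearB Dv add0r -linearN -linearZ; congr (D _); congr (_, _).
  by rewrite /= scaler0 oppr0 scaler0.
by rewrite /= scalerN scalerA mulNr scaleNr.
Qed.

End LinearAlgebra.

Lemma mxrank_ge_kernel (F : fieldType) (m n d : nat) (J : 'M[F]_(m, n)) (A : 'M[F]_(m, d)) :
  (forall v : 'rV_m, v *m J = 0 -> v *m A = 0) -> (\rank A <= \rank J)%N.
Proof.
move=> H; have : (kermx J <= kermx A)%MS.
  apply/sub_kermxP/row_matrixP => i; rewrite row_mul row0.
  by apply: H; rewrite -row_mul mulmx_ker row0.
move=> /mxrankS; rewrite !mxrank_ker.
by have := rank_leq_row J; have := rank_leq_row A; lia.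
Qed.

Lemma polydisc_mulmx (R : realType) (d N : nat) (B : 'M[R[i]]_(d, N)) (e : R) : 0 < e ->
  exists2 s : R, 0 < s & forall eta, polydisc s eta -> polydisc e (eta *m B).
Proof.
move=> e0; pose T := \sum_i \sum_k modc (B k i) + 1.
have T1 i : \sum_k modc (B k i) <= T - 1.
  rewrite /T addrK [leRHS](bigD1 i)//= lerDl.
  by apply: sumr_ge0 => j _; apply: sumr_ge0 => k _; exact: modc_ge0.
have T0 : 0 < T.
  by rewrite ltr_wpDl// sumr_ge0// => i _; apply: sumr_ge0 => k _; exact: modc_ge0.
exists (e / T) => [|eta he i]; first exact: divr_gt0.
rewrite mxE; apply: le_lt_trans (modc_sum _ _ _) _.
apply: (@le_lt_trans _ _ (\sum_k e / T * modc (B k i))).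
  by apply: ler_sum => k _; rewrite modcM ler_wpM2r ?modc_ge0// ltW.
rewrite -mulr_sumr mulrAC ltr_pdivrMr// ltr_pM2l//.
by have := T1 i; lra.
Qed.
Theorem corollary1p9 (R : realType) (N d : nat)
    (M : set 'rV[R[i]]_N) (rho : 'rV[R[i]]_N -> 'rV[R]_d)
    (rhoC : 'rV[R[i]]_N * 'rV[R[i]]_N -> 'rV[R[i]]_d)
    (p0 q0 : 'rV[R[i]]_N) (H : 'rV[R[i]]_N -> 'rV[R[i]]_N)
    (M_submanifold : real_analytic_submanifold M rho p0)
    (M_generic : generic M rho p0)
    (M_finite_type : finite_type M rho p0)
    (rhoC_complexification : complexification rho p0 rhoC)
    (H_holomorphic : holomorphic_germ H p0 q0)
    (H_finite : finite_germ H p0 q0)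
    (H_saturated : germ_saturated (complexify_map H) [set w | rhoC w = 0]
                     (p0, conj_row p0)) :
  (d <= \rank ('J H p0))%N.
Proof.
have [Mp0 _ indep M_eq] := M_submanifold.
have [near_diff diagonal] := rhoC_complexification.
set w0 := (p0, conj_row p0) in near_diff H_saturated.
have diff0 : differentiable rhoC w0 by exact: nbhs_singleton near_diff.
have rhoC0 : rhoC w0 = 0.
  have /(_ Mp0) rho0 := (nbhs_singleton M_eq).1.
  by rewrite (nbhs_singleton diagonal) rho0 map_mx0.
pose D := 'd rhoC w0.
have realD h : map_mx (real_complex R) ('d (fun x => rho (to_complex x)) (to_real p0) h) =
    D (to_complex h, conj_row (to_complex h)) := real_differential diff0 diagonal h.
have onto b : exists w, D (w, conj_row w) = map_mx (real_complex R) b.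
  have /row_fullP[X XJ] : row_full ('J (fun x => rho (to_complex x)) (to_real p0)).
    by move: indep; rewrite /row_free /row_full mxrank_tr.
  exists (to_complex (b *m X)); rewrite -realD; congr (map_mx _ _).
  by rewrite -mul_rV_lin1 -/(jacobian _ _) -mulmxA XJ mulmx1.
have span w : exists u v,
    [/\ w = u + 'i%C *: v, D (u, conj_row u) = 0 & D (v, conj_row v) = 0].
  have : [set: 'rV[R[i]]_N] w by [].
  rewrite -(nbhs_singleton M_generic Mp0) => -[u Tu [v Tv <-]]; exists u, v; split=> //.
    by rewrite -{1 2}(to_realK u) -realD Tu map_mx0.
  by rewrite -{1 2}(to_realK v) -realD Tv map_mx0.
have unit_row k : map_mx (real_complex R) (delta_mx 0 k) = delta_mx 0 k :> 'rV[R[i]]_d.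
  by rewrite map_delta_mx.
have /choice[a aP] k : exists z, D (z, 0) = delta_mx 0 k.
  by rewrite -unit_row; have [] := partial_differentials_onto onto span (delta_mx 0 k).
have /choice[b bP] k : exists z, D (0, z) = delta_mx 0 k.
  by rewrite -unit_row; have [] := partial_differentials_onto onto span (delta_mx 0 k).
(* right inverses of the two partial differentials of rhoC *)
pose A := \matrix_k a k; pose B := \matrix_k b k.
pose DZ := \matrix_(l < N) D (delta_mx 0 l, 0).
have ADZ : A *m DZ = 1%:M.
  apply/row_matrixP => k; rewrite row_mul rowK row1 -aP mulmx_sum_row.
  by rewrite [in RHS](row_sum_delta (a k)) linear_fst; apply: eq_bigr => l _; rewrite rowK.
have rkDZ : (d <= \rank DZ)%N by rewrite -{1}(mxrank1 R[i] d) -ADZ mxrankM_maxr.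
apply: (leq_trans rkDZ); apply: mxrank_ge_kernel => v vJ.
(* the second variable is restricted to the image of B *)
pose pt (Y : 'rV[R[i]]_(N + d)) := (p0 + lsubmx Y, conj_row p0 + rsubmx Y *m B).
pose h i (Z : 'rV[R[i]]_N) := (H (p0 + Z) - q0) 0 i.
pose g j (Y : 'rV[R[i]]_(N + d)) := rhoC (pt Y) 0 j.
have [Hp0 near_H] := H_holomorphic.
have small_H : \forall Z \near p0, `|H p0 - H Z| < 1.
  have cH : {for p0, continuous H}.
    by apply: differentiable_continuous; exact: nbhs_singleton near_H.
  by move/cvgrPdist_lt : cH => /(_ 1 ltr01).
have [r1 r10 H1] := near_polydisc (filterI near_H small_H).
have [U [[oU Up0] Upre]] := H_finite.
have [r2 r20 H2] := near_polydisc (open_nbhs_nbhs (conj oU Up0)).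
have [U0 [nU0 /(_ U0 nU0 (@subset_refl _ U0)) satU0]] := H_saturated.
have small : \forall w \near w0, `|rhoC w0 - rhoC w| < 1.
  have cr : {for w0, continuous rhoC} by exact: differentiable_continuous.
  by move/cvgrPdist_lt : cr => /(_ 1 ltr01).
have [r3 r30 H3] := near_polydisc2 (filterI near_diff (filterI small (filterI nU0 satU0))).
have [s s0 Hs] := polydisc_mulmx B r30.
have [r [r0 rr1 rr2 rr3 rrs]] : exists r : R, [/\ 0 < r, r <= r1, r <= r2, r <= r3 & r <= s].
  exists (Num.min (Num.min r1 r2) (Num.min r3 s)).
  by rewrite !lt_min r10 r20 r30 s0 !ge_min !lexx !orbT.
have Hpt (Y : 'rV[R[i]]_(N + d)) : polydisc r Y -> polydisc r3 (lsubmx Y) /\ polydisc r3 (rsubmx Y *m B).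
  move=> hY; split; first by move=> i; rewrite mxE; exact: (polydiscW rr3 hY (lshift d i)).
  by apply: Hs => i; rewrite mxE; exact: (polydiscW rrs hY (rshift N i)).
have pt0 : pt 0 = w0 by rewrite /pt linear0 linear0 mul0mx !addr0.
have ptD l t Y : pt (move_coord l t Y) =
    pt Y + t *: (lsubmx (delta_mx 0 l), rsubmx (delta_mx 0 l) *m B).
  by rewrite /pt /move_coord !linearD !linearZ /= mulmxDl -scalemxAl !addrA.
have dg j l Y : differentiable rhoC (pt Y) ->
    complex_derivative_at (fun t => g j (move_coord l t Y)) 0
      ('d rhoC (pt Y) (lsubmx (delta_mx 0 l), rsubmx (delta_mx 0 l) *m B) 0 j).
  move=> dY; apply: complex_derivative_ext (differential_line _ j dY) => t.
  by rewrite /g ptD.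
have dh i l Z : differentiable H (p0 + Z) ->
    complex_derivative_at (fun t => h i (move_coord l t Z)) 0 ('d H (p0 + Z) (delta_mx 0 l) 0 i).
  move=> dZ; have := complex_derivativeD (differential_line (delta_mx 0 l) i dZ)
    (complex_derivative_affine 0 (- q0 0 i) 0).
  rewrite addr0; apply: complex_derivative_ext => t.
  by rewrite /h /move_coord addrA !mxE mul0r add0r.
have hol_h i : hol r 1 (h i).
  move=> Z /(polydiscW rr1) /H1[dH HZ]; split=> [|l]; last by eexists; exact: dh.
  rewrite /h -Hp0; apply: ltW; move: HZ; rewrite distrC.
  by move/(row_norm_lt _ ltr01); apply.
have hol_g j : hol r 1 (g j).
  move=> Y /Hpt[hl hr]; have [dR [RY _]] := H3 _ _ hl hr.
  split=> [|l]; last by eexists; exact: dg.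
  move: RY; rewrite rhoC0 sub0r normrN => /(row_norm_lt _ ltr01) RY.
  exact: ltW (RY j).
have h0 i : h i 0 = 0 by rewrite /h addr0 Hp0 subrr mxE.
have g0 j : g j 0 = 0 by rewrite /g pt0 rhoC0 mxE.
have h_isolated Z : polydisc r Z -> (forall i, h i Z = 0) -> Z = 0.
  move=> hZ hZ0; have UZ : U (p0 + Z) by apply: H2; exact: polydiscW hZ.
  have : ((H @^-1` [set q0]) `&` U) (p0 + Z).
    split=> //=; apply/eqP; rewrite -subr_eq0; apply/eqP/rowP => i.
    by rewrite [RHS]mxE; exact: hZ0.
  by rewrite Upre /= => E; apply: (addrI p0); rewrite addr0.
have g_graph j k : dpart (rshift N k) (g j) 0 = (j == k)%:R.
  have := dg j (rshift N k) 0; rewrite pt0 => /(_ diff0) /dpartE ->.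
  have -> : lsubmx (delta_mx 0 (rshift N k)) = 0 :> 'rV[R[i]]_N.
    by apply/rowP => l; rewrite !mxE eq_lrshift.
  have -> : rsubmx (delta_mx 0 (rshift N k)) = delta_mx 0 k :> 'rV[R[i]]_d.
    by apply/rowP => l; rewrite !mxE eq_rshift.
  by rewrite -rowE rowK bP mxE.
have saturated Z Z' eta : polydisc r (row_mx Z eta) -> polydisc r (row_mx Z' eta) ->
    (forall i, h i Z = h i Z') -> (forall j, g j (row_mx Z eta) = 0) ->
    forall j, g j (row_mx Z' eta) = 0.
  move=> hY hY' hE gY j.
  have [hl hr] := Hpt _ hY; have [_ [_ [UY _]]] := H3 _ _ hl hr.
  have [hl' hr'] := Hpt _ hY'; have [_ [_ [_ satY]]] := H3 _ _ hl' hr'.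
  suff : rhoC (pt (row_mx Z' eta)) = 0 by rewrite /g => ->; rewrite mxE.
  apply/satY; exists (pt (row_mx Z eta)).
    by split=> //=; apply/rowP => i; rewrite [RHS]mxE; exact: gY.
  rewrite /pt !row_mxKl !row_mxKr /complexify_map /=; congr (_, _).
  by apply: (addIr (- q0)); apply/rowP => i; exact: hE.
have := kernel_transversal r0 hol_h hol_g h0 g0 h_isolated g_graph saturated (v := v).
have dh0 : differentiable H (p0 + 0) by rewrite addr0; exact: nbhs_singleton near_H.
move=> T; apply/rowP => j; rewrite [LHS]mxE [RHS]mxE -[RHS](T _ j).
  apply: eq_bigr => l _; congr (_ * _).
  have := dg j (lshift d l) 0; rewrite pt0 => /(_ diff0) /dpartE ->.
  have -> : lsubmx (delta_mx 0 (lshift d l)) = delta_mx 0 l :> 'rV[R[i]]_N.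
    by apply/rowP => k; rewrite !mxE eq_lshift.
  have -> : rsubmx (delta_mx 0 (lshift d l)) = 0 :> 'rV[R[i]]_d.
    by apply/rowP => k; rewrite !mxE eq_rlshift.
  by rewrite mul0mx mxE.
move=> i; have /rowP/(_ i) vJi := vJ; rewrite [LHS]mxE [RHS]mxE in vJi; rewrite -[RHS]vJi.
apply: eq_bigr => l _; congr (_ * _).
by have /dpartE -> := dh i l 0 dh0; rewrite addr0 mxE.
Qed.
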